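(* Let $X$ be a K\''ahler surface with $b_2^+(X)>1$ and let $E$ be a Hermitian bundle on $X$ of rank $n\geq 2$ whose first Chern class $c_1^{\mathbb{R}}(E)$ is of type $(1,1)$. Then for any self-dual imaginary-valued 2-form $\eta$ with $\eta^{2,0}$ holomorphic and non-zero (not identically zero) and any constant $\tau\in(0,1]$, the moduli space $M_{\mathfrak{c},E}(\tau,\eta)$ of $U(n)$ monopoles is empty.
   Context: $X$ is a closed connected K\''ahler surface with K\''ahler form $\omega_g$; $\Lambda_g$ is contraction with $\omega_g$ (the adjoint of exterior multiplication by $\omega_g$). $c_1^{\mathbb{R}}(E)$ is the image of $c_1(E)$ in $H^2(X;\mathbb{C})=H^{2,0}_{\bar\partial}\oplus H^{1,1}_{\bar\partial}\oplus H^{0,2}_{\bar\partial}$. $\mathfrak{c}$ denotes the canonical $Spin^c$ structure, with spinor bundles $S^+_{\mathfrak{c}}=\Lambda^{0,0}\oplus\Lambda^{0,2}$ and $S^-_{\mathfrak{c}}=\Lambda^{0,1}$ and background $Spin^c$ connection induced by the Levi-Civita connection. A spinor in $\Gamma(S^+_{\mathfrak{c}}\otimes E)$ is a pair $\Psi=(\alpha,\beta)$, $\alpha\in\Omega^{0,0}(X;E)$, $\beta\in\Omega^{0,2}(X;E)$. For a unitary connection $A$ in $E$, $\bar\partial_A:\Omega^{p,q}(E)\to\Omega^{p,q+1}(E)$ is the $(p,q+1)$-part of $d_A$, $\bar\partial_A^*$ its formal $L^2$-adjoint, and $F_A$ the curvature. For an endomorphism $f$ of $E$ (possibly form-valued),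 $\{f\}_\tau=(f)_0+\frac{\tau}{n}\mathrm{tr}(f)\,\mathrm{id}_E$, with $(f)_0$ the trace-free part. $\alpha\alpha^*\in\Gamma(\mathrm{End}\,E)$, $\beta\alpha^*\in\Omega^{0,2}(\mathrm{End}\,E)$, and $\beta\beta^*=*(\beta\wedge\bar\beta)\in\Gamma(\mathrm{End}\,E)$, formed using the Hermitian structures. The moduli space $M_{\mathfrak{c},E}(\tau,\eta)$ is the set of pairs $((\alpha,\beta),A)$ satisfying the $U(n)$ monopole equations $$\bar\partial_A\alpha+\bar\partial_A^*\beta=0,\qquad F_A^{0,2}=\tfrac14\{\beta\alpha^*\}_\tau+\eta^{0,2}\,\mathrm{id}_E,\qquad -i\Lambda_g(F_A)=\tfrac18\{\alpha\alpha^*-\beta\beta^*\}_\tau-i\Lambda_g(\eta)\,\mathrm{id}_E,$$ modulo the group of unitary automorphisms of $E$. *)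

(* Defs.v *)
From HB Require Import structures.
From mathcomp Require Import all_boot all_order all_algebra.
From mathcomp Require Import all_classical all_reals all_analysis.
From mathcomp Require Import complex.
Set Implicit Arguments.
Unset Strict Implicit.
Unset Printing Implicit Defensive.
Import Order.TTheory GRing.Theory Num.Theory numFieldNormedType.Exports.
Local Open Scope classical_set_scope.
Local Open Scope ring_scope.
Local Open Scope complex_scope.

(* MathComp-Analysis has no manifolds, so the geometry is set up here in
   charts.  A complex surface is modelled on R^4 with coordinates
   (x1, y1, x2, y2), z1 = x1 + i y1, z2 = x2 + i y2.  Tensor fields are
   families of component functions, one for each chart, obeying the usual
   transformation rules; only the values on the chart domains matter.
   Tangent vectors are rows, so a linear map is a matrix acting on the right
   whose k-th row is the image of the k-th coordinate vector. *)

Section Euclidean.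
Variable R : realType.
Implicit Types (W : set 'rV[R]_4) (f : 'rV[R]_4 -> R).

Definition iter_partial (s : seq 'I_4) f : 'rV[R]_4 -> R :=
  foldr (fun k g y => 'D_('e_k) g y) f s.

Definition smooth_on W f : Prop :=
  forall (s : seq 'I_4) (y : 'rV[R]_4), W y ->
    {for y, continuous (iter_partial s f)} /\
    forall k : 'I_4, derivable (iter_partial s f) y 'e_k.

Definition smoothC_on W (f : 'rV[R]_4 -> R[i]) : Prop :=
  smooth_on W (fun y => complex.Re (f y)) /\
  smooth_on W (fun y => complex.Im (f y)).

Definition point4 (a b c d : R) : 'rV[R]_4 := \row_k [:: a; b; c; d]`_k.

(* Iterated Lebesgue integral; it is only used for continuous functions with
   compact support. *)
Definition int4 f : R :=
  \int[lebesgue_measure]_a \int[lebesgue_measure]_b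
  \int[lebesgue_measure]_c \int[lebesgue_measure]_d f (point4 a b c d).

Definition int4C (f : 'rV[R]_4 -> R[i]) : R[i] :=
  int4 (fun y => complex.Re (f y)) +i* int4 (fun y => complex.Im (f y)).

End Euclidean.

Section Pointwise.
Variable R : realType.
Local Notation C := R[i].
Implicit Types (V : lmodType C) (g : 'M[R]_4).

Definition form1 V := 'I_4 -> V.
Definition form2 V := 'I_4 -> 'I_4 -> V.

Definition adjmx m n (M : 'M[C]_(m, n)) : 'M[C]_(n, m) := (map_mx conjc M)^T.

(* J (d/dx) = d/dy and J (d/dy) = - d/dx. *)
Definition Jmx : 'M[R]_4 :=
  \matrix_(k, l) (if ~~ odd k && (l == k.+1 :> nat) then 1
                  else if odd k && (k == l.+1 :> nat) then -1 else 0).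

(* Projections of the complexified tangent space onto T^{0,1}, T^{1,0}. *)
Definition P01 : 'M[C]_4 :=
  2^-1 *: (1%:M + 'i%C *: map_mx (real_complex R) Jmx).
Definition P10 : 'M[C]_4 := map_mx conjc P01.

Definition part01 V (a : form1 V) : form1 V :=
  fun k => \sum_p P01 k p *: a p.
Definition part02 V (B : form2 V) : form2 V :=
  fun k l => \sum_p \sum_q (P01 k p * P01 l q) *: B p q.
Definition part20 V (B : form2 V) : form2 V :=
  fun k l => \sum_p \sum_q (P10 k p * P10 l q) *: B p q.

Definition alternating V (B : form2 V) : Prop := forall k l, B k l = - B l k.

(* Components of a tensor after the linear change of frame D. *)
Definition pull1 V (D : 'M[R]_4) (a : form1 V) : form1 V :=
  fun k => \sum_p (D k p)%:C *: a p.
Definition pull2 V (D : 'M[R]_4) (B : form2 V) : form2 V :=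
  fun k l => \sum_p \sum_q (D k p * D l q)%:C *: B p q.

Definition eps4 (k l p q : 'I_4) : C :=
  \det (\matrix_(a < 4, b < 4) (tnth [tuple k; l; p; q] a == b)%:R).

(* The coefficient of dx1 dy1 dx2 dy2 in the wedge product of two 2-forms whose
   values are multiplied by mul. *)
Definition wedge22 (U V W : lmodType C) (mul : U -> V -> W)
    (B : form2 U) (B' : form2 V) : W :=
  4^-1 *: \sum_k \sum_l \sum_p \sum_q eps4 k l p q *: mul (B k l) (B' p q).

Definition vol g : R := Num.sqrt (\det g).

Definition raise2 g V (B : form2 V) : form2 V := pull2 (invmx g) B.

Definition hodge2 g V (B : form2 V) : form2 V := fun k l =>
  2^-1 *: \sum_p \sum_q ((vol g)%:C * eps4 p q k l) *: raise2 g B p q.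

Definition omega_of g : 'M[R]_4 := Jmx *m g.

(* Contraction with omega, i.e. the pointwise inner product with the real form
   omega: the adjoint of exterior multiplication of functions by omega. *)
Definition Lambda g V (B : form2 V) : V :=
  2^-1 *: \sum_p \sum_q (omega_of g p q)%:C *: raise2 g B p q.

Definition herm n (u v : 'cV[C]_n) : C := (adjmx v *m u) 0 0.
Definition herm1 g n (a b : form1 'cV[C]_n) : C :=
  \sum_p \sum_q (invmx g p q)%:C * herm (a p) (b q).
(* Normalised so that e^1 /\ e^2 has length one for orthonormal e^1, e^2. *)
Definition herm2 g n (a b : form2 'cV[C]_n) : C :=
  2^-1 * \sum_p \sum_q herm (raise2 g a p q) (b p q).

(* { f }_tau *)
Definition brace n (tau : R) (f : 'M[C]_n) : 'M[C]_n :=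
  (f - (\tr f / n%:R)%:M) + (tau%:C / n%:R * \tr f)%:M.

End Pointwise.

Record complexSurface (R : realType) := ComplexSurface {
  pts :> topologicalType;
  pts_hausdorff : hausdorff_space pts;
  pts_compact : compact [set: pts];
  pts_connected : connected [set: pts];
  idx : finType;
  dom : idx -> set pts;
  coord : idx -> pts -> 'rV[R]_4;
  icoord : idx -> 'rV[R]_4 -> pts;
  dom_open : forall i, open (dom i);
  dom_cover : forall x, exists i, dom i x;
  coord_open : forall i, open (coord i @` dom i);
  coordK : forall i x, dom i x -> icoord i (coord i x) = x;
  coord_cont : forall i, {within dom i, continuous (coord i)};
  icoord_cont : forall i, {within coord i @` dom i, continuous (icoord i)};
  transition_smooth : forall i j (p : 'I_4),
    smooth_on (coord i @` (dom i `&` dom j))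
              (fun y => coord j (icoord i y) 0 p);
  (* the Cauchy-Riemann equations for the changes of coordinates *)
  transition_holomorphic : forall i j x, dom i x -> dom j x ->
    let D : 'M[R]_4 := \matrix_(k, p)
      'D_('e_k) (fun y => coord j (icoord i y) 0 p) (coord i x) in
    Jmx R *m D = D *m Jmx R
}.

Section OnSurface.
Variables (R : realType) (X : complexSurface R).
Local Notation C := R[i].
Implicit Types i j : idx X.

Definition pderR i (k : 'I_4) (f : X -> R) (x : X) : R :=
  'D_('e_k) (f \o icoord i) (coord i x).
Definition pder i (k : 'I_4) (f : X -> C) (x : X) : C :=
  pderR i k (fun y => complex.Re (f y)) x
  +i* pderR i k (fun y => complex.Im (f y)) x.
Definition pdermx i (k : 'I_4) m n (f : X -> 'M[C]_(m, n)) (x : X)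
    : 'M[C]_(m, n) :=
  \matrix_(a, b) pder i k (fun y => f y a b) x.

(* Smoothness on an open subset U of the domain of the chart i. *)
Definition smooth_in i (U : set X) (f : X -> C) : Prop :=
  smoothC_on (coord i @` U) (f \o icoord i).
Definition smoothmx_in i (U : set X) m n (f : X -> 'M[C]_(m, n)) : Prop :=
  forall a b, smooth_in i U (fun y => f y a b).

Definition jac i j (x : X) : 'M[R]_4 :=
  \matrix_(k, p) pderR i k (fun y => coord j y 0 p) x.

Definition sform1 := idx X -> X -> form1 C^o.
Definition sform2 := idx X -> X -> form2 C^o.

Definition is_form1 (a : sform1) : Prop :=
  (forall i k, smooth_in i (dom i) (fun x => a i x k)) /\
  (forall i j x, dom i x -> dom j x -> a i x = pull1 (jac i j x) (a j x)).

Definition is_form2 (B : sform2) : Prop :=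
  [/\ forall i k l, smooth_in i (dom i) (fun x => B i x k l),
      forall i x, dom i x -> alternating (B i x) &
      forall i j x, dom i x -> dom j x ->
        B i x = pull2 (jac i j x) (B j x)].

Definition ext_d1 (a : sform1) : sform2 := fun i x k l =>
  pder i k (fun y => a i y l) x - pder i l (fun y => a i y k) x.

Definition closed2 (B : sform2) : Prop := forall i x k l p, dom i x ->
  pder i k (fun y => B i y l p) x + pder i l (fun y => B i y p k) x
    + pder i p (fun y => B i y k l) x = 0.

Definition type11 (B : sform2) : Prop := forall i x, dom i x ->
  part20 (B i x) = (fun _ _ => 0) /\ part02 (B i x) = (fun _ _ => 0).

Definition real2 (B : sform2) : Prop :=
  forall i x k l, dom i x -> conjc (B i x k l) = B i x k l.
Definition imaginary2 (B : sform2) : Prop :=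
  forall i x k l, dom i x -> conjc (B i x k l) = - B i x k l.

(* A (2,0)-form h dz1 /\ dz2 is holomorphic when d h / d zbar_a = 0; in the
   frame of the chart each component of the form is a constant times h. *)
Definition holomorphic20 (B : sform2) : Prop :=
  forall i x k l m, dom i x ->
    part01 (fun p => pder i p (fun y => part20 (B i y) l m) x : C^o) k = 0.

Definition nonzero20 (B : sform2) : Prop :=
  exists i x k l, dom i x /\ part20 (B i x) k l != 0.

(* Integration of 4-forms over X; a 4-form is given in each chart by its
    coefficient with respect to dx1 dy1 dx2 dy2, which is the orientation of
    the complex structure. *)

Definition partition_of_unity (rho : idx X -> X -> R) : Prop :=
  [/\ forall i x, 0 <= rho i x,
      forall x, \sum_i rho i x = 1,
      forall i, closure [set x | rho i x != 0] `<=` dom i &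
      forall i j, smooth_on (coord j @` dom j) (rho i \o icoord j)].

Definition pou : idx X -> X -> R := get partition_of_unity.

Definition integral4 (w : idx X -> X -> C) : C :=
  \sum_i int4C (fun y => if `[< (coord i @` dom i) y >]
     then (pou i (icoord i y))%:C * w i (icoord i y) else 0).

Definition smul (a b : C^o) : C^o := a * b.

(* There is an m-dimensional subspace of H^2(X; R) on which the intersection
   form is positive definite, spanned by the classes of the B a. *)
Definition positive_subspace (m : nat) : Prop :=
  exists B : 'I_m -> sform2,
    (forall a, [/\ is_form2 (B a), real2 (B a) & closed2 (B a)]) /\
    forall c : 'rV[R]_m, c != 0 ->
      let Bc : sform2 := fun i x k l => \sum_a (c 0 a)%:C *: B a i x k l in
      0 < integral4 (fun i x => wedge22 smul (Bc i x) (Bc i x)).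

Definition b2plus : nat :=
  get [set m | positive_subspace m /\
               forall m', positive_subspace m' -> (m' <= m)%N].

End OnSurface.

Record kahlerSurface (R : realType) := KahlerSurface {
  surf :> complexSurface R;
  metric : idx surf -> surf -> 'M[R]_4;
  metric_smooth : forall i k l,
    smooth_on (coord i @` dom i) (fun y => metric i (icoord i y) k l);
  metric_sym : forall i x, dom i x -> (metric i x)^T = metric i x;
  metric_pos : forall i x (v : 'rV[R]_4), dom i x -> v != 0 ->
    0 < (v *m metric i x *m v^T) 0 0;
  metric_tensor : forall i j x, dom i x -> dom j x ->
    metric i x = jac i j x *m metric j x *m (jac i j x)^T;
  metric_hermitian : forall i x, dom i x ->
    Jmx R *m metric i x *m (Jmx R)^T = metric i x;
  omega_closed :
    closed2 (fun i x k l => (omega_of (metric i x) k l)%:C)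
}.

Definition selfdual (R : realType) (X : kahlerSurface R) (B : sform2 X) : Prop :=
  forall i x, dom i x -> hodge2 (metric i x) (B i x) = B i x.

Definition integral (R : realType) (X : kahlerSurface R) (f : X -> R[i]) : R[i] :=
  integral4 (fun (i : idx X) x => (vol (metric i x))%:C * f x).

(* A Hermitian bundle of rank n, given by unitary frames over open sets triv a
   covering X; each triv a lies in the chart base a of X, whose coordinates are
   used there.  A section s has components s a in the frame a. *)
Record hermBundle (R : realType) (X : kahlerSurface R) (n : nat) := HermBundle {
  fr : Type;
  base : fr -> idx X;
  triv : fr -> set X;
  triv_open : forall a, open (triv a);
  triv_dom : forall a, triv a `<=` dom (base a);
  triv_cover : forall x : X, exists a, triv a x;
  glue : fr -> fr -> X -> 'M[R[i]]_n;
  glue_smooth : forall a b, smoothmx_in (base a) (triv a `&` triv b) (glue a b);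
  glue_unitary : forall a b x, triv a x -> triv b x ->
    glue a b x *m adjmx (glue a b x) = 1%:M;
  glue_cocycle : forall a b c x, triv a x -> triv b x -> triv c x ->
    glue a b x *m glue b c x = glue a c x
}.

Section OnBundle.
Variables (R : realType) (X : kahlerSurface R) (n : nat) (E : hermBundle X n).
Local Notation C := R[i].
Implicit Types a b : fr E.

Definition bjac a b (x : X) : 'M[R]_4 := jac (base a) (base b) x.

Definition esec := fr E -> X -> 'cV[C]_n.
Definition eform1 := fr E -> X -> form1 'cV[C]_n.
Definition eform2 := fr E -> X -> form2 'cV[C]_n.
Definition endform1 := fr E -> X -> form1 'M[C]_n.
Definition endform2 := fr E -> X -> form2 'M[C]_n.

Definition is_section (s : esec) : Prop :=
  (forall a, smoothmx_in (base a) (triv a) (s a)) /\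
  (forall a b x, triv a x -> triv b x -> s a x = glue a b x *m s b x).

Definition is_form01 (f : eform1) : Prop :=
  [/\ forall a k, smoothmx_in (base a) (triv a) (fun x => f a x k),
      forall a b x, triv a x -> triv b x ->
        f a x = (fun k => glue a b x *m pull1 (bjac a b x) (f b x) k) &
      forall a x, triv a x -> part01 (f a x) = f a x].

Definition is_form02 (f : eform2) : Prop :=
  [/\ forall a k l, smoothmx_in (base a) (triv a) (fun x => f a x k l),
      forall a x, triv a x -> alternating (f a x),
      forall a b x, triv a x -> triv b x ->
        f a x = (fun k l => glue a b x *m pull2 (bjac a b x) (f b x) k l) &
      forall a x, triv a x -> part02 (f a x) = f a x].

(* Unitary connections d + A a; the last clause says that the local operators
   d + A a agree on overlaps. *)
Definition is_connection (A : endform1) : Prop :=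
  [/\ forall a k, smoothmx_in (base a) (triv a) (fun x => A a x k),
      forall a x k, triv a x -> adjmx (A a x k) = - A a x k &
      forall a b x k, triv a x -> triv b x ->
        A a x k = glue a b x *m pull1 (bjac a b x) (A b x) k *m glue b a x
                  + glue a b x *m pdermx (base a) k (glue b a) x].

Definition curvature (A : endform1) : endform2 := fun a x k l =>
  pdermx (base a) k (fun y => A a y l) x - pdermx (base a) l (fun y => A a y k) x
  + (A a x k *m A a x l - A a x l *m A a x k).

Definition dbar0 (A : endform1) (s : esec) : eform1 := fun a x =>
  part01 (fun k => pdermx (base a) k (s a) x + A a x k *m s a x).

Definition dbar1 (A : endform1) (f : eform1) : eform2 := fun a x =>
  part02 (fun k l =>
    pdermx (base a) k (fun y => f a y l) x
    - pdermx (base a) l (fun y => f a y k) x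
    + (A a x k *m f a x l - A a x l *m f a x k)).

(* Global Hermitian products, computed at x in some frame defined there. *)
Definition frame_at (x : X) : fr E := projT1 (cid (triv_cover E x)).
Definition metric_at (x : X) : 'M[R]_4 := metric (base (frame_at x)) x.

Definition L2prod1 (f h : eform1) : C := integral (fun x : X =>
  herm1 (metric_at x) (f (frame_at x) x) (h (frame_at x) x)).
Definition L2prod2 (f h : eform2) : C := integral (fun x : X =>
  herm2 (metric_at x) (f (frame_at x) x) (h (frame_at x) x)).

(* gam = dbar_A^* beta, for the formal L2-adjoint of
   dbar_A : Omega^{0,1}(E) -> Omega^{0,2}(E). *)
Definition is_dbar_star (A : endform1) (beta : eform2) (gam : eform1) : Prop :=
  is_form01 gam /\
  forall f : eform1, is_form01 f ->
    L2prod2 (dbar1 A f) beta = L2prod1 f gam.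

(* c_1^R(E), as represented by (i / 2 pi) tr F_A for a unitary connection A,
   lies in the subspace H^{1,1} of H^2(X; C), i.e. is the class of a closed
   form of type (1,1). *)
Definition c1_type11 : Prop :=
  exists (A : endform1) (theta : sform2 X) (xi : sform1 X),
    [/\ is_connection A,
        [/\ is_form2 theta, closed2 theta & type11 theta],
        is_form1 xi &
        forall a x k l, triv a x ->
          'i%C / (2 * pi)%:C * \tr (curvature A a x k l)
          = theta (base a) x k l + ext_d1 xi (base a) x k l].

Definition config : Type := (esec * eform2 * endform1)%type.

Definition rank_one (s t : 'cV[C]_n) : 'M[C]_n := s *m adjmx t.

(* beta beta^* = * (beta /\ bar beta) *)
Definition beta_beta (g : 'M[R]_4) (b : form2 'cV[C]_n) : 'M[C]_n :=
  ((vol g)^-1)%:C *: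
    wedge22 (fun (u : 'cV[C]_n) (v : 'rV[C]_n) => u *m v) b
            (fun k l => adjmx (b k l)).

Definition monopole (tau : R) (eta : sform2 X) (m : config) : Prop :=
  let: (alpha, beta, A) := m in
  [/\ [/\ is_section alpha, is_form02 beta & is_connection A],
      exists gam : eform1, is_dbar_star A beta gam /\
        forall a x k, triv a x -> dbar0 A alpha a x k + gam a x k = 0,
      forall a x k l, triv a x ->
        part02 (curvature A a x) k l =
          4^-1 *: brace tau (rank_one (beta a x k l) (alpha a x))
          + (part02 (eta (base a) x) k l)%:M &
      forall a x, triv a x ->
        let g := metric (base a) x in
        - 'i%C *: Lambda g (curvature A a x) =
          8^-1 *: brace tau (rank_one (alpha a x) (alpha a x)
                             - beta_beta g (beta a x))
          + (- 'i%C * Lambda g (eta (base a) x))%:M].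

Definition is_gauge (u : fr E -> X -> 'M[C]_n) : Prop :=
  [/\ forall a, smoothmx_in (base a) (triv a) (u a),
      forall a x, triv a x -> u a x *m adjmx (u a x) = 1%:M &
      forall a b x, triv a x -> triv b x ->
        u a x = glue a b x *m u b x *m glue b a x].

Definition gauge_equiv (m m' : config) : Prop :=
  let: (alpha, beta, A) := m in
  let: (alpha', beta', A') := m' in
  exists u, is_gauge u /\ forall a x, triv a x ->
    [/\ alpha' a x = u a x *m alpha a x,
        forall k l, beta' a x k l = u a x *m beta a x k l &
        forall k, A' a x k = u a x *m A a x k *m adjmx (u a x)
          + u a x *m pdermx (base a) k (fun y => adjmx (u a y)) x].

Definition moduli_space (tau : R) (eta : sform2 X) : set (set config) :=
  [set O | exists2 m, monopole tau eta m &
           O = [set m' | monopole tau eta m' /\ gauge_equiv m m']].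

End OnBundle.

Arguments moduli_space {R X n} E tau eta.

(* Main.v *)
(* Write f, b, e for the (0,2)-parts of F_A, beta and eta, and put t = tr f,
   q = <b, alpha>.  The operator dbar_A maps dbar_A alpha = - dbar_A^* beta to
   f alpha, so the integral of <f alpha, b> is - |dbar_A^* beta|^2 <= 0, while
   the second monopole equation gives pointwise
     4 <f alpha, b> = |b|^2 |alpha|^2 - |q|^2 / n
                      + 16 / (n tau) |t|^2 - (16 / tau) t conj(e).
   Since c_1(E) is of type (1,1), t is the (0,2)-part of d lam for a global
   1-form lam; as conj(e) is holomorphic, the last term integrates to zero by
   Stokes.  The remaining terms add up to something nonnegative by
   Cauchy-Schwarz, hence to zero, and n >= 2 forces q = t = 0, so that e = 0.

   Independence of the integral from the charts rests on the change of
   variables formula for continuous compactly supported functions: the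
   integrand is cut by a fine grid of tent functions, and on each cell the
   transition map is replaced by its linear approximation. *)

Require Import Defs.
From mathcomp Require Import all_boot all_order all_algebra.
From mathcomp Require Import all_classical all_reals all_analysis.
From mathcomp Require Import complex ring lra perm.
Set Implicit Arguments.
Unset Strict Implicit.
Unset Printing Implicit Defensive.
Import Order.TTheory GRing.Theory Num.Theory numFieldNormedType.Exports.
Local Open Scope classical_set_scope.
Local Open Scope ring_scope.
Local Open Scope complex_scope.

Section CompactUniform.
Variables (R : realType) (V W : normedModType R).

Lemma compact_uniform (f : V -> W) (K : set V) (e : R) :
  compact K -> (forall x, K x -> {for x, continuous f}) -> 0 < e ->
  exists2 d : R, 0 < d &
    forall x z, K x -> `|x - z| < d -> `|f x - f z| < e.
Proof.
move=> /compact_near_coveringP cK cf e0.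
have e20 : 0 < e / 2 by rewrite divr_gt0.
have /= := cK R (0^'+) (fun d x => forall z, `|x - z| < d -> `|f x - f z| < e) _.
case=> [x Kx|d /= d0 H].
  have /cvgrPdist_lt /(_ _ e20) := cf x Kx.
  rewrite !near_simpl => /nbhs_ballP[r /= r0 hr].
  exists (ball x (r / 2), [set d | 0 < d < r / 2]) => /=.
    split; first by apply: nbhsx_ballx; rewrite divr_gt0.
    exists (r / 2) => /=; first by rewrite divr_gt0.
    by move=> d /=; rewrite sub0r normrN => h1 h2; rewrite h2 (le_lt_trans _ h1) ?ler_norm.
  move=> [x' d] /= [xx' /andP[d0 dr]] z hz.
  have := hr x'; rewrite -ball_normE /= => /(_ _).
  have h1 : `|x - x'| < r by move: xx'; rewrite -ball_normE /=; lra.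
  have h2 : `|x - z| < r.
    rewrite -(subrKA x') (le_lt_trans (ler_normD _ _))//.
    by move: xx'; rewrite -ball_normE /=; lra.
  move=> /(_ h1) h3.
  have := hr z; rewrite -ball_normE /= => /(_ h2) h4.
  rewrite -(subrKA (f x)) (le_lt_trans (ler_normD _ _))//.
  by rewrite (distrC (f x') (f x)); lra.
exists (d / 2); first by rewrite divr_gt0.
move=> x z Kx; apply: H => //=.
  by rewrite sub0r normrN gtr0_norm ?divr_gt0//; lra.
by rewrite divr_gt0.
Qed.

End CompactUniform.

(** * Integrals over the line *)

Section OneDim.
Variable R : realType.
Implicit Types (h F : R -> R) (a b c M : R).
Local Notation mu := (@lebesgue_measure R).
Local Notation I h := (\int[mu]_t h t).

Definition has_deriv F t d := derivable F t 1 /\ 'D_1 F t = d.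

Lemma has_derivP F (t d : R) : has_deriv F t d <-> is_derive t 1 F d.
Proof. by split=> [[h <-]|[]//]; exact: DeriveDef. Qed.

Definition supp1 M h := forall t, M < `|t| -> h t = 0.

Lemma Rint_itv h a b : (forall t, t \notin `[a, b] -> h t = 0) ->
  I h = \int[mu]_(t in `[a, b]) h t.
Proof.
move=> h0; rewrite [RHS]Rintegral_mkcond; congr Rintegral; apply/funext => t.
rewrite /patch; case: ifPn => // /negP; rewrite inE /= => /negP; exact: h0.
Qed.

Lemma supp1_itv M h a b : supp1 M h -> a <= - M -> M <= b ->
  forall t, t \notin `[a, b] -> h t = 0.
Proof.
move=> sh aM Mb t; rewrite in_itv /= negb_and -!ltNge => /orP[]ht; apply: sh.
  by rewrite ltr_normr; apply/orP; right; lra.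
by rewrite ltr_normr; apply/orP; left; lra.
Qed.

Lemma supp1_integrable M h : continuous h -> supp1 M h ->
  mu.-integrable setT (EFin \o h).
Proof.
move=> ch sh.
have := @continuous_compact_integrable R h `[- M, M]%classic.
move=> /(_ (@segment_compact _ _ _)) /(_ (continuous_subspaceT ch)) H.
have {}H := (integrable_mkcond _ _).1 H.
suff -> : EFin \o h = (EFin \o h) \_ `[- M, M] by apply: H.
rewrite restrict_EFin; congr comp; apply/funext => t.
rewrite /patch; case: ifPn => // /negP; rewrite inE /= => /negP ht; apply/esym.
by rewrite (supp1_itv sh (lexx _) (lexx _) ht).
Qed.

Lemma continuous_primitive M h : 0 < M -> continuous h ->
  exists F, forall t : R, t \in `]- M, M[ -> has_deriv F t (h t).
Proof.
move=> M0 ch; exists (fun x => \int[mu]_(t in `[- M, x]) h t) => t.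
rewrite in_itv /= => /andP[t1 t2].
have ih : mu.-integrable `[- M, M] (EFin \o h).
  by apply: continuous_compact_integrable;
    [exact: segment_compact | exact: continuous_subspaceT].
have [d e] := @continuous_FTC1 R h (BLeft (- M)) t M t2 ih t1 (ch t).
split; first exact: d.
by rewrite -derive1E.
Qed.

Lemma Rint_primitive M h F a b : continuous h -> supp1 M h ->
  a <= - M -> M <= b -> a < b ->
  (forall t : R, t \in `[a, b] -> has_deriv F t (h t)) ->
  I h = F b - F a.
Proof.
move=> ch sh aM Mb ab dF.
rewrite (Rint_itv (supp1_itv sh aM Mb)) /Rintegral.
have dF' t : t \in `[a, b] -> derivable F t 1 by move=> /dF[].
have cF t : t \in `[a, b] -> {for t, continuous F}.
  by move=> /dF' /derivable1_diffP /differentiable_continuous.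
rewrite (@continuous_FTC2 _ h F) //; first exact: continuous_subspaceT.
  split.
  - by move=> t ht; apply: dF'; apply: subset_itv_oo_cc.
  - by apply: cvg_at_right_filter; apply: cF; rewrite in_itv /= lexx ltW.
  - by apply: cvg_at_left_filter; apply: cF; rewrite in_itv /= lexx ltW.
by move=> t ht; rewrite derive1E; have [_ ->] := dF t (subset_itv_oo_cc ht).
Qed.

Lemma primitive_mono h F a b : a <= b ->
  (forall t : R, t \in `[a, b] -> has_deriv F t (h t)) ->
  exists2 c, c \in `[a, b] & F b - F a = h c * (b - a).
Proof.
move=> ab dF.
have dF' (t : R) : t \in `]a, b[ -> is_derive t 1 F (h t).
  by move=> ht; apply/has_derivP; apply: dF; exact: subset_itv_oo_cc.
apply: (MVT_segment ab dF'); apply: derivable_within_continuous => t ht.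
by have [] := dF t ht.
Qed.

Lemma Rint_norm_le M h e : 0 <= M -> continuous h -> supp1 M h ->
  (forall t, `|h t| <= e) -> `|I h| <= 2 * M * e.
Proof.
move=> M0 ch sh he.
have [M00|] := eqVneq M 0.
  have h0 t : h t = 0.
    have [->|t0] := eqVneq t 0; last first.
      by apply: sh; rewrite M00 normr_gt0.
    apply/eqP/negPn/negP => hn0.
    have /cvgrPdist_lt/(_ `|h 0|) := ch 0; rewrite normr_gt0 => /(_ hn0).
    move=> /nbhs_ballP[r /= r0 /(_ (r / 2))]; rewrite -ball_normE /= sub0r normrN.
    rewrite gtr0_norm ?divr_gt0// => H; have := H ltac:(lra).
    by rewrite (sh (r/2)) ?subr0 ?ltxx// M00 gtr0_norm ?divr_gt0.
  suff -> : h = cst 0 by rewrite Rintegral_cst// mul0r normr0 M00 mulr0 mul0r.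
  by apply/funext.
move=> Mn0; have Mp : 0 < M by rewrite lt_neqAle eq_sym Mn0.
have M1 : 0 < M + 1 by lra.
have [F dF] := continuous_primitive M1 ch.
have dF' t : t \in `[- M, M] -> has_deriv F t (h t).
  by rewrite in_itv /= => ht; apply: dF; rewrite in_itv /=; lra.
rewrite (Rint_primitive ch sh (lexx _) (lexx _) _ dF'); last lra.
have [|c cI ->] := primitive_mono _ dF'; first lra.
rewrite normrM opprK (gtr0_norm (_ : 0 < M + M)); last lra.
by rewrite mulrC -mulr2n -[M *+ 2]mulr_natl ler_pM2l ?he; lra.
Qed.

Lemma Rint_gt0 M h t0 : continuous h -> supp1 M h -> (forall t, 0 <= h t) ->
  0 < h t0 -> 0 < I h.
Proof.
move=> ch sh h0 ht0.
have /cvgrPdist_lt/(_ _ ht0)/nbhs_ballP[r /= r0 hr] := ch t0.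
pose N := Num.max M 0 + `|t0| + r + 1.
have NM : M <= Num.max M 0 by rewrite le_max lexx.
have N0 : 0 <= Num.max M 0 by rewrite le_max lexx orbT.
have t00 := normr_ge0 t0.
have ht1 := ler_norm t0.
have ht2 : - t0 <= `|t0| by rewrite -normrN ler_norm.
have Np : 0 < N + 1 by rewrite /N; lra.
have [F dF] := continuous_primitive Np ch.
have dF' a b t : - N <= a -> b <= N -> t \in `[a, b] -> has_deriv F t (h t).
  by move=> aN bN; rewrite in_itv /= => ht; apply: dF; rewrite in_itv /=; lra.
have N1 : - N <= - M by rewrite /N; lra.
have N2 : M <= N by rewrite /N; lra.
have N3 : - N < N by rewrite /N; lra.
rewrite (Rint_primitive ch sh N1 N2 N3 (fun t => @dF' _ _ t (lexx _) (lexx _))).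
have H1 : 0 <= F t0 - F (- N).
  have [||c cI ->] := @primitive_mono h F (- N) t0; first (rewrite /N; lra).
    by move=> t; apply: dF' => //; rewrite /N; lra.
  by rewrite mulr_ge0 ?h0 //; rewrite /N; lra.
have H2 : 0 <= F N - F (t0 + r / 2).
  have [||c cI ->] := @primitive_mono h F (t0 + r / 2) N; first (rewrite /N; lra).
    by move=> t; apply: dF' => //; rewrite /N; lra.
  by rewrite mulr_ge0 ?h0 //; rewrite /N; lra.
have H3 : 0 < F (t0 + r / 2) - F t0.
  have [||c] := @primitive_mono h F t0 (t0 + r / 2); first lra.
    by move=> t; apply: dF' => //; rewrite /N; lra.
  rewrite in_itv /= => cI ->; apply: mulr_gt0; last lra.
  have := hr c; rewrite -ball_normE /= => H.
  have /H : `|t0 - c| < r by rewrite distrC ger0_norm; lra.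
  by have := ler_norm (h t0 - h c); lra.
lra.
Qed.

Lemma Rint_derive M h F : continuous h -> supp1 M F ->
  (forall t : R, has_deriv F t (h t)) -> I h = 0.
Proof.
move=> ch sF dF.
pose N := Num.max M 0.
have NM : M <= N by rewrite /N le_max lexx.
have N0 : 0 <= N by rewrite /N le_max lexx orbT.
have sh : supp1 N h.
  move=> t ht; have [_ <-] := dF t; rewrite (@near_eq_derive _ _ _ _ (cst 0)) ?derive_cst//.
  near=> s; apply: sF; near: s.
  have : open [set s : R | N < `|s|].
    rewrite (_ : mkset _ = Num.norm @^-1` [set x | N < x]) //.
    by apply: open_comp; [move=> x _; exact: norm_continuous | exact: open_gt].
  move=> /(_ t ht); rewrite /interior; apply: filterS => s /=; lra.
have N1 : - (N + 1) <= - N by lra.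
have N2 : N <= N + 1 by lra.
have N3 : - (N + 1) < N + 1 by lra.
rewrite (Rint_primitive ch sh N1 N2 N3 (fun t _ => dF t)).
by rewrite !sF ?subrr// ?normrN gtr0_norm; lra.
Unshelve. all: by end_near. Qed.

Lemma Rint_affine M h c d : 0 <= M -> continuous h -> supp1 M h -> c != 0 ->
  I (fun t => h (c * t + d)) = `|c|^-1 * I h.
Proof.
move=> M0 ch sh c0.
pose N := `|c|^-1 * (M + `|d|) + 1.
have ci : 0 < `|c|^-1 by rewrite invr_gt0 normr_gt0.
have d0 := normr_ge0 d.
have Np : 0 < N by rewrite ltr_wpDl ?mulr_ge0//; lra.
have cN : `|c| * N = M + `|d| + `|c|.
  by rewrite mulrDr mulVKf ?mulr1 ?normr_eq0.
have sg : supp1 N (fun t => h (c * t + d)).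
  move=> t ht; apply: sh.
  have : `|c| * N < `|c * t| by rewrite normrM ltr_pM2l ?normr_gt0.
  have := ler_normD (c * t + d) (- d); rewrite addrK normrN cN.
  have : 0 < `|c| by rewrite normr_gt0.
  lra.
pose L := `|c| * N + `|d|.
have Lp : 0 < L + 1 by rewrite /L cN; have := normr_ge0 c; lra.
have [F dF] := continuous_primitive Lp ch.
have cd t : t \in `[- N, N] -> c * t + d \in `]- (L + 1), (L + 1)[.
  rewrite !in_itv /= => ht.
  have : `|c * t + d| <= L.
    rewrite (le_trans (ler_normD _ _))// lerD2r normrM ler_wpM2l// ler_norml; lra.
  by rewrite ler_norml; lra.
have cg : continuous (fun t => h (c * t + d)).
  move=> t; apply: (@continuous_comp _ _ _ (fun t => c * t + d) h).
    by apply: cvgD; [apply: cvgM; [exact: cvg_cst | exact: cvg_id]|exact: cvg_cst].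
  exact: ch.
have dG t : t \in `[- N, N] ->
    has_deriv (fun t => c^-1 * F (c * t + d)) t (h (c * t + d)).
  move=> ht; have /has_derivP dFt := dF _ (cd t ht).
  have dl : is_derive t 1 (fun t => c * t + d) c.
    by apply: is_derive_eq; rewrite /GRing.scale /= !(mulr0, mul0r, addr0, add0r, mulr1).
  have dFc : is_derive t 1 (F \o (fun t => c * t + d)) (h (c * t + d) * c).
    exact: is_derive1_comp.
  apply/has_derivP; apply: (@is_derive_eq _ _ _ (c^-1 *: (F \o (fun t => c * t + d))) t 1 _ (c^-1 *: (h (c * t + d) * c))).
  by rewrite /GRing.scale /= mulrCA mulVf ?mulr1.
rewrite (Rint_primitive cg sg (lexx _) (lexx _) _ dG); last lra.
have [cp|cn] : (M <= c * N + d /\ c * - N + d <= - M) \/ (c * N + d <= - M /\ M <= c * - N + d).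
  have d1 := ler_norm d; have d2 : - d <= `|d| by rewrite -normrN ler_norm.
  have [cp|cn] := ltP 0 c.
    left; move: cN; rewrite gtr0_norm// mulrN => ->; have : 0 < c by []. lra.
  right; move: cN; rewrite ler0_norm// mulrN mulNr => cN.
  have : 0 < - c by rewrite oppr_gt0 lt_neqAle c0.
  lra.
  have cp' : 0 < c by nra.
  have cNN : c * - N + d < c * N + d by nra.
  rewrite (Rint_primitive ch sh cp.2 cp.1 cNN (F := F)); first by rewrite gtr0_norm// mulrBr.
  move=> t; rewrite in_itv /= => ht; apply: dF; rewrite in_itv /= /L (gtr0_norm cp').
  have d1 := ler_norm d; have d2 : - d <= `|d| by rewrite -normrN ler_norm.
  lra.
have cn' : c < 0 by nra.
have cNN : c * N + d < c * - N + d by nra.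
rewrite (Rint_primitive ch sh cn.1 cn.2 cNN (F := F)).
  by rewrite ltr0_norm// invrN mulNr mulrBr opprB.
move=> t; rewrite in_itv /= => ht; apply: dF; rewrite in_itv /= /L (ltr0_norm cn').
have d1 := ler_norm d; have d2 : - d <= `|d| by rewrite -normrN ler_norm.
lra.
Qed.

End OneDim.

Lemma near_dist (R : numFieldType) (V : normedModType R) (y : V) (d : R) :
  0 < d -> \forall z \near y, `|y - z| < d.
Proof. by move=> d0; apply/nbhs_normP; exists d. Qed.

Section Continuity.
Variables (R : realType) (T : topologicalType).
Implicit Types (f g : T -> R) (x : T).

Lemma cont_cst (c : R) x : {for x, continuous (fun _ : T => c)}.
Proof. exact: cvg_cst. Qed.

Lemma contD f g x : {for x, continuous f} -> {for x, continuous g} ->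
  {for x, continuous (fun z => f z + g z)}.
Proof. exact: cvgD. Qed.

Lemma contN f x : {for x, continuous f} -> {for x, continuous (fun z => - f z)}.
Proof. exact: cvgN. Qed.

Lemma contB f g x : {for x, continuous f} -> {for x, continuous g} ->
  {for x, continuous (fun z => f z - g z)}.
Proof. exact: cvgB. Qed.

Lemma contM f g x : {for x, continuous f} -> {for x, continuous g} ->
  {for x, continuous (fun z => f z * g z)}.
Proof. exact: cvgM. Qed.

Lemma cont_sum (J : Type) (r : seq J) (P : pred J) (F : J -> T -> R) x :
  (forall j, {for x, continuous (F j)}) ->
  {for x, continuous (fun z => \sum_(j <- r | P j) F j z)}.
Proof.
move=> cF; elim: r => [|j r IH].
  have -> : (fun z => \sum_(j <- [::] | P j) F j z) = (fun=> 0).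
    by apply/funext => z; rewrite big_nil.
  exact: cont_cst.
have -> : (fun z => \sum_(j <- j :: r | P j) F j z) =
    (fun z => if P j then F j z + \sum_(j <- r | P j) F j z else \sum_(j <- r | P j) F j z).
  by apply/funext => z; rewrite big_cons.
by case: (P j) => //; exact: contD.
Qed.

Lemma cont_prod (J : Type) (r : seq J) (P : pred J) (F : J -> T -> R) x :
  (forall j, {for x, continuous (F j)}) ->
  {for x, continuous (fun z => \prod_(j <- r | P j) F j z)}.
Proof.
move=> cF; elim: r => [|j r IH].
  have -> : (fun z => \prod_(j <- [::] | P j) F j z) = (fun=> 1).
    by apply/funext => z; rewrite big_nil.
  exact: cont_cst.
have -> : (fun z => \prod_(j <- j :: r | P j) F j z) =
    (fun z => if P j then F j z * \prod_(j <- r | P j) F j z else \prod_(j <- r | P j) F j z).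
  by apply/funext => z; rewrite big_cons.
by case: (P j) => //; exact: contM.
Qed.

Lemma near_eq_continuous f g x : (\forall z \near x, f z = g z) ->
  {for x, continuous f} -> {for x, continuous g}.
Proof.
move=> fg cf; have fgx : f x = g x by exact: nbhs_singleton fg.
by rewrite /prop_for /continuous_at -fgx; apply: cvg_trans cf; exact: near_eq_cvg.
Qed.

Lemma cont_comp (T' : topologicalType) (h : T -> T') (f : T' -> R) x :
  {for x, continuous h} -> {for h x, continuous f} ->
  {for x, continuous (fun z => f (h z))}.
Proof. exact: continuous_comp. Qed.

End Continuity.

Arguments cont_cst {R T} c x.

Section Hat.
Variable R : realType.
Implicit Types (s t : R) (m N M : nat).

Definition clamp t : R := Num.max 0 (Num.min t 1).

Definition hat t : R := clamp (t + 1) - clamp t.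

Lemma clampP t : [\/ t <= 0 /\ clamp t = 0, 0 <= t <= 1 /\ clamp t = t |
  1 <= t /\ clamp t = 1].
Proof.
rewrite /clamp; have [t1|t1] := leP t 1; last by constructor 3; split; [exact: ltW|rewrite max_r].
have [t0|t0] := leP 0 t; first by constructor 2.
by constructor 1; rewrite ltW.
Qed.

Lemma clamp_lip s t : `|clamp s - clamp t| <= `|s - t|.
Proof.
rewrite ler_norml; have := ler_norm (s - t); have := ler_norm (- (s - t)).
rewrite normrN.
by case: (clampP s) => -[hs ->]; case: (clampP t) => -[ht ->]; lra.
Qed.

Lemma hat_lip s t : `|hat s - hat t| <= 2 * `|s - t|.
Proof.
rewrite /hat (_ : _ - _ = (clamp (s + 1) - clamp (t + 1)) - (clamp s - clamp t)); last by ring.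
have := clamp_lip (s + 1) (t + 1); have := clamp_lip s t.
have := ler_normB (clamp (s + 1) - clamp (t + 1)) (clamp s - clamp t).
rewrite (_ : s + 1 - (t + 1) = s - t); last by ring.
lra.
Qed.

Lemma hat_ge0 t : 0 <= hat t.
Proof.
by rewrite /hat; case: (clampP t) => -[ht ->]; case: (clampP (t + 1)) => -[ht' ->]; lra.
Qed.

Lemma hat_eq0 t : 1 <= `|t| -> hat t = 0.
Proof.
rewrite ler_normr => /orP[] h; rewrite /hat;
 by case: (clampP t) => -[ht ->]; case: (clampP (t + 1)) => -[ht' ->]; lra.
Qed.

Lemma hat_continuous : continuous hat.
Proof.
move=> t; apply/cvgrPdist_lt => e e0; near=> s.
apply: le_lt_trans (hat_lip _ _) _.
suff : `|t - s| < e / 2 by lra.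
by near: s; apply: (@near_dist _ R^o); rewrite divr_gt0.
Unshelve. all: by end_near. Qed.

Lemma hat_sum m t : \sum_(j < m.*2.+1) hat (t - (j%:R - m%:R)) =
  clamp (t + m%:R + 1) - clamp (t - m%:R).
Proof.
rewrite (eq_bigr (fun j : 'I_m.*2.+1 => - clamp (t + m%:R - j%:R) - - clamp (t + m%:R + 1 - j%:R))); last first.
  move=> j _; rewrite /hat opprK [RHS]addrC; congr (clamp _ - clamp _); ring.
rewrite -(big_mkord xpredT (fun j => - clamp (t + m%:R - j%:R) - - clamp (t + m%:R + 1 - j%:R))).
rewrite (eq_bigr (fun j => (fun i : nat => - clamp (t + m%:R + 1 - i%:R)) j.+1 - (fun i : nat => - clamp (t + m%:R + 1 - i%:R)) j)); last first.
  by move=> j _ /=; congr (- clamp _ - _); rewrite -natr1; ring.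
rewrite telescope_sumr// subr0 opprK addrC; congr (_ - clamp _).
by rewrite -addnn -natr1 natrD; ring.
Qed.

Definition gridpt N m (j : 'I_m.*2.+1) : R := (j%:R - m%:R) / N%:R.

Definition bump N m (j : 'I_m.*2.+1) t := hat (N%:R * (t - gridpt N j)).

Lemma bump_sum_le1 N m t : (0 < N)%N -> \sum_(j < m.*2.+1) bump N j t <= 1.
Proof.
move=> N0; rewrite (eq_bigr (fun j : 'I__ => hat (N%:R * t - (j%:R - m%:R)))); last first.
  by move=> j _; rewrite /bump mulrBr mulrC [X in _ - X]mulrC divfK// pnatr_eq0 -lt0n.
rewrite hat_sum.
by case: (clampP (N%:R * t + m%:R + 1)) => -[h ->]; case: (clampP (N%:R * t - m%:R)) => -[h' ->]; lra.
Qed.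

Lemma bump_sum N M t : (0 < N)%N -> `|t| <= M%:R ->
  \sum_(j < (N * M).*2.+1) bump N j t = 1.
Proof.
move=> N0; rewrite ler_norml => tM.
rewrite (eq_bigr (fun j : 'I__ => hat (N%:R * t - (j%:R - (N * M)%:R)))); last first.
  by move=> j _; rewrite /bump mulrBr mulrC [X in _ - X]mulrC divfK// pnatr_eq0 -lt0n.
have Np : 0 < N%:R :> R by rewrite ltr0n.
have h1 : - (N%:R * M%:R) <= N%:R * t by rewrite -mulrN ler_pM2l//; lra.
have h2 : N%:R * t <= N%:R * M%:R by rewrite ler_pM2l//; lra.
rewrite hat_sum natrM.
by case: (clampP (N%:R * t + N%:R * M%:R + 1)) => -[h ->]; case: (clampP (N%:R * t - N%:R * M%:R)) => -[h' ->]; lra.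
Qed.

Lemma bump_ge0 N m (j : 'I_m.*2.+1) t : 0 <= bump N j t.
Proof. exact: hat_ge0. Qed.

Lemma bump_neq0 N m (j : 'I_m.*2.+1) t : (0 < N)%N -> bump N j t != 0 ->
  `|t - gridpt N j| < N%:R^-1.
Proof.
move=> N0; apply: contra_neqT; rewrite -leNgt => h; apply: hat_eq0.
have Np : 0 < N%:R :> R by rewrite ltr0n.
by rewrite normrM (gtr0_norm Np) -[leLHS](mulfV (lt0r_neq0 Np)) ler_pM2l.
Qed.

Lemma bump_supp N M (j : 'I_(N * M).*2.+1) : (0 < N)%N -> supp1 M.+1%:R (bump N j).
Proof.
move=> N0 t ht; apply/eqP; apply: contraTT ht => /(bump_neq0 N0) h; rewrite -leNgt.
have h1 := ler_normD (t - gridpt N j) (gridpt N j); rewrite subrK in h1.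
have h2 : N%:R^-1 <= 1 :> R by rewrite invf_le1 ?ltr0n// ler1n.
have h3 : `|gridpt N j| <= M%:R.
  rewrite /gridpt normrM normfV normr_nat ler_pdivrMr ?ltr0n//.
  rewrite -natrM [X in _ <= X%:R]mulnC ler_norml.
  have h3 : j%:R <= (N * M)%:R + (N * M)%:R :> R by rewrite -natrD addnn ler_nat -ltnS.
  have h4 : 0 <= j%:R :> R by [].
  lra.
by rewrite -natr1; lra.
Qed.

Lemma bump_lip N m (j : 'I_m.*2.+1) s t :
  `|bump N j s - bump N j t| <= 2 * N%:R * `|s - t|.
Proof.
apply: le_trans (hat_lip _ _) _; rewrite -mulrBr normrM normr_nat mulrA.
by rewrite (_ : s - _ - _ = s - t)//; ring.
Qed.

Lemma bump_continuous N m (j : 'I_m.*2.+1) : continuous (bump N j).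
Proof.
move=> t; apply: (@continuous_comp _ _ _ (fun t => N%:R * (t - gridpt N j)) hat).
  apply: cvgM; first exact: cvg_cst.
  by apply: cvgB; [exact: cvg_id|exact: cvg_cst].
exact: hat_continuous.
Qed.

Lemma bump_le1 N m (j : 'I_m.*2.+1) t : (0 < N)%N -> bump N j t <= 1.
Proof.
move=> N0; apply: le_trans (@bump_sum_le1 N m t N0).
by rewrite (bigD1 j)//= lerDl sumr_ge0// => i _; exact: bump_ge0.
Qed.

Lemma norm_le_all_eps (x C : R) : (forall e, 0 < e -> `|x| <= C * e) -> x = 0.
Proof.
move=> H; have C0 : 0 <= C by have := H 1 ltr01; rewrite mulr1; apply: le_trans.
apply/eqP; rewrite -normr_le0; apply/ler_addgt0Pr => e e0; rewrite add0r.
have C1 : 0 < C + 1 by lra.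
apply: le_trans (H (e / (C + 1)) _) _; first by rewrite divr_gt0.
by rewrite mulrCA ger_pMr// ler_pdivrMr// mul1r; lra.
Qed.

Lemma exists_inv_lt (e : R) : 0 < e -> exists2 N : nat, (0 < N)%N & N%:R^-1 < e.
Proof.
move=> e0; exists (Num.truncn e^-1).+1 => //.
rewrite invf_plt ?posrE// ?ltr0n//.
by have /andP[_] := truncn_itv (ltW (etrans (invr_gt0 e) e0)).
Qed.

End Hat.

(** * Iterated integrals *)

Section Fibres.
Variable R : realType.
Local Notation V := 'rV[R]_4.
Local Notation mu := (@lebesgue_measure R).
Implicit Types (f g : V -> R) (y z : V) (k l : 'I_4) (M t : R).

Lemma coord_le_norm n (y : 'rV[R]_n) (k : 'I_n) : `|y 0 k| <= `|y|.
Proof.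
rewrite [leRHS]/Num.Def.normr /= mx_normrE.
by rewrite (le_bigmax _ (fun ij : 'I_1 * 'I_n => `|y ij.1 ij.2|) (0, k)).
Qed.

Lemma norm_le_coord n (y : 'rV[R]_n) (c : R) : 0 <= c -> (forall k : 'I_n, `|y 0 k| <= c) -> `|y| <= c.
Proof.
move=> c0 H; rewrite [leLHS]/Num.Def.normr /= mx_normrE.
by apply: bigmax_le => // -[i k] _ /=; rewrite ord1.
Qed.

Lemma continuous_row (T : topologicalType) n (h : T -> 'rV[R]_n) (x : T) :
  (forall k : 'I_n, {for x, continuous (fun s => h s 0 k)}) -> {for x, continuous h}.
Proof.
move=> H; apply/cvgrPdist_le => e e0.
have : \forall s \near x, forall k : 'I_n, `|h x 0 k - h s 0 k| <= e.
  apply: filter_forall => k.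
  by have /cvgrPdist_le/(_ _ e0) := H k.
apply: filterS => s Hs; apply: norm_le_coord; first exact: ltW.
by move=> k; rewrite !mxE.
Qed.

Definition upd y k t : V := \row_l (if l == k then t else y 0 l).

Lemma updE y k t l : upd y k t 0 l = if l == k then t else y 0 l.
Proof. by rewrite mxE. Qed.

Lemma upd_upd y k s t : upd (upd y k s) k t = upd y k t.
Proof. by apply/rowP => l; rewrite !updE; case: eqP. Qed.

Lemma updC y k l s t : k != l -> upd (upd y k s) l t = upd (upd y l t) k s.
Proof.
move=> kl; apply/rowP => m; rewrite !updE.
by case: (eqVneq m l) => // ->; rewrite eq_sym (negbTE kl).
Qed.

Lemma upd_id y k : upd y k (y 0 k) = y.
Proof. by apply/rowP => l; rewrite updE; case: eqP => // ->. Qed.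

Lemma upd_continuous y k : continuous (upd y k).
Proof.
move=> t; apply: continuous_row => l; rewrite /prop_for /continuous_at /= updE.
have [->|ne] := eqVneq l k.
  by under eq_fun do rewrite updE eqxx; exact: cvg_id.
by under eq_fun do rewrite updE (negbTE ne); exact: cvg_cst.
Qed.

Lemma upd_dist y z k t : `|upd y k t - upd z k t| <= `|y - z|.
Proof.
apply: norm_le_coord => // l; rewrite !mxE; case: eqP => _.
  by rewrite subrr normr0.
by have := coord_le_norm (y - z) l; rewrite !mxE.
Qed.

Lemma upd_dist_self z k t : `|z - upd z k t| <= `|z 0 k - t|.
Proof.
apply: norm_le_coord => // j; rewrite mxE [X in _ + X]mxE updE.
by case: eqP => [->//|_]; rewrite subrr normr0.
Qed.

Definition suppc k M f := forall y, M < `|y 0 k| -> f y = 0.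

Definition fibre k f y := \int[mu]_t f (upd y k t).

Lemma suppcW k M N f : M <= N -> suppc k M f -> suppc k N f.
Proof. by move=> MN sf y hy; apply: sf; apply: le_lt_trans hy. Qed.

Lemma fibre_cont_line k f y : continuous f -> continuous (fun t => f (upd y k t)).
Proof.
move=> cf t; apply: (@continuous_comp _ _ _ (upd y k) f); last exact: cf.
exact: upd_continuous.
Qed.

Lemma fibre_supp_line k M f y : suppc k M f -> supp1 M (fun t => f (upd y k t)).
Proof. by move=> sf t ht; apply: sf; rewrite updE eqxx. Qed.

Lemma fibre_integrable k M f y : continuous f -> suppc k M f ->
  mu.-integrable setT (EFin \o (fun t => f (upd y k t))).
Proof.
move=> cf sf; apply: (@supp1_integrable R M); first exact: fibre_cont_line.
exact: fibre_supp_line.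
Qed.

Lemma fibreD k M f g y : continuous f -> continuous g -> suppc k M f ->
  suppc k M g -> fibre k (fun z => f z + g z) y = fibre k f y + fibre k g y.
Proof.
by move=> cf cg sf sg; rewrite /fibre RintegralD//;
  [exact: (fibre_integrable y cf sf)|exact: (fibre_integrable y cg sg)].
Qed.

Lemma fibreZ k M f c y : continuous f -> suppc k M f ->
  fibre k (fun z => c * f z) y = c * fibre k f y.
Proof.
by move=> cf sf; rewrite /fibre RintegralZl//; exact: (fibre_integrable y cf sf).
Qed.

Lemma fibre_upd k f y t : fibre k f (upd y k t) = fibre k f y.
Proof. by rewrite /fibre; congr Rintegral; apply/funext => s; rewrite upd_upd. Qed.

Lemma fibre_supp k l M f : k != l -> suppc l M f -> suppc l M (fibre k f).
Proof.
move=> kl sf y hy; rewrite /fibre (_ : (fun t => f (upd y k t)) = cst 0).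
  by rewrite Rintegral_cst// mul0r.
by apply/funext => t; apply: sf; rewrite updE eq_sym (negbTE kl).
Qed.

Lemma fibre_le k M f y e : 0 <= M -> continuous f -> suppc k M f ->
  (forall t, `|f (upd y k t)| <= e) -> `|fibre k f y| <= 2 * M * e.
Proof.
move=> M0 cf sf H; apply: Rint_norm_le => //; first exact: fibre_cont_line.
exact: fibre_supp_line.
Qed.

Lemma fibre_continuous k M f : continuous f -> suppc k M f ->
  continuous (fibre k f).
Proof.
wlog M0 : M / 0 < M.
  move=> H cf sf; apply: (H (Num.max M 1)) => //; first by rewrite lt_max ltr01 orbT.
  by apply: suppcW sf; rewrite le_max lexx.
move=> cf sf y; apply/(@cvgrPdist_le _ _ _ _ (nbhs_filter y)) => e e0.
pose K := upd y k @` `[- M, M]%classic.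
have cK : compact K.
  apply: continuous_compact; last exact: segment_compact.
  exact: continuous_subspaceT (@upd_continuous y k).
have e1 : 0 < e / (2 * M) by rewrite divr_gt0// mulr_gt0.
have [d d0 Hd] := compact_uniform cK (fun x _ => cf x) e1.
near=> z.
have zy : `|y - z| < d by near: z; exact: (@near_dist _ V).
have -> : fibre k f y - fibre k f z = \int[mu]_t (f (upd y k t) - f (upd z k t)).
  by rewrite RintegralB//; [exact: (fibre_integrable y cf sf)|exact: (fibre_integrable z cf sf)].
have -> : e = 2 * M * (e / (2 * M)) by rewrite mulrC divfK// mulf_neq0// gt_eqF.
apply: Rint_norm_le; first exact: ltW.
- move=> t; apply: cvgB; exact: fibre_cont_line.
- by move=> t ht; rewrite !(fibre_supp_line _ sf ht) subrr.
move=> t; have [tM|tM] := ltP M `|t|.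
  by rewrite !(fibre_supp_line _ sf tM) subrr normr0 ltW.
apply/ltW/Hd; last by apply: le_lt_trans zy; exact: upd_dist.
by exists t => //=; rewrite in_itv /= -ler_norml.
Unshelve. all: by end_near. Qed.

Lemma fibre_gt0 k M f y : continuous f -> suppc k M f -> (forall z, 0 <= f z) ->
  0 < f y -> 0 < fibre k f y.
Proof.
move=> cf sf f0 fy; apply: (@Rint_gt0 R M _ (y 0 k)).
- exact: fibre_cont_line.
- exact: fibre_supp_line.
- by move=> t; exact: f0.
- by rewrite upd_id.
Qed.

Lemma fibre_affine k M f c d y : 0 <= M -> continuous f -> suppc k M f -> c != 0 ->
  \int[mu]_t f (upd y k (c * t + d)) = `|c|^-1 * fibre k f y.
Proof.
move=> M0 cf sf c0; rewrite (@Rint_affine R M (fun t => f (upd y k t)))//.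
  exact: fibre_cont_line.
exact: fibre_supp_line.
Qed.

Lemma suppc_sum (J : Type) (r : seq J) (P : pred J) (F : J -> V -> R) k M :
  (forall j, suppc k M (F j)) -> suppc k M (fun z => \sum_(j <- r | P j) F j z).
Proof. by move=> sF y hy; rewrite big1// => j _; exact: sF. Qed.

Lemma fibre_sum (J : Type) (r : seq J) (F : J -> V -> R) k M y :
  (forall j, continuous (F j)) -> (forall j, suppc k M (F j)) ->
  fibre k (fun z => \sum_(j <- r) F j z) y = \sum_(j <- r) fibre k (F j) y.
Proof.
move=> cF sF; elim: r => [|j r IH].
  by under eq_fun do rewrite big_nil; rewrite big_nil /fibre Rintegral_cst// mul0r.
under eq_fun do rewrite big_cons; rewrite big_cons (@fibreD _ M) ?IH//.
  by move=> z; apply: cont_sum => i; exact: cF.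
exact: suppc_sum.
Qed.

Lemma Rint_mulr M (h : R -> R) (c : R) : continuous h -> supp1 M h ->
  \int[mu]_t (h t * c) = (\int[mu]_t h t) * c.
Proof. by move=> ch sh; rewrite RintegralZr//; exact: supp1_integrable ch sh. Qed.

Lemma compact_norm_le (C : R) : compact [set z : V | `|z| <= C].
Proof.
apply: bounded_closed_compact.
  by exists C; split; [exact: num_real|move=> x Cx z /= zC; apply: le_trans zC (ltW Cx)].
rewrite (_ : mkset _ = Num.norm @^-1` [set x | x <= C]) //.
apply: closed_comp; last exact: closed_le.
by move=> x _; exact: norm_continuous.
Qed.

Lemma fibre_sub k M f g e y : 0 <= M -> continuous f -> continuous g ->
  suppc k M f -> suppc k M g ->
  (forall t, `|f (upd y k t) - g (upd y k t)| <= e) ->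
  `|fibre k f y - fibre k g y| <= 2 * M * e.
Proof.
move=> M0 cf cg sf sg H.
have -> : fibre k f y - fibre k g y = fibre k (fun z => f z - g z) y.
  by rewrite /fibre RintegralB//; [exact: (fibre_integrable y cf sf)|exact: (fibre_integrable y cg sg)].
apply: fibre_le => //; first by move=> z; exact: cvgB (cf z) (cg z).
by move=> z hz; rewrite sf ?sg ?subrr.
Qed.

Lemma suppc_natW k M f : suppc k M f -> exists N : nat, suppc k N%:R f.
Proof.
move=> sf; exists (Num.truncn (Num.max M 0)).+1; apply: suppcW sf.
have M0 : 0 <= Num.max M 0 by rewrite le_max lexx orbT.
have /andP[_] := truncn_itv M0.
by move=> h; apply: le_trans (ltW h); rewrite le_max lexx.
Qed.

Lemma coordk_continuous k z : {for z, continuous (fun z : V => z 0 k)}.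
Proof. exact: coord_continuous. Qed.

Lemma upd_continuous_pt k t : continuous (fun z : V => upd z k t).
Proof.
move=> z; apply/(@cvgrPdist_lt _ _ _ _ (nbhs_filter z)) => e e0; near=> x.
apply: le_lt_trans (upd_dist _ _ _ _) _; near: x; exact: (@near_dist _ V).
Unshelve. all: by end_near. Qed.

(* The integrand is uniformly approximated by sums of functions of the form
   [u (z k) * v z] with [v] independent of the coordinate [k]. *)
Lemma fibreC k l M f y : k != l -> continuous f -> suppc k M f -> suppc l M f ->
  fibre k (fibre l f) y = fibre l (fibre k f) y.
Proof.
move=> kl cf /suppc_natW[M1 sk1] /suppc_natW[M2 sl2] {M}.
pose M := (maxn M1 M2).+1.
have sk : suppc k M%:R f by apply: suppcW sk1; rewrite ler_nat ltnW// ltnS leq_maxl.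
have sl : suppc l M%:R f by apply: suppcW sl2; rewrite ler_nat ltnW// ltnS leq_maxr.
clearbody M.
have M0 : 0 <= M%:R :> R by rewrite ler0n.
have M10 : 0 <= M.+1%:R :> R by rewrite ler0n.
have MM : M%:R <= M.+1%:R :> R by rewrite ler_nat.
apply/eqP; rewrite -subr_eq0; apply/eqP.
pose c : R := 2 * M.+1%:R * (2 * M.+1%:R).
apply: (@norm_le_all_eps _ _ (c + c)) => e e0.
pose plane := [set z : V | exists s t, z = upd (upd y k s) l t].
have [N N0 HN] : exists2 N : nat, (0 < N)%N & forall z p, plane z ->
    `|z 0 k - p| < N%:R^-1 -> `|f z - f (upd z k p)| <= e.
  have [d d0 Hd] := compact_uniform (@compact_norm_le (`|y| + M%:R)) (fun x _ => cf x) e0.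
  have [N N0 Nd] := exists_inv_lt d0; exists N => // z p [s [t ->]] zp.
  have inK a b : `|a| <= M%:R -> `|b| <= M%:R -> `|upd (upd y k a) l b| <= `|y| + M%:R.
    move=> aM bM; apply: norm_le_coord; first by rewrite addr_ge0.
    move=> j; rewrite !updE; case: eqP => _; first by rewrite (le_trans bM)// lerDr.
    case: eqP => _; first by rewrite (le_trans aM)// lerDr.
    by rewrite (le_trans (coord_le_norm _ _))// lerDl.
  have ndist : `|upd (upd y k s) l t - upd (upd (upd y k s) l t) k p| < d.
    apply: le_lt_trans (lt_trans zp Nd); exact: upd_dist_self.
  have updE' : upd (upd (upd y k s) l t) k p = upd (upd y k p) l t.
    by rewrite (updC _ _ _ kl) upd_upd updC// eq_sym.
  have [tM|tM] := ltP M%:R `|t|.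
    have hl a : M%:R < `|upd (upd y k a) l t 0 l| by rewrite updE eqxx.
    by rewrite updE' !sl// subrr normr0 ltW.
  have [sM|sM] := lerP `|s| M%:R.
    by apply/ltW/Hd => //; exact: inK.
  have [pM|pM] := lerP `|p| M%:R.
    rewrite distrC updE'; apply/ltW/Hd; first exact: inK.
    by rewrite -updE' distrC.
  rewrite !sk ?subrr ?normr0 ?(ltW e0)//; first by rewrite updE eqxx.
  by rewrite updE (negbTE kl) updE eqxx.
pose J := 'I_(N * M).*2.+1.
pose v (j : J) z := f (upd z k (gridpt R N j)).
pose F (j : J) z := bump N j (z 0 k) * v j z.
pose g z := \sum_j F j z.
have cv j : continuous (v j).
  move=> z; apply: (@continuous_comp _ _ _ (fun z => upd z k (gridpt R N j)) f).
    exact: upd_continuous_pt.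
  exact: cf.
have cb (j : J) : continuous (fun z : V => bump N j (z 0 k)).
  move=> z; apply: (@continuous_comp _ _ _ (fun z : V => z 0 k) (bump N j)).
    exact: coordk_continuous.
  exact: bump_continuous.
have cF j : continuous (F j) by move=> z; exact: cvgM (cb j z) (cv j z).
have vl j : suppc l M%:R (v j).
  by move=> z hz; apply: sl; rewrite updE eq_sym (negbTE kl).
have Fl j : suppc l M.+1%:R (F j).
  by move=> z hz; rewrite /F vl ?mulr0//; apply: le_lt_trans hz.
have Fk j : suppc k M.+1%:R (F j).
  move=> z hz; rewrite /F; have [->|] := eqVneq (bump N j (z 0 k)) 0; first by rewrite mul0r.
  move=> /(bump_neq0 N0) h; rewrite /v sk ?mulr0// updE eqxx.
  have := ler_normD (z 0 k - gridpt R N j) (gridpt R N j); rewrite subrK.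
  have : N%:R^-1 <= 1 :> R by rewrite invf_le1 ?ltr0n// ler1n.
  by move: hz; rewrite -natr1; lra.
have cg : continuous g by move=> z; apply: cont_sum => j; exact: cF.
have gk : suppc k M.+1%:R g by exact: suppc_sum.
have gl : suppc l M.+1%:R g by exact: suppc_sum.
have sk' : suppc k M.+1%:R f by exact: suppcW sk.
have sl' : suppc l M.+1%:R f by exact: suppcW sl.
have fg z : plane z -> `|f z - g z| <= e.
  move=> pz; have -> : f z - g z = \sum_j bump N j (z 0 k) * (f z - v j z).
    under [RHS]eq_bigr do rewrite mulrBr; rewrite big_split/= sumrN -/(g z); congr (_ - _).
    rewrite -mulr_suml; have [zM|zM] := ltP M%:R `|z 0 k|; first by rewrite sk// mulr0.
    by rewrite bump_sum// mul1r.
  apply: (@le_trans _ _ (\sum_j bump N j (z 0 k) * e)).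
    apply: le_trans (ler_norm_sum _ _ _) _; apply: ler_sum => j _.
    rewrite normrM ger0_norm ?bump_ge0//.
    have [->|] := eqVneq (bump N j (z 0 k)) 0; first by rewrite !mul0r.
    by move=> /(bump_neq0 N0) h; rewrite ler_wpM2l ?bump_ge0//; exact: HN.
  by rewrite -mulr_suml ger_pMl// bump_sum_le1.
have plane1 s t : plane (upd (upd y k s) l t) by exists s, t.
have plane2 s t : plane (upd (upd y l s) k t) by exists t, s; rewrite updC// eq_sym.
have lk : l != k by rewrite eq_sym.
have E1 : `|fibre k (fibre l f) y - fibre k (fibre l g) y| <= c * e.
  rewrite /c -mulrA; apply: fibre_sub => //; try exact: fibre_supp.
  - exact: fibre_continuous cf sl'.
  - exact: fibre_continuous cg gl.
  - by move=> s; apply: fibre_sub => // t; exact: fg.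
have E2 : `|fibre l (fibre k f) y - fibre l (fibre k g) y| <= c * e.
  rewrite /c -mulrA; apply: fibre_sub => //; try exact: fibre_supp.
  - exact: fibre_continuous cf sk'.
  - exact: fibre_continuous cg gk.
  - by move=> s; apply: fibre_sub => // t; exact: fg.
have E3 : fibre k (fibre l g) y = fibre l (fibre k g) y.
  have -> : fibre l g = (fun z => \sum_j fibre l (F j) z).
    by apply/funext => z; exact: fibre_sum.
  have -> : fibre k g = (fun z => \sum_j fibre k (F j) z).
    by apply/funext => z; exact: fibre_sum.
  rewrite (@fibre_sum _ _ _ k M.+1%:R); first last.
  - by move=> j; apply: fibre_supp.
  - by move=> j; exact: fibre_continuous (cF j) (Fl j).
  rewrite (@fibre_sum _ _ _ l M.+1%:R); first last.
  - by move=> j; apply: fibre_supp.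
  - by move=> j; exact: fibre_continuous (cF j) (Fk j).
  apply: eq_bigr => j _.
  pose b := \int[mu]_t bump N j t.
  have cbj : continuous (bump N j : R -> R) by exact: bump_continuous.
  have bsupp : supp1 M.+1%:R (bump N j : R -> R).
    exact: bump_supp.
  have -> : fibre l (F j) = (fun z => bump N j (z 0 k) * fibre l (v j) z).
    apply/funext => z; rewrite -(fibreZ _ _ (@cv j) (vl j)) /fibre.
    by apply: eq_Rintegral => t _; rewrite /F updE (negbTE kl).
  have -> : fibre k (F j) = (fun z => b * v j z).
    apply/funext => z; rewrite /b -(Rint_mulr _ cbj bsupp).
    by apply: eq_Rintegral => t _; rewrite /F /v updE eqxx upd_upd.
  rewrite (fibreZ _ _ (@cv j) (vl j)) /b -(Rint_mulr _ cbj bsupp).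
  apply: eq_Rintegral => t _; rewrite updE eqxx; congr (_ * _).
  by apply: eq_Rintegral => s _; rewrite /v -!(updC _ _ _ kl) upd_upd.
rewrite -E3 distrC in E2; rewrite mulrDl.
by apply: le_trans (ler_distD _ _ _) (lerD E1 E2).
Qed.

Lemma point4E f (a b c d : R) :
  upd (upd (upd (upd 0 0 a) 1 b) (2%:R) c) 3%:R d = point4 a b c d.
Proof.
apply/rowP => -[[|[|[|[|//]]]] i]; rewrite !mxE /=; by [].
Qed.

Lemma int4_fibre f :
  int4 f = fibre 0 (fibre 1 (fibre 2%:R (fibre 3%:R f))) 0.
Proof.
rewrite /int4 [RHS]/fibre; apply: eq_Rintegral => a _.
rewrite [RHS]/fibre; apply: eq_Rintegral => b _.
rewrite [RHS]/fibre; apply: eq_Rintegral => c _.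
by rewrite [RHS]/fibre; apply: eq_Rintegral => d _; rewrite point4E.
Qed.

Lemma fibre_ge0 k f y : (forall z, 0 <= f z) -> 0 <= fibre k f y.
Proof. by move=> f0; apply: Rintegral_ge0 => t _; exact: f0. Qed.

Lemma fibre_indep k l f : (forall z t, f (upd z l t) = f z) ->
  forall z t, fibre k f (upd z l t) = fibre k f z.
Proof.
move=> H z t; have [->|lk] := eqVneq l k; first exact: fibre_upd.
by rewrite /fibre; apply: eq_Rintegral => s _; rewrite (updC _ _ _ lk) H.
Qed.

Lemma int4_fibre_at f y :
  int4 f = fibre 0 (fibre 1 (fibre 2%:R (fibre 3%:R f))) y.
Proof.
rewrite int4_fibre; set F := fibre 0 _.
have H0 z t : F (upd z 0 t) = F z by exact: fibre_upd.
have H1 : forall z t, F (upd z 1 t) = F z.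
  by apply: fibre_indep => z t; exact: fibre_upd.
have H2 : forall z t, F (upd z 2%:R t) = F z.
  by do 2 apply: fibre_indep; move=> z t; exact: fibre_upd.
have H3 : forall z t, F (upd z 3%:R t) = F z.
  by do 3 apply: fibre_indep; move=> z t; exact: fibre_upd.
rewrite -(H0 y 0) -(H1 (upd y 0 0) 0) -(H2 (upd (upd y 0 0) 1 0) 0).
rewrite -(H3 (upd (upd (upd y 0 0) 1 0) 2%:R 0) 0); congr F.
by apply/rowP => -[[|[|[|[|//]]]] i]; rewrite !mxE.
Qed.

End Fibres.

Arguments coordk_continuous {R} k z.

Lemma fibreE (R : realType) k (f : 'rV[R]_4 -> R) y :
  fibre k f y = \int[lebesgue_measure]_t f (upd y k t).
Proof. by []. Qed.

Opaque fibre.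

(** * Linear changes of variables *)

Section Linear.
Variable R : realType.
Local Notation V := 'rV[R]_4.
Implicit Types (f g : V -> R) (y z : V) (k l : 'I_4) (T S : V -> V).

Definition tame (s : seq 'I_4) f :=
  continuous f /\ exists2 M : R, 0 <= M & forall k, k \in s -> suppc k M f.

Definition Cc f := continuous f /\ exists2 M : R, 0 <= M & forall k, suppc k M f.

Lemma Cc_tame s f : Cc f -> tame s f.
Proof. by case=> cf [M M0 sf]; split=> //; exists M. Qed.

Lemma tame_fibre k s f : tame (k :: s) f -> k \notin s -> tame s (fibre k f).
Proof.
case=> cf [M M0 sf] ks; split.
  by apply: (fibre_continuous cf (sf k _)); rewrite mem_head.
exists M => // l ls; apply: fibre_supp; first by apply: contraNneq ks => ->.
by apply: sf; rewrite inE ls orbT.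
Qed.

Lemma tameS s s' f : {subset s <= s'} -> tame s' f -> tame s f.
Proof. by move=> ss [cf [M M0 sf]]; split=> //; exists M => // k /ss /sf. Qed.

Lemma fibre_swap k l s f : tame s f -> k \in s -> l \in s -> k != l ->
  fibre k (fibre l f) = fibre l (fibre k f).
Proof.
by case=> cf [M M0 sf] ks ls kl; apply/funext => y; apply: (fibreC _ kl cf (sf _ ks) (sf _ ls)).
Qed.

Lemma fibre_scale l s f g (c : R) : tame s f -> l \in s -> (forall y, g y = c * f y) ->
  forall y, fibre l g y = c * fibre l f y.
Proof.
case=> cf [M M0 sf] ls H y; rewrite -(fibreZ _ _ cf (sf _ ls)).
by congr fibre; apply/funext.
Qed.

Lemma int4_first k : exists s : 'I_4 * 'I_4 * 'I_4,
  uniq [:: s.1.1; s.1.2; s.2; k] /\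
  forall f, Cc f -> int4 f = fibre s.1.1 (fibre s.1.2 (fibre s.2 (fibre k f))) 0.
Proof.
have t3 f : Cc f -> tame [:: 0; 1; 2%:R] (fibre 3%:R f).
  by move=> /Cc_tame Cf; apply: tame_fibre.
have t2 f : Cc f -> tame [:: 0; 1] (fibre 2%:R (fibre 3%:R f)).
  move=> /t3 Cf; apply: tame_fibre => //; apply: tameS Cf => l; rewrite !inE.
  by case/or3P => ->; rewrite ?orbT.
have sw3 l f : Cc f -> l != 3%:R -> fibre l (fibre 3%:R f) = fibre 3%:R (fibre l f).
  by move=> Cf l3; apply: (@fibre_swap _ _ [:: l; 3%:R]); rewrite ?inE ?eqxx ?orbT//; exact: Cc_tame.
have sw2 l f : Cc f -> (l == 0) || (l == 1) ->
    fibre l (fibre 2%:R (fibre 3%:R f)) = fibre 2%:R (fibre l (fibre 3%:R f)).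
  move=> /t3 Cf l2; apply: (fibre_swap Cf); first by rewrite !inE orbA l2.
    by rewrite !inE !orbT.
  by case/orP: l2 => /eqP ->.
have sw1 f : Cc f -> fibre 0 (fibre 1 (fibre 2%:R (fibre 3%:R f))) =
    fibre 1 (fibre 0 (fibre 2%:R (fibre 3%:R f))).
  by move=> /t2 Cf; apply: (fibre_swap Cf).
have : k \in [:: 0; 1; 2%:R; 3%:R] by case: k => -[|[|[|[|//]]]] ?; rewrite !inE.
rewrite !inE => /or4P[] /eqP ->.
- exists (1, 2%:R, 3%:R); split; first by [].
  by move=> f Cf; rewrite int4_fibre (sw1 _ Cf) (sw2 0 _ Cf isT) (sw3 0 _ Cf isT).
- exists (0, 2%:R, 3%:R); split; first by [].
  by move=> f Cf; rewrite int4_fibre (sw2 1 _ Cf isT) (sw3 1 _ Cf isT).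
- exists (0, 1, 3%:R); split; first by [].
  by move=> f Cf; rewrite int4_fibre (sw3 2%:R _ Cf isT).
- exists (0, 1, 2%:R); split; first by [].
  by move=> f Cf; rewrite int4_fibre.
Qed.

Lemma int4_inner k f g (c : R) : Cc f -> Cc g ->
  (forall y, fibre k g y = c * fibre k f y) -> int4 g = c * int4 f.
Proof.
move=> Cf Cg H; have [[[a b] d] [/= ud E]] := int4_first k.
rewrite !E//; move: ud; rewrite !inE !negb_or -!andbA => /and4P[ab ad ak /and4P[bd bk dk _]].
have t1 : tame [:: d; b; a] (fibre k f).
  apply: tame_fibre; first exact: Cc_tame.
  by rewrite !inE !negb_or !(eq_sym k) dk bk ak.
have t2 : tame [:: b; a] (fibre d (fibre k f)).
  by apply: tame_fibre => //; rewrite !inE !negb_or !(eq_sym d) bd ad.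
have t3 : tame [:: a] (fibre b (fibre d (fibre k f))).
  by apply: tame_fibre => //; rewrite !inE eq_sym.
apply: (fibre_scale t3); first by rewrite mem_head.
apply: (fibre_scale t2); first by rewrite mem_head.
by apply: (fibre_scale t1); first by rewrite mem_head.
Qed.

Lemma int4_le (M e : R) f : 0 <= M -> 0 <= e -> continuous f -> (forall k, suppc k M f) ->
  (forall y, `|f y| <= e) -> `|int4 f| <= (2 * M) ^+ 4 * e.
Proof.
move=> M0 e0 cf sf fe; rewrite int4_fibre.
pose t (s : seq 'I_4) (g : V -> R) := continuous g /\ forall k, k \in s -> suppc k M g.
have step k s (g : V -> R) (e' : R) : t (k :: s) g -> k \notin s -> (forall y, `|g y| <= e') ->
    t s (fibre k g) /\ forall y, `|fibre k g y| <= 2 * M * e'.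
  case=> cg sg ks ge; have sk := sg k (mem_head _ _); split; last first.
    by move=> y; apply: fibre_le.
  split; first exact: fibre_continuous cg sk.
  move=> l ls; apply: fibre_supp; first by apply: contraNneq ks => ->.
  by apply: sg; rewrite inE ls orbT.
have [t3 b3] := @step 3%:R [:: 2%:R; 1; 0] f e (conj cf (fun k _ => sf k)) isT fe.
have [t2 b2] := @step 2%:R [:: 1; 0] _ _ t3 isT b3.
have [t1 b1] := @step 1 [:: 0] _ _ t2 isT b2.
have [_ b0] := @step 0 [::] _ _ t1 isT b1.
by rewrite (le_trans (b0 0))// exprS !exprS expr0 mulr1 !mulrA.
Qed.

Lemma int4D f g : Cc f -> Cc g -> int4 (fun y => f y + g y) = int4 f + int4 g.
Proof.
move=> [cf [M M0 sf]] [cg [N N0 sg]].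
pose L := Num.max M N.
have sfL k : suppc k L f by apply: suppcW (sf k); rewrite le_max lexx.
have sgL k : suppc k L g by apply: suppcW (sg k); rewrite le_max lexx orbT.
pose t (s : seq 'I_4) (h : V -> R) := continuous h /\ forall k, k \in s -> suppc k L h.
have step k s (f1 g1 h1 : V -> R) : t (k :: s) f1 -> t (k :: s) g1 -> k \notin s ->
    (forall y, h1 y = f1 y + g1 y) -> [/\ t s (fibre k f1), t s (fibre k g1) &
    forall y, fibre k h1 y = fibre k f1 y + fibre k g1 y].
  move=> [cf1 sf1] [cg1 sg1] ks H; have kk := mem_head k s; split.
  - split; first exact: fibre_continuous cf1 (sf1 k kk).
    move=> l ls; apply: fibre_supp; first by apply: contraNneq ks => ->.
    by apply: sf1; rewrite inE ls orbT.
  - split; first exact: fibre_continuous cg1 (sg1 k kk).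
    move=> l ls; apply: fibre_supp; first by apply: contraNneq ks => ->.
    by apply: sg1; rewrite inE ls orbT.
  move=> y; rewrite -(fibreD y cf1 cg1 (sf1 k kk) (sg1 k kk)).
  by congr fibre; apply/funext.
rewrite !int4_fibre.
have [a3 b3 c3] := @step 3%:R [:: 2%:R; 1; 0] f g _ (conj cf (fun k _ => sfL k)) (conj cg (fun k _ => sgL k)) isT (fun _ => erefl).
have [a2 b2 c2] := @step 2%:R [:: 1; 0] _ _ _ a3 b3 isT c3.
have [a1 b1 c1] := @step 1 [:: 0] _ _ _ a2 b2 isT c2.
have [_ _ c0] := @step 0 [::] _ _ _ a1 b1 isT c1.
exact: c0.
Qed.

Lemma CcZ (c : R) f : Cc f -> Cc (fun y => c * f y).
Proof.
move=> [cf [M M0 sf]]; split; first by move=> y; exact: cvgM (cvg_cst _) (cf y).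
by exists M => // k y hy; rewrite (sf k)// mulr0.
Qed.

Lemma CcD f g : Cc f -> Cc g -> Cc (fun y => f y + g y).
Proof.
move=> [cf [M M0 sf]] [cg [N N0 sg]]; split; first by move=> y; exact: cvgD (cf y) (cg y).
exists (Num.max M N); first by rewrite le_max M0.
by move=> k y; rewrite gt_max => /andP[h1 h2]; rewrite (sf k)// (sg k)// addr0.
Qed.

Lemma CcM f g : Cc f -> continuous g -> Cc (fun y => f y * g y).
Proof.
move=> [cf [M M0 sf]] cg; split; first by move=> y; exact: cvgM (cf y) (cg y).
by exists M => // k y hy; rewrite (sf k)// mul0r.
Qed.

Lemma Cc0 : Cc (fun=> 0).
Proof. by split; [exact: cst_continuous|exists 0 => // k y]. Qed.

Lemma Cc_sum (J : Type) (r : seq J) (P : pred J) (F : J -> V -> R) :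
  (forall j, Cc (F j)) -> Cc (fun y => \sum_(j <- r | P j) F j y).
Proof.
move=> CF; elim: r => [|j r IH].
  by under eq_fun do rewrite big_nil; exact: Cc0.
by under eq_fun do rewrite big_cons; case: (P j) => //; exact: CcD.
Qed.

Lemma int4Z (c : R) f : Cc f -> int4 (fun y => c * f y) = c * int4 f.
Proof.
move=> Cf; apply: (@int4_inner 0 f) => //; first exact: CcZ.
move=> y; have [cf [M _ sf]] := Cf; exact: fibreZ cf (sf 0).
Qed.

Lemma int4_0 : int4 (fun=> 0 : R) = 0.
Proof.
transitivity (int4 (fun y : V => 0 * (fun=> 0 : R) y)).
  by congr int4; apply/funext => y; rewrite mul0r.
by rewrite int4Z ?mul0r//; exact: Cc0.
Qed.

Lemma int4_sum (J : Type) (r : seq J) (F : J -> V -> R) :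
  (forall j, Cc (F j)) -> int4 (fun y => \sum_(j <- r) F j y) = \sum_(j <- r) int4 (F j).
Proof.
move=> CF; elim: r => [|j r IH].
  by under eq_fun do rewrite big_nil; rewrite big_nil int4_0.
under eq_fun do rewrite big_cons; rewrite big_cons int4D ?IH//.
exact: Cc_sum.
Qed.

Lemma int4_ge0 f : (forall y, 0 <= f y) -> 0 <= int4 f.
Proof.
move=> f0; rewrite /int4; apply: Rintegral_ge0 => a _; apply: Rintegral_ge0 => b _.
by apply: Rintegral_ge0 => c _; apply: Rintegral_ge0 => d _; exact: f0.
Qed.

Lemma int4_gt0 f y : Cc f -> (forall z, 0 <= f z) -> 0 < f y -> 0 < int4 f.
Proof.
move=> [cf [M M0 sf]] f0 fy; rewrite (int4_fibre_at _ y).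
pose t (s : seq 'I_4) (h : V -> R) := [/\ continuous h, forall k, k \in s -> suppc k M h & forall z, 0 <= h z].
have step k s (h : V -> R) : t (k :: s) h -> k \notin s ->
   t s (fibre k h) /\ forall z, 0 < h z -> 0 < fibre k h z.
  move=> [ch sh h0] ks; have kk := mem_head k s; split; last first.
    by move=> z hz; exact: fibre_gt0 ch (sh k kk) h0 hz.
  split.
  - exact: fibre_continuous ch (sh k kk).
  - move=> l ls; apply: fibre_supp; first by apply: contraNneq ks => ->.
    by apply: sh; rewrite inE ls orbT.
  - by move=> z; exact: fibre_ge0.
have [a3 b3] := @step 3%:R [:: 2%:R; 1; 0] f (And3 cf (fun k _ => sf k) f0) isT.
have [a2 b2] := @step 2%:R [:: 1; 0] _ a3 isT.
have [a1 b1] := @step 1 [:: 0] _ a2 isT.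
have [_ b0] := @step 0 [::] _ a1 isT.
exact: b0 _ (b1 _ (b2 _ (b3 _ fy))).
Qed.

Opaque int4.

Lemma Cc_norm (M : R) f : continuous f -> (forall y, M < `|y| -> f y = 0) -> Cc f.
Proof.
move=> cf H; split=> //; exists (Num.max 0 M); first by rewrite le_max lexx.
move=> k y; rewrite gt_max => /andP[_ yM]; apply: H.
exact: lt_le_trans yM (coord_le_norm _ _).
Qed.

Definition scales (c : R) T := forall f, Cc f ->
  Cc (fun y => f (T y)) /\ int4 (fun y => f (T y)) = c * int4 f.

Lemma scales_comp c d T S : scales c T -> scales d S ->
  scales (c * d) (fun y => T (S y)).
Proof.
move=> hT hS f /hT[Cf ef]; have [CfS efS] := hS _ Cf.
split; first exact: CfS.
rewrite efS ef mulrCA mulrA; reflexivity.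
Qed.

Lemma scales_shear k (c a : R) (r : 'I_4 -> R) : c != 0 -> r k = 0 ->
  scales `|c|^-1 (fun y => upd y k (c * y 0 k + (\sum_l r l * y 0 l + a))).
Proof.
move=> c0 rk f Cf; pose d y := \sum_l r l * y 0 l + a.
have cd : continuous d.
  move=> y; apply: contD; last exact: cont_cst.
  by apply: cont_sum => l; exact: (contM (cont_cst (r l) y) (coordk_continuous l y)).
pose T y := upd y k (c * y 0 k + d y).
have cT : continuous T.
  move=> y; apply: continuous_row => l; rewrite /prop_for /continuous_at /T.
  under eq_fun do rewrite updE; rewrite updE.
  case: eqP => _; last exact: coordk_continuous.
  exact: (contD (contM (cont_cst c y) (coordk_continuous k y)) (cd y)).
have [cf [M M0 sf]] := Cf.
have CfT : Cc (fun y => f (T y)).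
  split; first by move=> y; exact: continuous_comp (cT y) (cf _).
  pose B := \sum_l `|r l| * M + `|a|.
  have B0 : 0 <= B by rewrite addr_ge0// sumr_ge0// => l _; rewrite mulr_ge0.
  have cp : 0 < `|c| by rewrite normr_gt0.
  exists (Num.max M ((M + B) / `|c|)); first by rewrite le_max M0.
  move=> l y; rewrite gt_max => /andP[yM yB].
  have [[j jk yj]|] := pselect (exists2 j, j != k & M < `|y 0 j|).
    by rewrite (sf j)// /T updE (negbTE jk).
  move=> /forall2NP H; have [lk|lk] := eqVneq l k; last first.
    by case: (H l) => h; case: h.
  rewrite {l}lk in yM yB; rewrite (sf k)// /T updE eqxx.
  have dB : `|d y| <= B.
    apply: le_trans (ler_normD _ _) _; rewrite lerD2r.
    apply: le_trans (ler_norm_sum _ _ _) _; apply: ler_sum => l _.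
    rewrite normrM; have [->|lk] := eqVneq l k; first by rewrite rk normr0 !mul0r.
    rewrite ler_wpM2l// leNgt; apply/negP => yl.
    by case: (H l) => h; case: h.
  have h1 : M + B < `|c * y 0 k| by rewrite normrM mulrC -ltr_pdivrMr.
  have := ler_normB (c * y 0 k + d y) (d y); rewrite addrK; lra.
split; first exact: CfT.
apply: (int4_inner (k := k) Cf CfT) => y.
rewrite -(fibre_affine (d y) y M0 cf (sf k) c0) fibreE; apply: eq_Rintegral => t _.
rewrite /T updE eqxx upd_upd; congr (f (upd _ _ (_ + _))).
rewrite /d; congr (_ + _); apply: eq_bigr => l _; rewrite updE.
by case: eqP => // ->; rewrite rk !mul0r.
Qed.

Lemma scales_eq c T S : T =1 S -> scales c T -> scales c S.
Proof. by move=> /funext ->. Qed.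

Lemma scales_id : scales 1 id.
Proof. by move=> f Cf; rewrite mul1r. Qed.

Lemma sum4 (W : zmodType) (F : 'I_4 -> W) :
  \sum_i F i = F 0 + F 1 + F 2%:R + F 3%:R.
Proof.
rewrite !big_ord_recr big_ord0 /= add0r.
by congr (F _ + F _ + F _ + F _); apply/val_inj.
Qed.

Lemma ord4P (P : 'I_4 -> Prop) : P 0 -> P 1 -> P 2%:R -> P 3%:R -> forall k, P k.
Proof.
move=> p0 p1 p2 p3 k.
have : k \in [:: 0; 1; 2%:R; 3%:R] by case: k => -[|[|[|[|//]]]] ?; rewrite !inE.
by rewrite !inE => /or4P[] /eqP ->.
Qed.

Definition colstep (A : 'M[R]_4) k y := upd y k ((y *m A) 0 k).

Lemma scales_colstep (A : 'M[R]_4) k : A k k != 0 -> scales `|A k k|^-1 (colstep A k).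
Proof.
move=> A0; pose r l := if l == k then 0 else A l k.
apply: scales_eq (scales_shear 0 A0 (_ : r k = 0)); last by rewrite /r eqxx.
move=> y; congr upd; rewrite addr0 mxE [RHS](bigD1 k)//= mulrC; congr (_ + _).
rewrite (bigD1 k)//= /r eqxx mul0r add0r; apply: eq_bigr => l lk.
by rewrite (negbTE lk) mulrC.
Qed.

Lemma scales_translate (p : V) : scales 1 (fun y => y + p).
Proof.
have h k : scales 1 (fun y => upd y k (1 * y 0 k + (\sum_l (fun=> 0) l * y 0 l + p 0 k))).
  by have := scales_shear (p 0 k) (@oner_neq0 R) (erefl : (fun=> 0) k = 0); rewrite normr1 invr1.
have := scales_comp (h 0) (scales_comp (h 1) (scales_comp (h 2%:R) (h 3%:R))).
rewrite !mulr1; apply: scales_eq => y; apply/rowP; apply: ord4P;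
  rewrite !(updE, mxE) /= !big1 ?add0r ?mul1r//; by move=> *; rewrite mul0r.
Qed.

Lemma scales_tperm (i j : 'I_4) : i != j ->
  scales 1 (fun y => upd (upd y i (y 0 j)) j (y 0 i)).
Proof.
move=> ij; pose e (x : R) (m l : 'I_4) := if l == m then x else 0.
have esum x m y : \sum_l e x m l * y 0 l = x * y 0 m.
  by rewrite (bigD1 m)//= /e eqxx big1 ?addr0// => l /negbTE ->; rewrite mul0r.
have n1 : (-1 : R) != 0 by rewrite oppr_eq0 oner_neq0.
have e1 : e 1 j i = 0 by rewrite /e (negbTE ij).
have e2 : e 1 i j = 0 by rewrite /e eq_sym (negbTE ij).
have e3 : e (-1) j i = 0 by rewrite /e (negbTE ij).
have s1 := scales_shear 0 (@oner_neq0 R) e1.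
have s2 := scales_shear 0 n1 e2.
have s3 := scales_shear 0 (@oner_neq0 R) e3.
have := scales_comp s3 (scales_comp s2 s1).
rewrite normrN normr1 invr1 !mulr1; apply: scales_eq => y; rewrite !esum !addr0.
have ijf := negbTE ij; have ji : (j == i) = false by rewrite eq_sym.
apply/rowP => l; rewrite ?(updE, eqxx, ijf, ji).
have [->|lj] := eqVneq l j; first by rewrite ji; ring.
by case: eqP => // _; ring.
Qed.

Lemma scales_perm (s : {perm 'I_4}) : scales 1 (fun y => y *m perm_mx s).
Proof.
have [ts -> dts] := prod_tpermP s; elim: ts dts => [_|[i j] ts IH /=].
  rewrite big_nil perm_mx1; apply: scales_eq scales_id => y; by rewrite mulmx1.
move=> /andP[ij dts]; rewrite big_cons perm_mxM.
have := scales_comp (IH dts) (scales_tperm ij); rewrite mulr1; apply: scales_eq => y /=.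
rewrite mulmxA; congr (_ *m _); apply/rowP => l.
rewrite -[tperm i j]invgK -col_permE mxE tpermV !updE.
rewrite mxE; case: tpermP => [->|->|/eqP/negbTE -> /eqP/negbTE ->] //; rewrite ?eqxx ?(negbTE ij)//.
Qed.

Lemma scales_lower (L : 'M[R]_4) : (forall i j : 'I_4, (i <= j)%N -> L i j = (i == j)%:R) ->
  scales 1 (fun y => y *m L).
Proof.
move=> HL.
have hk k : scales 1 (colstep L k).
  have e : L k k = 1 by rewrite HL// eqxx.
  by have := @scales_colstep L k; rewrite e normr1 invr1 oner_eq0 => /(_ isT).
have := scales_comp (hk 3%:R) (scales_comp (hk 2%:R) (scales_comp (hk 1) (hk 0))).
rewrite !mulr1; apply: scales_eq => y.
have e00 : L 0 0 = 1 by rewrite HL.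
have e11 : L 1 1 = 1 by rewrite HL.
have e22 : L 2%:R 2%:R = 1 by rewrite HL.
have e33 : L 3%:R 3%:R = 1 by rewrite HL.
have e01 : L 0 1 = 0 by rewrite HL.
have e02 : L 0 2%:R = 0 by rewrite HL.
have e03 : L 0 3%:R = 0 by rewrite HL.
have e12 : L 1 2%:R = 0 by rewrite HL.
have e13 : L 1 3%:R = 0 by rewrite HL.
have e23 : L 2%:R 3%:R = 0 by rewrite HL.
by apply/rowP; apply: ord4P; rewrite /colstep; do 5 rewrite ?(updE, mxE) ?sum4 /=; rewrite ?(e01, e02, e03, e12, e13, e23, e00, e11, e22, e33); ring.
Qed.

Lemma scales_upper (U : 'M[R]_4) : (forall i j : 'I_4, (j < i)%N -> U i j = 0) ->
  \det U != 0 -> scales `|\det U|^-1 (fun y => y *m U).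
Proof.
move=> HU dU.
have dE : \det U = U 0 0 * U 1 1 * U 2%:R 2%:R * U 3%:R 3%:R.
  rewrite -det_tr det_trig; last first.
    by apply/is_trig_mxP => i j ij; rewrite mxE HU.
  rewrite !big_ord_recr big_ord0 /= mul1r !mxE.
  by congr (U _ _ * U _ _ * U _ _ * U _ _); apply/val_inj.
move: (dU); rewrite dE !mulf_eq0 !negb_or -!andbA => /and4P[u0 u1 u2 u3].
have := scales_comp (scales_colstep u0) (scales_comp (scales_colstep u1)
   (scales_comp (scales_colstep u2) (scales_colstep u3))).
rewrite -!invfM -!normrM !mulrA; apply: scales_eq => y.
have e01 : U 1 0 = 0 by rewrite HU.
have e02 : U 2%:R 0 = 0 by rewrite HU.
have e03 : U 3%:R 0 = 0 by rewrite HU.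
have e12 : U 2%:R 1 = 0 by rewrite HU.
have e13 : U 3%:R 1 = 0 by rewrite HU.
have e23 : U 3%:R 2%:R = 0 by rewrite HU.
by apply/rowP; apply: ord4P; rewrite /colstep; do 5 rewrite ?(updE, mxE) ?sum4 /=; rewrite ?(e01, e02, e03, e12, e13, e23); ring.
Qed.

Lemma scales_mulmx (A : 'M[R]_4) : \det A != 0 -> scales `|\det A|^-1 (fun y => y *m A).
Proof.
move=> dA.
have [P [L [U [hP hL hU dL e]]]] : exists P L U : 'M[R]_4, [/\ is_perm_mx P,
    forall i j : 'I_4, (i <= j)%N -> L i j = (i == j)%:R,
    forall i j : 'I_4, (j < i)%N -> U i j = 0, \det L = 1 & P *m A = L *m U].
  exists (cormen_lup A).1.1, (cormen_lup A).1.2, (cormen_lup A).2; split.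
  - exact: cormen_lup_perm.
  - exact: cormen_lup_lower.
  - exact: cormen_lup_upper.
  - exact: cormen_lup_detL.
  - by case: (cormen_lup A) (cormen_lup_correct A) => -[P L] U h; exact: h.
move: hP e => /is_perm_mxP[s ->] e.
have eA : A = perm_mx s^-1%g *m L *m U.
  by rewrite -mulmxA -e mulmxA -perm_mxM mulVg perm_mx1 mul1mx.
have nU : `|\det U| = `|\det A|.
  have := congr1 (fun B => `|\det B|) e; rewrite /= !det_mulmx dL mul1r normrM det_perm.
  by rewrite normrX normrN normr1 expr1n mul1r.
have dU : \det U != 0 by rewrite -normr_eq0 nU normr_eq0.
have := scales_comp (scales_upper hU dU) (scales_comp (scales_lower hL) (scales_perm s^-1%g)).
by rewrite !mulr1 nU; apply: scales_eq => y; rewrite [in RHS]eA !mulmxA.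
Qed.

End Linear.

(** * Chain rule and symmetry of second derivatives *)

Section Gradient.
Variable R : realType.
Local Notation V := 'rV[R]_4.
Implicit Types (f g : V -> R) (x y z : V) (k l : 'I_4) (W K : set V).

Definition pd k f y : R := 'D_('e_k) f y.

Lemma updDe y k s t : upd y k (s + t) = s *: 'e_k + upd y k t.
Proof.
apply/rowP => l; rewrite !mxE eqxx /=; case: eqP => _; first by rewrite mulr1.
by rewrite mulr0 add0r.
Qed.

Lemma has_deriv_shift (F : R -> R) (a s c : R) : has_deriv F (a + s) c ->
  has_deriv (fun t => F (a + t)) s c.
Proof.
have E : (fun h : R => h^-1 *: (((fun t => F (a + t)) \o shift s) (h *: (1 : R)) - F (a + s))) =
    (fun h : R => h^-1 *: ((F \o shift (a + s)) (h *: (1 : R)) - F (a + s))).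
  by apply/funext => h /=; rewrite addrCA.
by move=> [d e]; split; [rewrite /derivable E|rewrite -e /derive E].
Qed.

Lemma has_deriv_upd f y k t : derivable f (upd y k t) 'e_k ->
  has_deriv (fun s => f (upd y k s)) t (pd k f (upd y k t)).
Proof.
have E : (fun h : R => h^-1 *: (((fun s => f (upd y k s)) \o shift t) (h *: (1 : R)) - f (upd y k t))) =
    (fun h : R => h^-1 *: ((f \o shift (upd y k t)) (h *: 'e_k) - f (upd y k t))).
  by apply/funext => h /=; rewrite updDe /GRing.scale /= mulr1.
move=> df; split; first by rewrite /derivable E.
by rewrite /pd /derive E.
Qed.

Lemma upd_mvt f y k (a b G e : R) :
  (forall t, Num.min a b <= t <= Num.max a b -> derivable f (upd y k t) 'e_k /\
     `|pd k f (upd y k t) - G| <= e) ->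
  `|f (upd y k b) - f (upd y k a) - (b - a) * G| <= e * `|b - a|.
Proof.
wlog ab : a b / a <= b.
  move=> H; case/orP: (le_total a b) => [ab|ba]; first exact: H.
  rewrite minC maxC => /(H _ _ ba); rewrite (distrC a b) => {}H.
  have -> : f (upd y k b) - f (upd y k a) - (b - a) * G =
    - (f (upd y k a) - f (upd y k b) - (a - b) * G) by ring.
  by rewrite normrN.
rewrite (min_idPl ab) (max_idPr ab) => H.
have [t tI E] : exists2 c, c \in `[a, b] &
    f (upd y k b) - f (upd y k a) = pd k f (upd y k c) * (b - a).
  apply: (@primitive_mono R (fun t => pd k f (upd y k t)) (fun t => f (upd y k t)) _ _ ab) => t.
  by rewrite in_itv /= => /H[df _]; exact: has_deriv_upd.
rewrite E mulrC -mulrBr normrM mulrC ler_wpM2r//.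
by rewrite in_itv /= in tI; have [] := H _ tI.
Qed.

Lemma dist_between (a b t : R) : Num.min a b <= t <= Num.max a b -> `|t - a| <= `|b - a|.
Proof.
have [ab|ba] := leP a b => /andP[h1 h2].
  by rewrite !ger0_norm; lra.
by rewrite !ler0_norm; lra.
Qed.

Lemma grad_estimate f x z (G : 'I_4 -> R) (e : R) :
  (forall y k, (forall l, `|y 0 l - x 0 l| <= `|z 0 l - x 0 l|) ->
     derivable f y 'e_k /\ `|pd k f y - G k| <= e) ->
  `|f z - f x - \sum_k (z - x) 0 k * G k| <= 4 * e * `|z - x|.
Proof.
move=> H.
pose x1 := upd x 0 (z 0 0); pose x2 := upd x1 1 (z 0 1).
pose x3 := upd x2 2%:R (z 0 2%:R); pose x4 := upd x3 3%:R (z 0 3%:R).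
have x4z : x4 = z by apply/rowP; apply: ord4P; rewrite !updE.
have step (p : V) k : (forall l, p 0 l = x 0 l \/ p 0 l = z 0 l) -> p 0 k = x 0 k ->
    `|f (upd p k (z 0 k)) - f p - (z - x) 0 k * G k| <= e * `|z - x|.
  move=> hp pk.
  have e0 : 0 <= e by have [_ /(le_trans _)] := H x k (fun l => ltac:(by rewrite subrr normr0)); apply.
  have h : `|f (upd p k (z 0 k)) - f (upd p k (x 0 k)) - (z 0 k - x 0 k) * G k| <= e * `|z 0 k - x 0 k|.
    apply: upd_mvt => t ht; apply: H => l; rewrite updE; case: eqP => [->|_].
      exact: dist_between.
    by have [->|->] := hp l; rewrite ?subrr ?normr0.
  rewrite -{2}(upd_id p k) pk; move: h; rewrite -[z 0 k - x 0 k]/(z 0 k + - x 0 k).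
  have zx : (z - x) 0 k = z 0 k - x 0 k by rewrite !mxE.
  rewrite zx => h; apply: le_trans h _; rewrite ler_wpM2l// -zx; exact: coord_le_norm.
have s0 : `|f x1 - f x - (z - x) 0 0 * G 0| <= e * `|z - x|.
  by apply: step => // l; left.
have s1 : `|f x2 - f x1 - (z - x) 0 1 * G 1| <= e * `|z - x|.
  by apply: step; [apply: ord4P; rewrite !updE /=; tauto|rewrite !updE].
have s2 : `|f x3 - f x2 - (z - x) 0 2%:R * G 2%:R| <= e * `|z - x|.
  by apply: step; [apply: ord4P; rewrite !updE /=; tauto|rewrite !updE].
have s3 : `|f z - f x3 - (z - x) 0 3%:R * G 3%:R| <= e * `|z - x|.
  have := step x3 3%:R; rewrite -/x4 x4z; apply; last by rewrite !updE.
  by apply: ord4P; rewrite !updE /=; tauto.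
rewrite sum4.
have -> : f z - f x - ((z - x) 0 0 * G 0 + (z - x) 0 1 * G 1 + (z - x) 0 2%:R * G 2%:R + (z - x) 0 3%:R * G 3%:R) =
 (f x1 - f x - (z - x) 0 0 * G 0) + (f x2 - f x1 - (z - x) 0 1 * G 1) +
 ((f x3 - f x2 - (z - x) 0 2%:R * G 2%:R) + (f z - f x3 - (z - x) 0 3%:R * G 3%:R)) by ring.
have -> : 4 * e * `|z - x| = (e * `|z - x| + e * `|z - x|) + (e * `|z - x| + e * `|z - x|) by ring.
by apply: le_trans (ler_normD _ _) (lerD _ _); apply: le_trans (ler_normD _ _) (lerD _ _).
Qed.

Definition C1_on W f := forall y, W y -> forall k,
  derivable f y 'e_k /\ {for y, continuous (pd k f)}.

Lemma compact_in_open K W : compact K -> open W -> K `<=` W ->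
  exists2 d : R, 0 < d & forall x z, K x -> `|x - z| < d -> W z.
Proof.
move=> /compact_near_coveringP cK oW KW.
have /= := cK R (0^'+) (fun d x => forall z, `|x - z| < d -> W z) _.
case=> [x Kx|d /= d0 H].
  have : nbhs x W by apply: open_nbhs_nbhs; split => //; exact: KW.
  move=> /nbhs_ballP[r /= r0 hr].
  exists (ball x (r / 2), [set d | 0 < d < r / 2]) => /=.
    split; first by apply: nbhsx_ballx; rewrite divr_gt0.
    exists (r / 2) => /=; first by rewrite divr_gt0.
    by move=> d /=; rewrite sub0r normrN => h1 h2; rewrite h2 (le_lt_trans _ h1) ?ler_norm.
  move=> [x' d] /= [xx' /andP[d0 dr]] z hz; apply: hr; rewrite -ball_normE /=.
  rewrite -(subrKA x') (le_lt_trans (ler_normD _ _))//.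
  by move: xx'; rewrite -ball_normE /=; lra.
exists (d / 2); first by rewrite divr_gt0.
move=> x z Kx; apply: H => //=.
  by rewrite sub0r normrN gtr0_norm ?divr_gt0//; lra.
by rewrite divr_gt0.
Qed.

Lemma compact_bounded_fun K f : compact K -> (forall x, K x -> {for x, continuous f}) ->
  exists2 C : R, 0 <= C & forall x, K x -> `|f x| <= C.
Proof.
move=> cK cf.
have cfK : {within K, continuous f} by apply: continuous_in_subspaceT => x /set_mem; exact: cf.
have [C [_ HC]] := compact_bounded (continuous_compact cfK cK).
exists (Num.max 0 (C + 1)); first by rewrite le_max lexx.
move=> x Kx; rewrite le_max (HC (C + 1)) ?orbT ?ltrDl//; by exists x.
Qed.

Lemma finite_radius (n : nat) (P : 'I_n -> R -> Prop) :
  (forall p d d', P p d -> d' <= d -> P p d') ->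
  (forall p, exists2 d : R, 0 < d & P p d) -> exists2 d : R, 0 < d & forall p, P p d.
Proof.
move=> mono H; have /choice[d Hd] : forall p, exists d, 0 < d /\ P p d.
  by move=> p; have [d d0 Pd] := H p; exists d.
exists (\big[Num.min/1]_p d p).
  by apply: lt_bigmin => // p _; have [] := Hd p.
by move=> p; apply: (mono p (d p)); [have [] := Hd p|exact: bigmin_le].
Qed.

Lemma C1_estimate W f K (e : R) : open W -> C1_on W f -> compact K -> K `<=` W -> 0 < e ->
  exists2 d : R, 0 < d & forall x z, K x -> `|x - z| < d ->
    W z /\ `|f z - f x - \sum_k (z - x) 0 k * pd k f x| <= e * `|z - x|.
Proof.
move=> oW c1 cK KW e0; have e40 : 0 < e / 4 by rewrite divr_gt0.
have [d0 d00 Hd0] := compact_in_open cK oW KW.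
have [d1 d10 Hd1] : exists2 d : R, 0 < d & forall k x z, K x -> `|x - z| < d ->
    `|pd k f x - pd k f z| < e / 4.
  apply: (@finite_radius 4 (fun k d => forall x z, K x -> `|x - z| < d -> `|pd k f x - pd k f z| < e / 4)).
    by move=> k d d' H dd x z Kx xz; apply: H => //; exact: lt_le_trans xz dd.
  by move=> k; apply: compact_uniform => // x /KW Wx; have [] := c1 x Wx k.
exists (Num.min d0 d1); first by rewrite lt_min d00.
move=> x z Kx; rewrite lt_min => /andP[xz0 xz1]; split; first exact: Hd0 xz0.
have -> : e * `|z - x| = 4 * (e / 4) * `|z - x| by rewrite mulrC [4 * _]mulrC divfK// mulrC.
apply: grad_estimate => y k yx.
have xy : `|x - y| <= `|x - z|.
  apply: norm_le_coord => // l; rewrite !mxE distrC; apply: le_trans (yx l) _.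
  by have := coord_le_norm (x - z) l; rewrite !mxE distrC.
split; first by have [] := c1 y (Hd0 _ _ Kx (le_lt_trans xy xz0)) k.
by rewrite distrC; apply/ltW/Hd1 => //; exact: le_lt_trans xz1.
Qed.

Lemma C1_estimate_pt W f x (e : R) : open W -> C1_on W f -> W x -> 0 < e ->
  exists2 d : R, 0 < d & forall z, `|x - z| < d ->
    W z /\ `|f z - f x - \sum_k (z - x) 0 k * pd k f x| <= e * `|z - x|.
Proof.
move=> oW c1 Wx e0.
have [|d d0 H] := C1_estimate oW c1 (@compact_set1 _ x) _ e0; first by move=> _ ->.
by exists d => // z; exact: H.
Qed.

Lemma C1_continuous W f x : open W -> C1_on W f -> W x -> {for x, continuous f}.
Proof.
move=> oW c1 Wx; have [d d0 H] := C1_estimate_pt oW c1 Wx ltr01.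
apply/(@cvgrPdist_lt _ _ _ _ (nbhs_filter x)) => e e0.
pose C := \sum_k `|pd k f x| + 1 + 1.
have Cp : 0 < C by rewrite ltr_wpDl// addr_ge0// sumr_ge0.
near=> z.
have xz : `|x - z| < Num.min d (e / C).
  by near: z; apply: (@near_dist _ V); rewrite lt_min d0 divr_gt0.
move: xz; rewrite lt_min => /andP[xz1 xz2]; have [_ h] := H z xz1.
have h2 : `|\sum_k (z - x) 0 k * pd k f x| <= (\sum_k `|pd k f x|) * `|z - x|.
  apply: le_trans (ler_norm_sum _ _ _) _; rewrite mulr_suml; apply: ler_sum => k _.
  by rewrite normrM mulrC ler_wpM2l// coord_le_norm.
have h3 : `|f z - f x| <= (C - 1) * `|z - x|.
  rewrite -[f z - f x](subrK (\sum_k (z - x) 0 k * pd k f x)).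
  apply: le_trans (ler_normD _ _) _; rewrite /C addrK mulrDl mul1r [leRHS]addrC lerD//.
  by rewrite mul1r in h.
rewrite distrC; apply: le_lt_trans h3 _; rewrite ltr_pdivlMr// mulrC distrC in xz2.
apply: le_lt_trans xz2; rewrite ler_wpM2r//; lra.
Unshelve. all: by end_near. Qed.

(* The derivative of a curve [u] at 0, in the form of the limits defining
   [derivable] and ['D_v]. *)
Lemma curve_deriv W f (u : R -> V) (c : 'I_4 -> R) : open W -> C1_on W f -> W (u 0) ->
  (forall p, (fun h => h^-1 * (u h 0 p - u 0 0 p)) @ 0^' --> c p) ->
  (fun h => h^-1 * (f (u h) - f (u 0))) @ 0^' --> \sum_p c p * pd p f (u 0).
Proof.
move=> oW c1 Wu Hu; pose q (h : R) p := h^-1 * (u h 0 p - u 0 0 p).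
have Hs : (fun h => \sum_p q h p * pd p f (u 0)) @ 0^' --> \sum_p c p * pd p f (u 0).
  have Hp p : (fun h => q h p * pd p f (u 0)) @ 0^' --> c p * pd p f (u 0).
    by apply: cvgM; [exact: Hu|exact: cvg_cst].
  under eq_fun do rewrite sum4; rewrite sum4.
  exact: (cvgD (cvgD (cvgD (Hp 0) (Hp 1)) (Hp 2%:R)) (Hp 3%:R)).
apply/cvgrPdist_le => e e0.
pose C := \sum_p `|c p| + 1.
have C0 : 0 < C by rewrite ltr_wpDl// sumr_ge0.
have e1 : 0 < e / (2 * C) by rewrite divr_gt0// mulr_gt0.
have [d d0 Hd] := C1_estimate_pt oW c1 Wu e1.
have Hq : \forall h \near 0^', forall p, `|q h p| <= C.
  apply: filter_forall => p.
  have /cvgrPdist_le/(_ 1 ltr01) := Hu p; apply: filterS => h hh.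
  have := ler_normD (c p) (q h p - c p); rewrite addrC subrK distrC => h1.
  apply: le_trans h1 _; rewrite lerD// /C (bigD1 p)//= lerDl sumr_ge0//.
near=> h.
have hn0 : h != 0 by near: h; exact: nbhs_dnbhs_neq.
have hd : `|h| < d / C by near: h; apply: dnbhs0_lt; rewrite divr_gt0.
have qC : forall p, `|q h p| <= C by near: h.
have hu : `|u h - u 0| <= `|h| * C.
  apply: norm_le_coord => [|p]; first by rewrite mulr_ge0// ltW.
  have -> : (u h - u 0) 0 p = h * q h p by rewrite /q !mxE mulrA mulfV// mul1r.
  by rewrite normrM ler_wpM2l.
have [_ E] := Hd (u h) ltac:(rewrite distrC; apply: le_lt_trans hu _; by rewrite -ltr_pdivlMr).
have E1 : `|\sum_p q h p * pd p f (u 0) - h^-1 * (f (u h) - f (u 0))| <= e / 2.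
  have -> : \sum_p q h p * pd p f (u 0) - h^-1 * (f (u h) - f (u 0)) =
      - (h^-1 * (f (u h) - f (u 0) - \sum_k (u h - u 0) 0 k * pd k f (u 0))).
    have -> : \sum_p q h p * pd p f (u 0) = h^-1 * \sum_k (u h - u 0) 0 k * pd k f (u 0).
      by rewrite mulr_sumr; apply: eq_bigr => p _; rewrite /q !mxE mulrA.
    ring.
  rewrite normrN normrM normfV ler_pdivrMl ?normr_gt0//; apply: le_trans E _.
  have -> : `|h| * (e / 2) = e / (2 * C) * (`|h| * C).
    by field; rewrite gt_eqF.
  by rewrite ler_wpM2l// ltW.
have E2 : `|\sum_p c p * pd p f (u 0) - \sum_p q h p * pd p f (u 0)| <= e / 2.
  near: h; have /cvgrPdist_le := Hs; apply; by rewrite divr_gt0.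
rewrite (splitr e); apply: le_trans (ler_distD (\sum_p q h p * pd p f (u 0)) _ _) _.
exact: lerD.
Unshelve. all: by end_near. Qed.

Lemma chain_rule W f (phi : V -> V) x k : open W -> C1_on W f -> W (phi x) ->
  (forall p, derivable (fun y => phi y 0 p) x 'e_k) ->
  derivable (fun y => f (phi y)) x 'e_k /\
  pd k (fun y => f (phi y)) x = \sum_p pd k (fun y => phi y 0 p) x * pd p f (phi x).
Proof.
move=> oW c1 Wx dphi.
pose u (h : R) := phi (h *: 'e_k + x).
have u0 : u 0 = phi x by rewrite /u scale0r add0r.
have H : (fun h => h^-1 * (f (u h) - f (u 0))) @ 0^' -->
    \sum_p pd k (fun y => phi y 0 p) x * pd p f (u 0).
  apply: (curve_deriv oW c1); first by rewrite u0.
  by move=> p; rewrite u0; exact: dphi p.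
rewrite u0 in H; split; first by apply/cvg_ex; eexists; exact: H.
by apply: cvg_lim => //; exact: H.
Qed.

Lemma second_diff_eq (A B C D u v h : R) : h != 0 ->
  A - B - (C - D) = u * h * h -> A - C - (B - D) = v * h * h -> u = v.
Proof.
move=> h0 e1 e2; apply: (mulIf h0); apply: (mulIf h0); rewrite -e1 -e2; ring.
Qed.

(* Both sides are limits of the second difference of [f] over a small square
   with sides in the directions [k] and [l]. *)
Lemma schwarz W f x k l : open W -> W x -> C1_on W f ->
  C1_on W (pd k f) -> C1_on W (pd l f) -> pd k (pd l f) x = pd l (pd k f) x.
Proof.
move=> oW Wx c1 c1k c1l.
have [->//|kl] := eqVneq k l.
have [d d0 HW] := compact_in_open (@compact_set1 _ x) oW (fun y e => ltac:(rewrite e; exact: Wx)).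
pose sq (s t : R) := upd (upd x k (x 0 k + s)) l (x 0 l + t).
have sqx s t : `|x - sq s t| <= Num.max `|s| `|t|.
  apply: norm_le_coord => [|j]; first by rewrite le_max normr_ge0.
  rewrite mxE [X in _ + X]mxE !updE; case: eqP => [->|_].
    by rewrite opprD addrA subrr add0r normrN le_max lexx orbT.
  case: eqP => [->|_]; last by rewrite subrr normr0 le_max normr_ge0.
  by rewrite opprD addrA subrr add0r normrN le_max lexx.
have sqW s t : `|s| < d -> `|t| < d -> W (sq s t).
  move=> sd td; apply: (HW x) => //; apply: le_lt_trans (sqx s t) _.
  by rewrite gt_max sd.
(* Mean value theorem, first in the direction [a], then in the direction [b]. *)
have mvt2 a b (P : R -> R -> V) :
    (forall s t, `|s| < d -> `|t| < d -> W (P s t)) ->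
    (forall (s t : R), exists y, forall s', P s' t = upd y a (x 0 a + s')) ->
    (forall (s t : R), exists y, forall t', P s t' = upd y b (x 0 b + t')) ->
    C1_on W (pd a f) -> forall h : R, 0 < h < d ->
    exists s t, [/\ 0 <= s <= h, 0 <= t <= h &
      f (P h h) - f (P 0 h) - (f (P h 0) - f (P 0 0)) = pd b (pd a f) (P s t) * h * h].
  move=> PW Pa Pb c1a h /andP[h0 hd].
  have d1 (g : V -> R) c (Q : R -> V) s : C1_on W g ->
      (exists y, forall s', Q s' = upd y c (x 0 c + s')) -> W (Q s) ->
      has_deriv (fun s => g (Q s)) s (pd c g (Q s)).
    move=> c1g [y Hy] WQ; have [dg _] := c1g _ WQ c.
    have -> : (fun s => g (Q s)) = (fun s => g (upd y c (x 0 c + s))).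
      by apply/funext => s'; rewrite Hy.
    by move: dg; rewrite Hy => dg; exact: has_deriv_shift (has_deriv_upd dg).
  have ih s : s \in `[0, h] -> `|s| < d.
    by rewrite in_itv /= => /andP[s0 sh]; rewrite ger0_norm//; lra.
  have h0' : 0 <= h by exact: ltW.
  have i0 : (0 : R) \in `[0, h] by rewrite in_itv /= lexx.
  have ihh : h \in `[0, h] by rewrite in_itv /= lexx andbT.
  have [s sI E1] := @primitive_mono R (fun s => pd a f (P s h) - pd a f (P s 0))
     (fun s => f (P s h) - f (P s 0)) 0 h h0' (fun s sI => ltac:(
       have /has_derivP e1 := d1 f a (fun s => P s h) s c1 (Pa s h) (PW _ _ (ih s sI) (ih h ihh));
       have /has_derivP e2 := d1 f a (fun s => P s 0) s c1 (Pa s 0) (PW _ _ (ih s sI) (ih 0 i0));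
       apply/has_derivP; exact: is_deriveB)).
  have [t tI E2] := @primitive_mono R (fun t => pd b (pd a f) (P s t))
     (fun t => pd a f (P s t)) 0 h h0' (fun t tI =>
       d1 (pd a f) b (fun t => P s t) t c1a (Pb s t) (PW _ _ (ih s sI) (ih t tI))).
  exists s, t; move: sI tI; rewrite !in_itv /= => sI tI; split => //.
  rewrite subr0 in E1 E2.
  have -> : f (P h h) - f (P 0 h) - (f (P h 0) - f (P 0 0)) =
     f (P h h) - f (P h 0) - (f (P 0 h) - f (P 0 0)) by ring.
  by rewrite E1 E2.
apply/eqP; rewrite -subr_eq0; apply/eqP; apply: (@norm_le_all_eps _ _ 2) => e e0.
have [_ /(@cvgrPdist_lt _ _ _ _ (nbhs_filter x)) /(_ _ e0) /nbhs_normP[r1 /= r10 R1]] := c1l x Wx k.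
have [_ /(@cvgrPdist_lt _ _ _ _ (nbhs_filter x)) /(_ _ e0) /nbhs_normP[r2 /= r20 R2]] := c1k x Wx l.
pose h := Num.min d (Num.min r1 r2) / 2.
have m0 : 0 < Num.min d (Num.min r1 r2) by rewrite !lt_min d0 r10.
have hm : h < Num.min d (Num.min r1 r2) by rewrite /h; lra.
have h0 : 0 < h by rewrite /h divr_gt0.
move: hm; rewrite !lt_min => /and3P[hd hr1 hr2].
have h0d : 0 < h < d by rewrite h0.
clearbody h; clear m0 HW.
have lk : l != k by rewrite eq_sym.
have sqk (s t : R) : exists y, forall s', sq s' t = upd y k (x 0 k + s').
  by exists (upd x l (x 0 l + t)) => s'; rewrite /sq updC.
have sql (s t : R) : exists y, forall t', sq s t' = upd y l (x 0 l + t').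
  by exists (upd x k (x 0 k + s)).
have [s1 [t1 [s1h t1h E1]]] := mvt2 k l sq sqW sqk sql c1k h h0d.
have [t2 [s2 [t2h s2h E2]]] := mvt2 l k (fun t s => sq s t) (fun t s td sd => sqW s t sd td)
  (fun t s => sql s t) (fun t s => sqk s t) c1l h h0d.
have E : pd l (pd k f) (sq s1 t1) = pd k (pd l f) (sq s2 t2).
  exact: second_diff_eq (lt0r_neq0 h0) E1 E2.
have near_sq s t (r : R) : h < r -> 0 <= s <= h -> 0 <= t <= h -> `|x - sq s t| < r.
  move=> hr /andP[s0 sh] /andP[t0 th]; apply: le_lt_trans (sqx s t) _.
  by rewrite (ger0_norm s0) (ger0_norm t0) gt_max (le_lt_trans sh hr) (le_lt_trans th hr).
have h1 := R1 _ (near_sq _ _ _ hr1 s2h t2h).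
have h2 := R2 _ (near_sq _ _ _ hr2 s1h t1h).
rewrite -(subrKA (pd k (pd l f) (sq s2 t2))) mulr_natl mulr2n.
apply: le_trans (ler_normD _ _) (lerD (ltW h1) _).
by rewrite -E distrC ltW.
Qed.

End Gradient.

(** * Change of variables *)

Section ChangeOfVariables.
Variable R : realType.
Local Notation V := 'rV[R]_4.
Implicit Types (f g w : V -> R) (x y z : V) (k l : 'I_4) (U W K : set V) (phi psi : V -> V).

Lemma row_subE (u v : V) p : (u - v) 0 p = u 0 p - v 0 p.
Proof. by rewrite !mxE. Qed.

Definition jacobian phi x : 'M[R]_4 := \matrix_(k, p) pd k (fun y => phi y 0 p) x.

Lemma jacobian_mul phi x (h : V) p : (h *m jacobian phi x) 0 p = \sum_k h 0 k * pd k (fun y => phi y 0 p) x.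
Proof. by rewrite mxE; apply: eq_bigr => k _; rewrite mxE. Qed.

Lemma jacobian_estimate U phi K (e : R) : open U -> (forall p, C1_on U (fun y => phi y 0 p)) ->
  compact K -> K `<=` U -> 0 < e ->
  exists2 d : R, 0 < d & forall x z, K x -> `|x - z| < d ->
    U z /\ `|phi z - phi x - (z - x) *m jacobian phi x| <= e * `|z - x|.
Proof.
move=> oU c1 cK KU e0.
have [d d0 Hd] : exists2 d : R, 0 < d & forall p x z, K x -> `|x - z| < d ->
    U z /\ `|phi z 0 p - phi x 0 p - \sum_k (z - x) 0 k * pd k (fun y => phi y 0 p) x| <= e * `|z - x|.
  apply: (@finite_radius _ 4 (fun p d => forall x z, K x -> `|x - z| < d ->
    U z /\ `|phi z 0 p - phi x 0 p - \sum_k (z - x) 0 k * pd k (fun y => phi y 0 p) x| <= e * `|z - x|)).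
    by move=> p d d' H dd x z Kx xz; apply: H => //; exact: lt_le_trans xz dd.
  by move=> p; exact: C1_estimate (c1 p) cK KU e0.
exists d => // x z Kx xz; split; first by have [] := Hd 0 x z Kx xz.
apply: norm_le_coord => [|p]; first by rewrite mulr_ge0// ltW.
have [_] := Hd p x z Kx xz; rewrite -jacobian_mul.
by rewrite !row_subE.
Qed.

Lemma C1_lipschitz U phi K : open U -> (forall p, C1_on U (fun y => phi y 0 p)) ->
  compact K -> K `<=` U ->
  exists L d : R, [/\ 0 < L, 0 < d & forall x z, K x -> `|x - z| < d ->
    U z /\ `|phi x - phi z| <= L * `|x - z|].
Proof.
move=> oU c1 cK KU.
have [d d0 Hd] := jacobian_estimate oU c1 cK KU ltr01.
have /choice[C HC] : forall kp : 'I_4 * 'I_4, exists C : R, forall x, K x ->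
    0 <= C /\ `|pd kp.1 (fun y => phi y 0 kp.2) x| <= C.
  move=> [k p].
  have [C C0 HC] := compact_bounded_fun cK (fun x Kx => (c1 p x (KU x Kx) k).2).
  by exists C => x Kx; split=> //; exact: HC.
pose B := \sum_k \sum_p `|C (k, p)|.
exists (B + 1), d; split=> //.
  by rewrite ltr_wpDl// sumr_ge0// => k _; rewrite sumr_ge0.
move=> x z Kx xz; have [Uz E] := Hd x z Kx xz; split=> //.
rewrite distrC (distrC x) mulrDl mul1r; rewrite mul1r in E.
rewrite -[phi z - phi x](subrK ((z - x) *m jacobian phi x)).
apply: le_trans (ler_normD _ _) _; rewrite [leRHS]addrC lerD//.
apply: norm_le_coord => [|p].
  by rewrite mulr_ge0// sumr_ge0// => k _; rewrite sumr_ge0.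
rewrite jacobian_mul; apply: le_trans (ler_norm_sum _ _ _) _.
rewrite mulr_suml; apply: ler_sum => k _; rewrite normrM mulrC.
apply: ler_pM => //; last exact: coord_le_norm.
have [C0 h] := HC (k, p) x Kx; apply: le_trans h _.
by rewrite (bigD1 p)//= ger0_norm// lerDl sumr_ge0.
Qed.

Lemma ext_continuous U K f : open U -> compact K -> K `<=` U ->
  (forall x, U x -> {for x, continuous f}) -> (forall x, U x -> ~ K x -> f x = 0) ->
  Cc (fun x => if `[< U x >] then f x else 0).
Proof.
move=> oU cK KU cf f0; set g := fun x => _.
have g0 x : ~ K x -> g x = 0.
  by move=> nK; rewrite /g; case: asboolP => // Ux; exact: f0.
have [M [_ HM]] := compact_bounded cK.
apply: (@Cc_norm _ (M + 1)); last first.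
  move=> y yM; apply: g0 => Ky; have := HM (M + 1) (ltr_pwDr ltr01 (lexx _)) y Ky.
  by rewrite /= leNgt yM.
move=> x; have [Kx|nKx] := pselect (K x).
  have Ux := KU _ Kx; apply: near_eq_continuous (cf x Ux).
  have : nbhs x U by apply: open_nbhs_nbhs; split.
  by apply: filterS => z Uz; rewrite /g asboolT.
have oK : open (~` K) by apply: closed_openC; apply: compact_closed => //; exact: norm_hausdorff.
apply: near_eq_continuous (cont_cst 0 x).
have : nbhs x (~` K) by apply: open_nbhs_nbhs; split.
by apply: filterS => z nz; rewrite g0.
Qed.

Lemma int4_le_at x0 (r e : R) f : 0 <= r -> 0 <= e -> Cc f -> (forall y, `|f y| <= e) ->
  (forall y, r < `|y - x0| -> f y = 0) -> `|int4 f| <= (2 * r) ^+ 4 * e.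
Proof.
move=> r0 e0 Cf fe f0.
have [Cg Eg] := scales_translate x0 Cf; rewrite mul1r in Eg; rewrite -Eg.
have [cg _] := Cg; apply: (@int4_le R r e _ r0 e0 cg) => [k y hy|y]; last exact: fe.
by apply: f0; rewrite addrK; exact: lt_le_trans hy (coord_le_norm _ _).
Qed.

Section Grid.
Variables N M : nat.
Hypothesis N0 : (0 < N)%N.
Local Notation cell := {ffun 'I_4 -> 'I_(N * M).*2.+1}.
Implicit Type p : cell.

Definition cellbump p y : R := \prod_k bump N (p k) (y 0 k).

Lemma cellbump_sum y : `|y| <= M%:R -> \sum_p cellbump p y = 1.
Proof.
move=> yM; rewrite /cellbump.
rewrite -(bigA_distr_bigA (fun k (j : 'I_(N * M).*2.+1) => bump N j (y 0 k))).
by apply: big1 => k _; rewrite bump_sum// (le_trans (coord_le_norm _ _)).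
Qed.

Lemma cellbump_ge0 p y : 0 <= cellbump p y.
Proof. by apply: prodr_ge0 => k _; exact: bump_ge0. Qed.

Lemma cellbump_le1 p y : cellbump p y <= 1.
Proof. by apply: prodr_ile1 => k _; rewrite bump_ge0 bump_le1. Qed.

Lemma cellbump_continuous p : continuous (cellbump p).
Proof.
move=> y; apply: cont_prod => k.
apply: (@continuous_comp _ _ _ (fun z : V => z 0 k) (bump N (p k))).
  exact: (coordk_continuous k y).
exact: bump_continuous.
Qed.

Lemma cellbump_neq0 p y k : cellbump p y != 0 ->
  `|y 0 k - gridpt R N (p k)| < N%:R^-1.
Proof.
move=> h; apply: bump_neq0 => //; apply: contraNneq h => h.
by rewrite /cellbump (bigD1 k)//= h mul0r.
Qed.

Lemma cellbump_near p y z : cellbump p y != 0 -> cellbump p z != 0 ->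
  `|y - z| < 2 / N%:R.
Proof.
move=> hy hz; have Np : 0 < N%:R^-1 :> R by rewrite invr_gt0 ltr0n.
rewrite ltNge; apply/negP => h.
have /existsP[k] : [exists k, 2 / N%:R <= `|(y - z) 0 k|].
  apply: contraT; rewrite negb_exists => /forallP H.
  move: h; rewrite leNgt => /negP[].
  rewrite [ltLHS]/Num.Def.normr /= mx_normrE.
  apply: bigmax_lt; first by rewrite divr_gt0// ltr0n.
  by move=> -[i k] _ /=; rewrite ord1 ltNge.
rewrite !mxE; have := cellbump_neq0 k hy; have := cellbump_neq0 k hz.
set c := gridpt _ _ _ => h1 h2.
have := ler_distD c (y 0 k) (z 0 k); rewrite (distrC c).
rewrite -[2 / _]/(2 * _); lra.
Qed.

Lemma prod2_lip (a b c d : R) : 0 <= a <= 1 -> 0 <= b <= 1 -> 0 <= c <= 1 -> 0 <= d <= 1 ->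
  `|a * b - c * d| <= `|a - c| + `|b - d|.
Proof.
move=> ha hb hc hd; have -> : a * b - c * d = (a - c) * b + c * (b - d) by ring.
apply: le_trans (ler_normD _ _) _; rewrite !normrM.
have h1 : `|b| <= 1 by rewrite ger0_norm; lra.
have h2 : `|c| <= 1 by rewrite ger0_norm; lra.
by apply: lerD; [rewrite ler_piMr|rewrite ler_piMl].
Qed.

Lemma cellbump_lip p y z : `|cellbump p y - cellbump p z| <= 8 * N%:R * `|y - z|.
Proof.
pose b k y := bump N (p k) (y 0 k).
have b01 k y' : 0 <= b k y' <= 1 by rewrite bump_ge0 bump_le1.
have prod01 (u v : R) : 0 <= u <= 1 -> 0 <= v <= 1 -> 0 <= u * v <= 1.
  by move=> /andP[u0 u1] /andP[v0 v1]; rewrite mulr_ge0//= mulr_ile1.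
have bl k : `|b k y - b k z| <= 2 * N%:R * `|y - z|.
  rewrite /b; apply: le_trans (@bump_lip R N _ (p k) (y 0 k) (z 0 k)) _; rewrite ler_wpM2l//.
  by have := coord_le_norm (y - z) k; rewrite !mxE.
have E y' : cellbump p y' = (b 0 y' * b 1 y') * (b 2%:R y' * b 3%:R y').
  rewrite /cellbump !big_ord_recr big_ord0 /= mul1r -mulrA.
  by congr (_ * _ * (_ * _)); congr (b _ _); apply/val_inj.
rewrite !E; apply: le_trans (prod2_lip _ _ _ _) _; try exact: prod01.
have h1 := prod2_lip (b01 0 y) (b01 1 y) (b01 0 z) (b01 1 z).
have h2 := prod2_lip (b01 2%:R y) (b01 3%:R y) (b01 2%:R z) (b01 3%:R z).
have := bl 0; have := bl 1; have := bl 2%:R; have := bl 3%:R; lra.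
Qed.

Lemma cellbump_Cc p : Cc (cellbump p).
Proof.
split; first exact: cellbump_continuous.
exists M.+1%:R => // k y hy; rewrite /cellbump (bigD1 k)//= (bump_supp (p k) N0) ?mul0r//.
Qed.

End Grid.

Lemma compact_norm_nat K : compact K -> exists M : nat, forall y, K y -> `|y| <= M%:R.
Proof.
move=> /compact_bounded[M [_ HM]]; exists (Num.truncn (Num.max M 0 + 1)).+1 => y Ky.
have M0 : 0 <= Num.max M 0 + 1 by rewrite addr_ge0// le_max lexx orbT.
have /andP[_ h] := truncn_itv M0; apply: le_trans (ltW h); apply: HM Ky.
by rewrite ltr_pwDr// le_max lexx.
Qed.

Lemma le_of_contraction (h a L eta : R) : 0 <= h -> L * eta <= 1 / 2 ->
  h <= L * (a + eta * h) -> h <= 2 * L * a.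
Proof.
move=> h0 Le hle; have h1 : L * eta * h <= 1 / 2 * h by rewrite ler_wpM2r.
move: hle; rewrite mulrDr mulrA => hle; lra.
Qed.

Lemma cell_radius (L q n : R) : 0 <= L -> q <= 2 / n -> 2 * L * q <= 4 * L / n.
Proof.
move=> L0 qn; have -> : 4 * L / n = 2 * L * (2 / n) by ring.
by rewrite ler_wpM2l// mulr_ge0.
Qed.

Variables (U W : set V) (phi psi : V -> V).
Hypotheses (oU : open U) (oW : open W).
Hypothesis phiK : forall x, U x -> W (phi x) /\ psi (phi x) = x.
Hypothesis psiK : forall y, W y -> U (psi y) /\ phi (psi y) = y.
Hypothesis phi1 : forall p, C1_on U (fun y => phi y 0 p).
Hypothesis psi1 : forall p, C1_on W (fun y => psi y 0 p).
Hypothesis det_pos : forall x, U x -> 0 < \det (jacobian phi x).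

Lemma C1_map_continuous (T : set V) (f : V -> V) x : open T ->
  (forall p, C1_on T (fun y => f y 0 p)) -> T x -> {for x, continuous f}.
Proof. by move=> oT f1 Tx; apply: continuous_row => p; exact: C1_continuous oT (f1 p) Tx. Qed.

Lemma det_jacobian_continuous x : U x -> {for x, continuous (fun z => \det (jacobian phi z))}.
Proof.
move=> Ux; rewrite /determinant; apply: cont_sum => s.
apply: contM; first exact: cont_cst.
apply: cont_prod => k.
have -> : (fun z => jacobian phi z k (s k)) = pd k (fun y => phi y 0 (s k)).
  by apply/funext => z; rewrite mxE.
by have [] := phi1 (s k) Ux k.
Qed.

Section Cell.
Variables (w : V -> R) (K : set V) (L d1 C1 eta d2 d3 d4 : R) (N M : nat) (p : {ffun 'I_4 -> 'I_(N * M).*2.+1}).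
Hypotheses (cw : continuous w) (cK : compact K) (KW : K `<=` W) (wK : forall y, ~ K y -> w y = 0).
Hypotheses (N0 : (0 < N)%N) (L0 : 0 < L) (C10 : 0 <= C1) (eta0 : 0 < eta).
Hypothesis etaL : L * eta <= 1 / 2.
Hypothesis (d10 : 0 < d1) (d20 : 0 < d2).
Hypothesis psi_lip : forall y z, K y -> `|y - z| < d1 -> W z /\ `|psi y - psi z| <= L * `|y - z|.
Hypothesis phi_est : forall x z, (psi @` K) x -> `|x - z| < d2 ->
  U z /\ `|phi z - phi x - (z - x) *m jacobian phi x| <= eta * `|z - x|.
Let H x := w (phi x) * \det (jacobian phi x).
Hypothesis H_bound : forall x, (psi @` K) x -> `|H x| <= C1.
Hypothesis H_unif : forall x z, (psi @` K) x -> `|x - z| < d3 -> `|H x - H z| < eta.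
Hypothesis w_unif : forall y z, K y -> `|y - z| < d4 -> `|w y - w z| < eta.
Hypotheses (N1 : 2 / N%:R < d1) (N2 : 4 * L / N%:R < d2) (N3 : 4 * L / N%:R < d3) (N4 : 2 / N%:R < d4).

Let u x := if `[< U x >] then H x * cellbump p (phi x) else 0.

Lemma psiK_sub : psi @` K `<=` U.
Proof. by move=> _ [y /KW /psiK[Uy _] <-]. Qed.

Lemma H_continuous x : U x -> {for x, continuous H}.
Proof.
move=> Ux; apply: contM; last exact: det_jacobian_continuous.
have := C1_map_continuous oU phi1 Ux => h.
apply: (cont_comp (f := w) h); exact: cw.
Qed.

Lemma compact_psiK : compact (psi @` K).
Proof.
apply: continuous_compact => //; apply: continuous_in_subspaceT => y /set_mem Ky.
exact: C1_map_continuous oW psi1 (KW Ky).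
Qed.

Lemma H_supp x : U x -> ~ (psi @` K) x -> H x = 0.
Proof.
move=> Ux nKx; rewrite /H wK ?mul0r// => Kx; apply: nKx.
by exists (phi x) => //; have [] := phiK Ux.
Qed.

Lemma cell_Cc : Cc u.
Proof.
apply: (ext_continuous oU compact_psiK psiK_sub) => x Ux; last first.
  by move=> nKx; rewrite (H_supp Ux nKx) mul0r.
apply: contM; first exact: H_continuous.
have h := C1_map_continuous oU phi1 Ux.
exact: cont_comp h (@cellbump_continuous N M p (phi x)).
Qed.

(* [psi] is Lipschitz, so the derivative of [phi] is bounded below. *)
Lemma jacobian_lower y0 (h : V) : K y0 -> `|h| <= 2 * L * `|h *m jacobian phi (psi y0)|.
Proof.
move=> Ky0; set J := jacobian phi (psi y0).
have [->|h0] := eqVneq h 0; first by rewrite normr0 !mulr_ge0// ltW.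
have hp : 0 < `|h| by rewrite normr_gt0.
pose B := `|h *m J| + eta * `|h| + 1.
have B0 : 0 < B by rewrite ltr_wpDl// addr_ge0// mulr_ge0// ltW.
pose s := Num.min (d2 / `|h|) (d1 / B) / 2.
have m0 : 0 < Num.min (d2 / `|h|) (d1 / B) by rewrite lt_min !divr_gt0.
have s0 : 0 < s by rewrite /s divr_gt0.
have [s2 s1] : s < d2 / `|h| /\ s < d1 / B.
  have : s < Num.min (d2 / `|h|) (d1 / B) by rewrite /s; lra.
  by rewrite lt_min => /andP[].
clearbody s; rewrite ltr_pdivlMr// in s2; rewrite ltr_pdivlMr// in s1.
have [_ fy] := psiK (KW Ky0).
have sh : `|s *: h| = s * `|h| by rewrite normrZ gtr0_norm.
have [Uz E] : U (psi y0 + s *: h) /\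
    `|phi (psi y0 + s *: h) - y0 - s *: (h *m J)| <= eta * (s * `|h|).
  have [] := @phi_est (psi y0) (psi y0 + s *: h); first by exists y0.
    by rewrite opprD addrA subrr add0r normrN sh.
  by rewrite fy [_ + _ - psi y0]addrAC subrr add0r -scalemxAl sh.
have E2 : `|phi (psi y0 + s *: h) - y0| <= s * `|h *m J| + eta * (s * `|h|).
  rewrite -[_ - y0](subrK (s *: (h *m J))); apply: le_trans (ler_normD _ _) _.
  by rewrite addrC normrZ (gtr0_norm s0) lerD2l.
have [_] := @psi_lip y0 (phi (psi y0 + s *: h)) Ky0 ltac:(rewrite distrC; apply: le_lt_trans E2 _;
    apply: le_lt_trans s1; rewrite /B; nra).
have [_ ->] := phiK Uz.
rewrite opprD addrA subrr add0r normrN sh distrC => E3.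
have E4 : s * `|h| <= s * (L * (`|h *m J| + eta * `|h|)).
  apply: le_trans E3 _; rewrite [leRHS]mulrCA ler_pM2l// mulrDr [s * (eta * _)]mulrCA.
  exact: E2.
rewrite ler_pM2l// in E4; exact: le_of_contraction (normr_ge0 h) etaL E4.
Qed.

Lemma cell_estimate :
  `|int4 u - int4 (fun y => w y * cellbump p y)| <=
  ((8 * L) ^+ 4 * (1 + 32 * C1 * L) + 4 ^+ 4) * eta / N%:R ^+ 4.
Proof.
have Np : 0 < N%:R^-1 :> R by rewrite invr_gt0 ltr0n.
have Cb := @cellbump_Cc N M N0 p.
have [[y0 Ky0 by0]|none] := pselect (exists2 y, K y & cellbump p y != 0); last first.
  have z y : w y * cellbump p y = 0.
    have [Ky|/wK ->] := pselect (K y); last by rewrite mul0r.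
    have [->|b] := eqVneq (cellbump p y) 0; first by rewrite mulr0.
    by case: none; exists y.
  have -> : u = fun=> 0.
    by apply/funext => x; rewrite /u /H mulrAC z mul0r if_same.
  have -> : (fun y => w y * cellbump p y) = fun=> 0 by exact/funext.
  rewrite subrr normr0 divr_ge0// ?exprn_ge0// mulr_ge0 ?(ltW eta0)// addr_ge0 ?exprn_ge0//.
  by rewrite mulr_ge0 ?exprn_ge0 ?addr_ge0 ?mulr_ge0// ltW.
pose x0 := psi y0; pose J := jacobian phi x0.
have [Ux0 fx0] := psiK (KW Ky0).
have Kx0 : (psi @` K) x0 by exists y0.
have dJ : 0 < \det J by exact: det_pos.
pose A x := (x - x0) *m J + y0.
pose v x := H x0 * cellbump p (A x).
have [CbA EbA] : Cc (fun x => cellbump p (A x)) /\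
    int4 (fun x => cellbump p (A x)) = (\det J)^-1 * int4 (cellbump p).
  have := scales_comp (scales_translate (y0 - x0 *m J)) (scales_mulmx (lt0r_neq0 dJ)) Cb.
  have -> : (fun x => cellbump p (A x)) = (fun y => cellbump p (y *m J + (y0 - x0 *m J))).
    by apply/funext => x; rewrite /A mulmxBl -addrA [- _ + _]addrC.
  by rewrite mul1r (gtr0_norm dJ).
have Cv : Cc v by exact: CcZ.
have Ev : int4 v = w y0 * int4 (cellbump p).
  by rewrite (int4Z _ CbA) EbA /H fx0 -/x0 -/J mulrA mulfK ?(lt0r_neq0 dJ).
have Cu := cell_Cc.
have lt0 x : 4 * L / N%:R < `|x - x0| -> u x = 0 /\ v x = 0.
  move=> hx; split; apply/eqP; apply: contraTT hx; rewrite -leNgt.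
    rewrite /u; case: asboolP => [Ux|_]; last by rewrite eqxx.
    rewrite mulf_eq0 negb_or => /andP[Hx bx].
    have Kx : K (phi x).
      by apply: contrapT => nK; move: Hx; rewrite /H wK ?mul0r ?eqxx.
    have h := cellbump_near N0 by0 bx.
    have [_] := @psi_lip y0 (phi x) Ky0 (lt_trans h N1).
    have [_ ->] := phiK Ux; rewrite -/x0 distrC => h2; apply: le_trans h2 _.
    apply: le_trans (cell_radius (ltW L0) (ltW h)); rewrite -mulrA ler_peMl ?ler1n//.
    by rewrite mulr_ge0// ltW.
  rewrite /v mulf_eq0 negb_or => /andP[_ bx].
  have h := cellbump_near N0 by0 bx; rewrite /A opprD addrCA subrr addr0 normrN in h.
  have h2 := jacobian_lower (x - x0) Ky0; apply: le_trans h2 _.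
  exact: cell_radius (ltW L0) (ltW h).
pose e1 := (1 + 32 * C1 * L) * eta.
have e10 : 0 <= e1 by rewrite /e1 mulr_ge0 ?addr_ge0 ?mulr_ge0// ltW.
have uv x : `|u x - v x| <= e1.
  have [hx|hx] := ltP (4 * L / N%:R) `|x - x0|.
    by have [-> ->] := lt0 x hx; rewrite subrr normr0.
  have [Ux E] := @phi_est x0 x Kx0 ltac:(rewrite distrC; exact: le_lt_trans hx N2).
  rewrite fx0 in E.
  have h3 := @H_unif x0 x Kx0 ltac:(rewrite distrC; exact: le_lt_trans hx N3).
  rewrite /u /v asboolT//.
  have -> : H x * cellbump p (phi x) - H x0 * cellbump p (A x) =
      (H x - H x0) * cellbump p (phi x) + H x0 * (cellbump p (phi x) - cellbump p (A x)) by ring.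
  apply: le_trans (ler_normD _ _) _; rewrite /e1 [leRHS]mulrDl mul1r; apply: lerD; rewrite normrM.
    rewrite distrC -[leRHS]mulr1; apply: ler_pM => //; first exact: ltW.
    by rewrite ger0_norm ?cellbump_ge0 ?cellbump_le1.
  have h4 := @cellbump_lip N M N0 p (phi x) (A x).
  have h5 : `|phi x - A x| <= eta * (4 * L / N%:R).
    have -> : phi x - A x = phi x - y0 - (x - x0) *m J by rewrite /A opprD addrA addrAC.
    by apply: le_trans E _; rewrite ler_pM2l.
  apply: (@le_trans _ _ (C1 * (8 * N%:R * (eta * (4 * L / N%:R))))).
    apply: ler_pM => //; first exact: H_bound.
    by apply: le_trans h4 _; rewrite ler_wpM2l// mulr_ge0.
  rewrite le_eqVlt; apply/orP; left; apply/eqP; field.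
  by rewrite pnatr_eq0 -lt0n.
have I1 : `|int4 u - int4 v| <= (2 * (4 * L / N%:R)) ^+ 4 * e1.
  have Cuv : Cc (fun x => u x + -1 * v x) by exact: CcD Cu (CcZ _ Cv).
  have -> : int4 u - int4 v = int4 (fun x => u x + -1 * v x).
    by rewrite int4D ?int4Z ?mulN1r//; exact: CcZ.
  apply: (@int4_le_at x0) => //.
  - by rewrite mulr_ge0 ?mulr_ge0// ltW.
  - by move=> x; rewrite mulN1r.
  - by move=> x /lt0[-> ->]; rewrite mulr0 addr0.
have Cwb : Cc (fun y => w y * cellbump p y).
  have := CcM Cb cw; congr Cc; by apply/funext => y; rewrite mulrC.
have I2 : `|int4 (fun y => w y * cellbump p y) - w y0 * int4 (cellbump p)| <= (2 * (2 / N%:R)) ^+ 4 * eta.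
  have CbZ : Cc (fun y => - w y0 * cellbump p y) by exact: CcZ.
  have Cs := CcD Cwb CbZ.
  have -> : int4 (fun y => w y * cellbump p y) - w y0 * int4 (cellbump p) =
      int4 (fun y => w y * cellbump p y + - w y0 * cellbump p y).
    by rewrite (int4D Cwb CbZ) (int4Z _ Cb) mulNr.
  apply: (@int4_le_at y0) => //.
  - exact: ltW.
  - move=> y; rewrite -mulrDl; have [->|b] := eqVneq (cellbump p y) 0; first by rewrite mulr0 normr0 ltW.
    have h := @w_unif y0 y Ky0 (lt_trans (cellbump_near N0 by0 b) N4).
    rewrite normrM -[leRHS]mulr1; apply: ler_pM => //; first by rewrite distrC ltW.
    by rewrite ger0_norm ?cellbump_ge0 ?cellbump_le1.
  - move=> y hy; suff -> : cellbump p y = 0 by rewrite !mulr0 addr0.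
    by apply/eqP; apply: contraTT hy => b; rewrite -leNgt distrC (ltW (cellbump_near N0 by0 b)).
rewrite distrC in I2; rewrite -Ev in I2.
apply: le_trans (ler_distD (int4 v) _ _) _; apply: le_trans (lerD I1 I2) _.
rewrite /e1 le_eqVlt; apply/orP; left; apply/eqP; field.
by rewrite pnatr_eq0 -lt0n.
Qed.

End Cell.

Lemma cell_count (L C1 eta : R) (N M : nat) : (0 < N)%N -> 0 <= L -> 0 <= C1 -> 0 <= eta ->
  ((8 * L) ^+ 4 * (1 + 32 * C1 * L) + 4 ^+ 4) * eta / N%:R ^+ 4 *+ #|{: {ffun 'I_4 -> 'I_(N * M).*2.+1}}|
  <= ((8 * L) ^+ 4 * (1 + 32 * C1 * L) + 4 ^+ 4) * (2 * M%:R + 1) ^+ 4 * eta.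
Proof.
move=> N0 L0 C10 eta0; rewrite card_ffun !card_ord -mulr_natr natrX.
set c := (_ + 4 ^+ 4); have c0 : 0 <= c.
  by rewrite /c addr_ge0 ?exprn_ge0// mulr_ge0 ?exprn_ge0 ?addr_ge0 ?mulr_ge0.
have Np : 0 < N%:R :> R by rewrite ltr0n.
have h : ((N * M).*2.+1)%:R <= N%:R * (2 * M%:R + 1) :> R.
  by rewrite mulrDr mulr1 mulrCA -natrM -natrM -natrD ler_nat mul2n -addn1 leq_add2l.
apply: (@le_trans _ _ (c * eta / N%:R ^+ 4 * (N%:R * (2 * M%:R + 1)) ^+ 4)).
  rewrite ler_wpM2l//; first by rewrite divr_ge0 ?mulr_ge0 ?exprn_ge0// ltW.
  by apply: lerXn2r => //; rewrite nnegrE// mulr_ge0 ?addr_ge0 ?mulr_ge0// ltW.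
rewrite le_eqVlt; apply/orP; left; apply/eqP; field.
by rewrite lt0r_neq0.
Qed.

Lemma exists_nat_below (a b d1 d2 d3 d4 : R) : 0 <= a -> 0 <= b ->
  0 < d1 -> 0 < d2 -> 0 < d3 -> 0 < d4 ->
  exists2 N : nat, (0 < N)%N & [/\ a / N%:R < d1, b / N%:R < d2, b / N%:R < d3 & a / N%:R < d4].
Proof.
move=> a0 b0 d10 d20 d30 d40.
pose d := Num.min (Num.min d1 d2) (Num.min d3 d4); pose c := a + b + 1.
have dp : 0 < d by rewrite !lt_min d10 d20 d30 d40.
have cp : 0 < c by rewrite /c; lra.
have [N N0 HN] := exists_inv_lt (divr_gt0 dp cp); exists N => //.
have Np : 0 < N%:R^-1 :> R by rewrite invr_gt0 ltr0n.
rewrite ltr_pdivlMr// mulrC in HN.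
have ha : a / N%:R < d by apply: le_lt_trans HN; rewrite ler_pM2r// /c; lra.
have hb : b / N%:R < d by apply: le_lt_trans HN; rewrite ler_pM2r// /c; lra.
by move: ha hb; rewrite !lt_min => /andP[/andP[-> _] /andP[_ ->]] /andP[/andP[_ ->] /andP[-> _]].
Qed.

Theorem change_of_variables (w : V -> R) (K : set V) :
  continuous w -> compact K -> K `<=` W -> (forall y, ~ K y -> w y = 0) ->
  Cc (fun x => if `[< U x >] then w (phi x) * \det (jacobian phi x) else 0) /\
  int4 (fun x => if `[< U x >] then w (phi x) * \det (jacobian phi x) else 0) = int4 w.
Proof.
move=> cw cK KW wK; pose H x := w (phi x) * \det (jacobian phi x).
set u := fun x => _.
have cK' : compact (psi @` K) by exact: compact_psiK.
have K'U : psi @` K `<=` U by exact: psiK_sub.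
have Hc x : U x -> {for x, continuous H} by move=> Ux; exact: H_continuous.
have Cu : Cc u.
  by apply: (ext_continuous oU cK' K'U) => // x Ux nKx; exact: (H_supp wK Ux nKx).
split; first exact: Cu.
have [M HM] := compact_norm_nat cK.
have [L [d1 [L0 d10 psi_lip]]] := C1_lipschitz oW psi1 cK KW.
have [C1 C10 H_bound] := compact_bounded_fun cK' (fun x Kx => Hc x (K'U x Kx)).
apply/eqP; rewrite -subr_eq0; apply/eqP.
apply: (@norm_le_all_eps _ _ (((8 * L) ^+ 4 * (1 + 32 * C1 * L) + 4 ^+ 4) * (2 * M%:R + 1) ^+ 4)) => e e0.
pose eta := Num.min e (1 / 2 / L).
have eta0 : 0 < eta by rewrite lt_min e0 divr_gt0.
have etaL : L * eta <= 1 / 2.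
  by rewrite mulrC -ler_pdivlMr// /eta ge_min lexx orbT.
have etae : eta <= e by rewrite /eta ge_min lexx.
clearbody eta.
have [d2 d20 phi_est] := jacobian_estimate oU phi1 cK' K'U eta0.
have [d3 d30 H_unif] := compact_uniform cK' (fun x Kx => Hc x (K'U x Kx)) eta0.
have [d4 d40 w_unif] := compact_uniform cK (fun y _ => cw y) eta0.
have L40 : 0 <= 4 * L by rewrite mulr_ge0// ltW.
have [N N0 [N1 N2 N3 N4]] := exists_nat_below (ler0n R 2) L40 d10 d20 d30 d40.
pose up (p : {ffun 'I_4 -> 'I_(N * M).*2.+1}) x :=
  if `[< U x >] then H x * cellbump p (phi x) else 0.
pose wp (p : {ffun 'I_4 -> 'I_(N * M).*2.+1}) y := w y * cellbump p y.
have Cup p : Cc (up p) by exact: (@cell_Cc w K N M p cw cK KW wK).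
have Cwp p : Cc (wp p).
  have := CcM (@cellbump_Cc N M N0 p) cw; congr Cc; by apply/funext => y; rewrite mulrC.
have w0 y : w y = 0 \/ `|y| <= M%:R.
  by have [/HM Ky|/wK ->] := pselect (K y); [right|left].
have Eu : u = fun x => \sum_p up p x.
  apply/funext => x; rewrite /u /up; case: asboolP => Ux; last by rewrite big1.
  rewrite -mulr_sumr /H; have [->|h] := w0 (phi x); first by rewrite !mul0r.
  by rewrite cellbump_sum// mulr1.
have Ew : w = fun y => \sum_p wp p y.
  apply/funext => y; rewrite /wp -mulr_sumr.
  by have [->|h] := w0 y; [rewrite mul0r|rewrite cellbump_sum// mulr1].
rewrite Eu [in X in _ - X]Ew (int4_sum _ Cup) (int4_sum _ Cwp) -sumrB.
apply: le_trans (ler_norm_sum _ _ _) _.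
apply: (@le_trans _ _ (\sum_(p : {ffun 'I_4 -> 'I_(N * M).*2.+1})
   ((8 * L) ^+ 4 * (1 + 32 * C1 * L) + 4 ^+ 4) * eta / N%:R ^+ 4)).
  apply: ler_sum => p _.
  exact: (@cell_estimate w K L d1 C1 eta d2 d3 d4 N M p cw cK KW wK N0 L0 C10 eta0 etaL d10 d20 psi_lip phi_est H_bound H_unif w_unif N1 N2 N3 N4).
rewrite sumr_const; apply: le_trans (cell_count _ N0 (ltW L0) C10 (ltW eta0)) _.
rewrite ler_wpM2l// mulr_ge0 ?exprn_ge0 ?addr_ge0 ?mulr_ge0 ?exprn_ge0 ?addr_ge0//.
all: by rewrite ?mulr_ge0// ltW.
Qed.

End ChangeOfVariables.

(** * Forms of type (0,2) on a tangent space *)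

Section Algebra.
Variable R : realType.
Local Notation C := R[i].
Implicit Types (V : lmodType C) (D g : 'M[R]_4) (z w : C).

(* Row [k] of [P01] is [ubar k] times its row [lead k]. *)
Definition ubar (k : 'I_4) : C := if odd k then - 'i%C else 1.
Definition lead (k : 'I_4) : 'I_4 := if (k < 2)%N then 0 else 2%:R.

Lemma P01E k p : P01 R k p =
  2^-1 * ((k == p)%:R + 'i%C * (if ~~ odd k && (p == k.+1 :> nat) then 1
                  else if odd k && (k == p.+1 :> nat) then -1 else 0)).
Proof.
rewrite !mxE; case: ifP => _; first by rewrite rmorph1.
by case: ifP => _; rewrite ?rmorphN1 ?rmorph0.
Qed.

Lemma mulii : 'i%C * 'i%C = -1 :> C.
Proof. by rewrite -expr2 sqr_i. Qed.

Lemma P01_lead k p : P01 R k p = ubar k * P01 R (lead k) p.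
Proof.
rewrite !P01E /ubar /lead.
have e := mulii.
elim/ord4P: k; elim/ord4P: p => /=; ring: e.
Qed.

Lemma P01_idem k m : \sum_p P01 R k p * P01 R p m = P01 R k m.
Proof.
rewrite sum4 !P01E; have e := mulii.
elim/ord4P: k; elim/ord4P: m => /=; by field: e.
Qed.

(* Components of the part of type (0,2) relative to its (0,2)-entry. *)
Definition s02 (k l : 'I_4) : C :=
  if (k < 2)%N && (2 <= l)%N then ubar k * ubar l
  else if (2 <= k)%N && (l < 2)%N then - (ubar k * ubar l) else 0.

Lemma opp_self V (v : V) : v = - v -> v = 0.
Proof.
move=> h; apply/eqP; have : (2 : C) *: v == 0.
  by rewrite scaler_nat mulr2n {1}h addNr.
by rewrite scaler_eq0 pnatr_eq0.
Qed.

Lemma part02_alt V (B : form2 V) : Defs.alternating B -> Defs.alternating (part02 B).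
Proof.
move=> hB k l; rewrite /part02 exchange_big -sumrN; apply: eq_bigr => q _.
by rewrite -sumrN; apply: eq_bigr => p _; rewrite (hB p q) scalerN mulrC.
Qed.

Lemma part02_lead V (B : form2 V) k l :
  part02 B k l = (ubar k * ubar l) *: part02 B (lead k) (lead l).
Proof.
rewrite /part02 scaler_sumr; apply: eq_bigr => p _; rewrite scaler_sumr.
apply: eq_bigr => q _; rewrite scalerA (P01_lead k) (P01_lead l); congr (_ *: _).
by rewrite mulrACA.
Qed.

Lemma part02E V (B : form2 V) : Defs.alternating B ->
  part02 B = fun k l => s02 k l *: part02 B 0 2%:R.
Proof.
move=> /part02_alt hB; apply/funext => k; apply/funext => l.
rewrite part02_lead /s02 /lead.
have h0 k' : part02 B k' k' = 0 by apply: opp_self; exact: hB.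
have [hk|hk] := ltnP k 2; have [hl|hl] := ltnP l 2 => /=.
- by rewrite h0 scaler0 scale0r.
- by [].
- by rewrite hB scalerN scaleNr.
- by rewrite h0 scaler0 scale0r.
Qed.

Lemma mulmxJ (D : 'M[R]_4) : Jmx R *m D = D *m Jmx R ->
  forall k m, \sum_p P01 R k p * (D p m)%:C = \sum_p (D k p)%:C * P01 R p m.
Proof.
move=> hJ k m.
have h (A : 'M[R]_4) : map_mx (real_complex R) A *m P01 R = P01 R *m map_mx (real_complex R) A ->
    \sum_p P01 R k p * (A p m)%:C = \sum_p (A k p)%:C * P01 R p m.
  move=> /matrixP/(_ k m); rewrite !mxE => e; symmetry; move: e.
  under eq_bigr => p _ do rewrite mxE.
  by move=> ->; apply: eq_bigr => p _; rewrite [X in _ * X]mxE.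
apply: h; rewrite /P01 -scalemxAl -scalemxAr mulmxDl mulmxDr mul1mx mulmx1.
by rewrite -scalemxAl -scalemxAr -!map_mxM hJ.
Qed.

Lemma part02_pull2 V D (B : form2 V) : Jmx R *m D = D *m Jmx R ->
  part02 (pull2 D B) = pull2 D (part02 B).
Proof.
move=> /mulmxJ hD; apply/funext => k; apply/funext => l; rewrite /part02 /pull2.
have h (M N : 'I_4 -> 'I_4 -> C) : \sum_p \sum_q (M k p * M l q) *: \sum_r \sum_s (N p r * N q s) *: B r s =
   \sum_r \sum_s ((\sum_p M k p * N p r) * (\sum_q M l q * N q s)) *: B r s.
  under eq_bigr => p _.
    under eq_bigr => q _.
      rewrite scaler_sumr; under eq_bigr => r _.
        rewrite scaler_sumr; under eq_bigr => s _ do rewrite scalerA.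
      over.
    over.
    rewrite exchange_big /=.
    under eq_bigr => r _ do rewrite exchange_big /=.
  over.
  rewrite exchange_big /=; apply: eq_bigr => r _.
  rewrite exchange_big; apply: eq_bigr => s _.
  rewrite big_distrlr /= scaler_suml; apply: eq_bigr => p _; rewrite scaler_suml.
  by apply: eq_bigr => q _; rewrite mulrACA.
transitivity (\sum_r \sum_s ((\sum_p P01 R k p * (D p r)%:C) * (\sum_q P01 R l q * (D q s)%:C)) *: B r s).
  rewrite -(h (fun a b => P01 R a b) (fun a b => (D a b)%:C)).
  by do 4 (apply: eq_bigr => ? _; try congr (_ *: _)); rewrite rmorphM.
under eq_bigr => r _ do under eq_bigr => s _ do rewrite !hD.
rewrite -(h (fun a b => (D a b)%:C) (fun a b => P01 R a b)).
by apply: eq_bigr => p _; apply: eq_bigr => q _; rewrite rmorphM.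
Qed.

Definition kappa D : C := \sum_p \sum_q (D 0 p * D 2%:R q)%:C * s02 p q.

Lemma part02_kappa V D (B : form2 V) : Jmx R *m D = D *m Jmx R -> Defs.alternating B ->
  part02 (pull2 D B) 0 2%:R = kappa D *: part02 B 0 2%:R.
Proof.
move=> hJ hB; rewrite part02_pull2// [in LHS](part02E hB) /pull2 /kappa scaler_suml.
by apply: eq_bigr => p _; rewrite scaler_suml; apply: eq_bigr => q _; rewrite scalerA.
Qed.

Lemma commJP D : Jmx R *m D = D *m Jmx R ->
  [/\ D 1 0 = - D 0 1, D 1 1 = D 0 0, D 1 2%:R = - D 0 3%:R & D 1 3%:R = D 0 2%:R] /\
  [/\ D 3%:R 0 = - D 2%:R 1, D 3%:R 1 = D 2%:R 0, D 3%:R 2%:R = - D 2%:R 3%:R & D 3%:R 3%:R = D 2%:R 2%:R].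
Proof.
move=> /matrixP h.
have e k l : \sum_p Jmx R k p * D p l = \sum_p D k p * Jmx R p l.
  by have := h k l; rewrite !mxE.
have := (e 0 0, e 0 1, e 0 2%:R, e 0 3%:R, (e 2%:R 0, e 2%:R 1, e 2%:R 2%:R, e 2%:R 3%:R)).
rewrite !sum4 !mxE /= !mul0r !mul1r !mulr0 !mulr1 !mulrN1 !addr0 !add0r.
by move=> [[[[-> ->] ->] ->]] [[[-> ->] ->] ->].
Qed.

Definition minor_nat (K : Type) (a : nat -> nat -> K) (m i k : nat) := a i.+1 (fintype.bump m k).

Lemma det_nat (K : comPzRingType) m (a : nat -> nat -> K) :
  \det (\matrix_(i < m.+1, j < m.+1) a i j) =
  \sum_(j < m.+1) a 0%N j * ((-1) ^+ j * \det (\matrix_(i < m, k < m) minor_nat a j i k)).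
Proof.
rewrite (expand_det_row _ 0); apply: eq_bigr => j _; rewrite mxE /cofactor; congr (_ * (_ * \det _)).
by apply/matrixP => i k; rewrite !mxE.
Qed.

Lemma det4 (K : comPzRingType) (A : 'M[K]_4) : \det A =
  A 0 0 * (A 1 1 * (A 2%:R 2%:R * A 3%:R 3%:R - A 2%:R 3%:R * A 3%:R 2%:R)
         - A 1 2%:R * (A 2%:R 1 * A 3%:R 3%:R - A 2%:R 3%:R * A 3%:R 1)
         + A 1 3%:R * (A 2%:R 1 * A 3%:R 2%:R - A 2%:R 2%:R * A 3%:R 1))
  - A 0 1 * (A 1 0 * (A 2%:R 2%:R * A 3%:R 3%:R - A 2%:R 3%:R * A 3%:R 2%:R)
         - A 1 2%:R * (A 2%:R 0 * A 3%:R 3%:R - A 2%:R 3%:R * A 3%:R 0)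
         + A 1 3%:R * (A 2%:R 0 * A 3%:R 2%:R - A 2%:R 2%:R * A 3%:R 0))
  + A 0 2%:R * (A 1 0 * (A 2%:R 1 * A 3%:R 3%:R - A 2%:R 3%:R * A 3%:R 1)
         - A 1 1 * (A 2%:R 0 * A 3%:R 3%:R - A 2%:R 3%:R * A 3%:R 0)
         + A 1 3%:R * (A 2%:R 0 * A 3%:R 1 - A 2%:R 1 * A 3%:R 0))
  - A 0 3%:R * (A 1 0 * (A 2%:R 1 * A 3%:R 2%:R - A 2%:R 2%:R * A 3%:R 1)
         - A 1 1 * (A 2%:R 0 * A 3%:R 2%:R - A 2%:R 2%:R * A 3%:R 0)
         + A 1 2%:R * (A 2%:R 0 * A 3%:R 1 - A 2%:R 1 * A 3%:R 0)).
Proof.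
pose a i j := A (inord i) (inord j).
have -> : A = \matrix_(i < 4, j < 4) a i j.
  by apply/matrixP => i j; rewrite mxE /a !inord_val.
rewrite det_nat sum4 !det_nat !big_ord_recl !big_ord0 !det_nat !big_ord_recl !big_ord0 !det_mx11 !mxE /=.
rewrite /minor_nat /fintype.bump /=.
ring.
Qed.

Lemma kappaE D : Jmx R *m D = D *m Jmx R ->
  kappa D = ((D 0 0)%:C - 'i%C * (D 0 1)%:C) * ((D 2%:R 2%:R)%:C - 'i%C * (D 2%:R 3%:R)%:C)
   - ((D 0 2%:R)%:C - 'i%C * (D 0 3%:R)%:C) * ((D 2%:R 0)%:C - 'i%C * (D 2%:R 1)%:C).
Proof.
move=> _; rewrite /kappa !sum4 /s02 /ubar /= !rmorphM; ring.
Qed.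

Lemma kappa_norm D : Jmx R *m D = D *m Jmx R -> kappa D * conjc (kappa D) = (\det D)%:C.
Proof.
move=> hJ; rewrite (kappaE hJ) det4; have [[-> -> -> ->] [-> -> -> ->]] := commJP hJ.
move: (D 0 0) (D 0 1) (D 2%:R 2%:R) (D 2%:R 3%:R) (D 0 2%:R) (D 0 3%:R) (D 2%:R 0) (D 2%:R 1) => a b c d e f k l.
by apply/eqP; rewrite eq_complex /=; apply/andP; split; apply/eqP; ring.
Qed.

Lemma det_commJ_ge0 D : Jmx R *m D = D *m Jmx R -> 0 <= \det D.
Proof. by move=> hJ; rewrite -ler0c -(kappa_norm hJ) mulcJ_ge0. Qed.

Lemma JmxT : (Jmx R)^T = - Jmx R.
Proof.
by apply/matrixP => i j; rewrite !mxE; elim/ord4P: i; elim/ord4P: j; rewrite /= ?oppr0 ?opprK.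
Qed.

Lemma Jmx_sqr : Jmx R *m Jmx R = - 1%:M.
Proof.
apply/matrixP => i j; rewrite !mxE sum4 !mxE; elim/ord4P: i; elim/ord4P: j; rewrite /=; ring.
Qed.

Section Metric.
Variable g : 'M[R]_4.
Hypothesis gT : g^T = g.
Hypothesis gpos : forall v : 'rV[R]_4, v != 0 -> 0 < (v *m g *m v^T) 0 0.
Hypothesis gJ : Jmx R *m g *m (Jmx R)^T = g.
Local Notation h := (invmx g).

Lemma metric_unit : g \in unitmx.
Proof.
rewrite -row_free_unit -kermx_eq0; apply/eqP/row_matrixP => i; rewrite row0.
have [//|/gpos] := eqVneq (row i (kermx g)) 0.
by rewrite -row_mul mulmx_ker row0 mul0mx mxE ltxx.
Qed.

Lemma inv_sym : h^T = h.
Proof. by rewrite trmx_inv gT. Qed.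

Lemma inv_pos (v : 'rV[R]_4) : v != 0 -> 0 < (v *m h *m v^T) 0 0.
Proof.
move=> v0; have : v *m h != 0.
  by apply: contraNneq v0 => e; rewrite -[v](mulmxKV metric_unit) e mul0mx.
by move/gpos; rewrite (mulmxKV metric_unit) trmx_mul inv_sym mulmxA.
Qed.

Lemma inv_commJ : Jmx R *m h = h *m Jmx R.
Proof.
have e : Jmx R *m g = g *m Jmx R.
  rewrite -[in RHS]gJ -[RHS]mulmxA JmxT mulNmx Jmx_sqr opprK mulmx1.
  by [].
apply: (can_inj (mulKmx metric_unit)); rewrite mulmxA -e -mulmxA.
by rewrite mulmxA (mulmxK metric_unit) mulmxA mulmxV ?metric_unit// mul1mx.
Qed.

Lemma inv_entries : [/\ h 0 1 = 0, h 2%:R 3%:R = 0, h 2%:R 0 = h 0 2%:R & h 2%:R 1 = - h 0 3%:R].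
Proof.
have [[e1 e2 e3 e4] [e5 e6 e7 e8]] := commJP inv_commJ.
have S k l : h k l = h l k by rewrite -[in LHS]inv_sym mxE.
split.
- have := S 1 0; rewrite e1; lra.
- have := S 3%:R 2%:R; rewrite e7; lra.
- exact: S.
- by rewrite S e3.
Qed.

Lemma kappa_inv : kappa h = (h 0 0 * h 2%:R 2%:R - h 0 2%:R ^+ 2 - h 0 3%:R ^+ 2)%:C.
Proof.
rewrite (kappaE inv_commJ); have [-> -> -> ->] := inv_entries.
rewrite !(rmorphM, rmorphB, rmorphD, rmorphN, rmorphXn, rmorph0) /=.
move: (h 0 0)%:C (h 2%:R 2%:R)%:C (h 0 2%:R)%:C (h 0 3%:R)%:C => a b c d.
have ei := mulii; ring: ei.
Qed.

Lemma kappa_inv_pos : 0 < h 0 0 * h 2%:R 2%:R - h 0 2%:R ^+ 2 - h 0 3%:R ^+ 2.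
Proof.
have Q (v : 'rV[R]_4) : (v *m h *m v^T) 0 0 = \sum_q (\sum_p v 0 p * h p q) * v 0 q.
  by rewrite mxE; apply: eq_bigr => q _; rewrite !mxE.
have d0 : 0 < h 2%:R 2%:R.
  have : ('e_(2%:R) : 'rV[R]_4) != 0.
    by apply/eqP => /rowP/(_ 2%:R); rewrite !mxE eqxx => /eqP; rewrite oner_eq0.
  by move/inv_pos; rewrite Q !sum4 !mxE /= !mul0r !mulr0 !mul1r !mulr1 !add0r !addr0.
pose v : 'rV[R]_4 := point4 (h 2%:R 2%:R) 0 (- h 0 2%:R) (- h 0 3%:R).
have v0 : v != 0.
  by apply/eqP => /rowP/(_ 0); rewrite !mxE /= => e; rewrite e ltxx in d0.
have := inv_pos v0; rewrite Q !sum4 !mxE /=.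
have [[e1 e2 e3 e4] [e5 e6 e7 e8]] := commJP inv_commJ.
have [f1 f2 f3 f4] := inv_entries.
rewrite ?(e1,e2,e3,e4,e5,e6,e7,e8) ?(f1,f2,f3,f4).
move: (h 0 0) (h 2%:R 2%:R) (h 0 2%:R) (h 0 3%:R) d0 => a d b c d0 Hq.
rewrite -(pmulr_rgt0 _ d0); move: Hq; congr (_ < _); ring.
Qed.

Lemma vol_kappa : vol g = (h 0 0 * h 2%:R 2%:R - h 0 2%:R ^+ 2 - h 0 3%:R ^+ 2)^-1.
Proof.
have := kappa_norm inv_commJ; rewrite kappa_inv conjc_real -rmorphM => /complexI.
move: kappa_inv_pos; set N := (X in 0 < X) => N0; rewrite det_inv => e.
by rewrite /vol -[\det g]invrK -e invfM -expr2 sqrtr_sqr gtr0_norm// invr_gt0.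
Qed.

Lemma kappa_vol : exists2 N : R, 0 < N & kappa h = N%:C /\ vol g = N^-1.
Proof.
by eexists; [exact: kappa_inv_pos|split; [exact: kappa_inv|exact: vol_kappa]].
Qed.

Lemma vol_gt0 : 0 < vol g.
Proof. by rewrite vol_kappa invr_gt0 kappa_inv_pos. Qed.
End Metric.

Lemma conjM z w : conjc (z * w) = conjc z * conjc w.
Proof. exact: rmorphM. Qed.

Lemma conjD z w : conjc (z + w) = conjc z + conjc w.
Proof. exact: rmorphD. Qed.

Lemma realC_eq0 (c : R) : (c%:C == 0 :> C) = (c == 0).
Proof. by rewrite eq_complex /= eqxx andbT. Qed.

Lemma Re_sum (J : Type) (r : seq J) (P : pred J) (F : J -> C) :
  complex.Re (\sum_(j <- r | P j) F j) = \sum_(j <- r | P j) complex.Re (F j).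
Proof. by apply: (big_morph (@complex.Re R)) => // -[x y] [z w]. Qed.

Lemma Im_sum (J : Type) (r : seq J) (P : pred J) (F : J -> C) :
  complex.Im (\sum_(j <- r | P j) F j) = \sum_(j <- r | P j) complex.Im (F j).
Proof. by apply: (big_morph (@complex.Im R)) => // -[x y] [z w]. Qed.

Lemma herm_sum n (u v : 'cV[C]_n) : herm u v = \sum_r conjc (v r 0) * u r 0.
Proof. by rewrite /herm mxE; apply: eq_bigr => r _; rewrite !mxE. Qed.

Lemma hermZl n c (u v : 'cV[C]_n) : herm (c *: u) v = c * herm u v.
Proof. by rewrite /herm -scalemxAr mxE. Qed.

Lemma hermZr n c (u v : 'cV[C]_n) : herm u (c *: v) = conjc c * herm u v.
Proof.
rewrite !herm_sum mulr_sumr; apply: eq_bigr => r _.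
by rewrite mxE rmorphM mulrA.
Qed.

Lemma hermDl n (u u' v : 'cV[C]_n) : herm (u + u') v = herm u v + herm u' v.
Proof. by rewrite /herm mulmxDr mxE. Qed.

Lemma hermDr n (u u' v : 'cV[C]_n) : herm v (u + u') = herm v u + herm v u'.
Proof.
by rewrite !herm_sum -big_split; apply: eq_bigr => r _; rewrite mxE rmorphD mulrDl.
Qed.

Lemma herm_conj n (u v : 'cV[C]_n) : conjc (herm u v) = herm v u.
Proof.
rewrite !herm_sum rmorph_sum; apply: eq_bigr => r _.
by rewrite rmorphM /= conjcK mulrC.
Qed.

Lemma herm_ge0 n (u : 'cV[C]_n) : 0 <= herm u u.
Proof. by rewrite herm_sum sumr_ge0// => r _; rewrite mulrC mulcJ_ge0. Qed.

Lemma herm_eq0 n (u : 'cV[C]_n) : herm u u = 0 -> u = 0.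
Proof.
rewrite herm_sum => /eqP; rewrite psumr_eq0; last by move=> r _; rewrite mulrC mulcJ_ge0.
move=> /allP h; apply/matrixP => r c; rewrite (ord1 c) mxE.
have := h r (mem_index_enum r); rewrite /= mulf_eq0 conjc_eq0 orbb => /eqP; exact.
Qed.

Lemma herm_cauchy_schwarz n (u v : 'cV[C]_n) :
  herm u v * conjc (herm u v) <= herm u u * herm v v.
Proof.
have [A0|A0] := eqVneq (herm v v) 0.
  by rewrite (herm_eq0 A0) /herm /adjmx map_mx0 trmx0 !mul0mx mxE rmorph0 !mulr0.
have Ap : 0 < herm v v by rewrite lt_neqAle eq_sym A0 herm_ge0.
have cA : conjc (herm v v) = herm v v by rewrite herm_conj.
rewrite -subr_ge0 -(pmulr_rge0 _ Ap).
have := herm_ge0 (herm v v *: u + (- herm u v) *: v).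
rewrite hermDl !hermDr !hermZl !hermZr rmorphN /= cA -(herm_conj u v) => h.
apply: le_trans h _; rewrite le_eqVlt; apply/orP; left; apply/eqP.
ring.
Qed.

Lemma pull2_alt V D (B : form2 V) : Defs.alternating B -> Defs.alternating (pull2 D B).
Proof.
move=> hB k l; rewrite /pull2 exchange_big -sumrN; apply: eq_bigr => q _.
by rewrite -sumrN; apply: eq_bigr => p _; rewrite (hB p q) scalerN mulrC.
Qed.

Lemma s02_alt V (u : V) : Defs.alternating (fun k l => s02 k l *: u).
Proof.
move=> k l; rewrite -scaleNr /s02; congr (_ *: _).
by elim/ord4P: k; elim/ord4P: l; rewrite /ubar /=; ring.
Qed.

Lemma part02_s02 V (u : V) : part02 (fun k l => s02 k l *: u) 0 2%:R = u.
Proof.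
rewrite /part02; under eq_bigr => p _ do (under eq_bigr => q _ do rewrite scalerA); 
under eq_bigr => p _ do rewrite -scaler_suml; rewrite -scaler_suml -[RHS]scale1r; congr (_ *: _).
rewrite !sum4 !P01E /s02 /ubar /=; have ei := mulii; by field: ei.
Qed.

Lemma pull2_s02 V D (u : V) : Jmx R *m D = D *m Jmx R ->
  pull2 D (fun k l => s02 k l *: u) = fun k l => s02 k l *: (kappa D *: u).
Proof.
move=> hJ; have a := s02_alt u.
rewrite -[LHS](_ : part02 (pull2 D (fun k l => s02 k l *: u)) = _); last first.
  by rewrite part02_pull2// (part02E a) part02_s02.
by rewrite (part02E (pull2_alt D a)) part02_kappa// part02_s02.
Qed.

Lemma s02_norm k l : conjc (s02 k l) * s02 k l = ((k < 2)%N (+) (l < 2)%N)%:R.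
Proof.
apply/eqP; elim/ord4P: k; elim/ord4P: l; rewrite /s02 /ubar /= eq_complex /=;
by apply/andP; split; apply/eqP; ring.
Qed.

Lemma vol_herm2 g n (u v : 'cV[C]_n) : g^T = g ->
  (forall w : 'rV[R]_4, w != 0 -> 0 < (w *m g *m w^T) 0 0) ->
  Jmx R *m g *m (Jmx R)^T = g ->
  (vol g)%:C * herm2 g (fun k l => s02 k l *: u) (fun k l => s02 k l *: v) = 4 * herm u v.
Proof.
move=> gT gp gJ; rewrite /herm2 /raise2 pull2_s02; last exact: (inv_commJ gp gJ).
have [N N0 [-> ->]] := kappa_vol gT gp gJ.
under eq_bigr => p _ do (under eq_bigr => q _ do rewrite hermZr !hermZl).
rewrite (_ : \sum_p _ = 8 * (N%:C * herm u v)); last first.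
  under eq_bigr => p _ do (under eq_bigr => q _ do rewrite mulrA s02_norm).
  by rewrite !sum4 /=; ring.
have NC : N%:C != 0 by rewrite realC_eq0 lt0r_neq0.
rewrite fmorphV; by field.
Qed.

Lemma herm1_ge0 g n (a : form1 'cV[C]_n) : g^T = g ->
  (forall w : 'rV[R]_4, w != 0 -> 0 < (w *m g *m w^T) 0 0) ->
  0 <= complex.Re (herm1 g a a).
Proof.
move=> gT gp; rewrite /herm1.
have E (r : 'I_n) (s : bool) : 0 <= \sum_p \sum_q invmx g p q * ((if s then complex.Re (a p r 0) else complex.Im (a p r 0)) *
   (if s then complex.Re (a q r 0) else complex.Im (a q r 0))).
  pose v : 'rV[R]_4 := \row_p (if s then complex.Re (a p r 0) else complex.Im (a p r 0)).
  have -> : \sum_p \sum_q invmx g p q * ((if s then complex.Re (a p r 0) else complex.Im (a p r 0)) *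
   (if s then complex.Re (a q r 0) else complex.Im (a q r 0))) = (v *m invmx g *m v^T) 0 0.
    rewrite mxE exchange_big; apply: eq_bigr => q _; rewrite !mxE mulr_suml.
    by apply: eq_bigr => p _; rewrite !mxE mulrA [_ * invmx g p q]mulrC.
  have [->|v0] := eqVneq v 0; first by rewrite !mul0mx mxE.
  exact/ltW/(inv_pos gT gp v0).
have -> : complex.Re (\sum_p \sum_q (invmx g p q)%:C * herm (a p) (a q)) =
  \sum_r (\sum_p \sum_q invmx g p q * (complex.Re (a p r 0) * complex.Re (a q r 0)) +
         \sum_p \sum_q invmx g p q * (complex.Im (a p r 0) * complex.Im (a q r 0))).
  rewrite [LHS]Re_sum; under eq_bigr => p _ do rewrite Re_sum.
  under [RHS]eq_bigr => r _ do rewrite -big_split /=.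
  rewrite [RHS]exchange_big; apply: eq_bigr => p _ /=.
  under [RHS]eq_bigr => r _ do rewrite -big_split /=.
  rewrite [RHS]exchange_big; apply: eq_bigr => q _ /=.
  rewrite herm_sum mulr_sumr [LHS]Re_sum; apply: eq_bigr => r _.
  by case: (a p r 0) => x y; case: (a q r 0) => z w /=; ring.
rewrite sumr_ge0// => r _; apply: addr_ge0; [exact: (E r true)|exact: (E r false)].
Qed.

Lemma trace_brace n (tau : R) (A : 'M[C]_n) : (0 < n)%N -> \tr (brace tau A) = tau%:C * \tr A.
Proof.
move=> n0; have nC : n%:R != 0 :> C by rewrite pnatr_eq0 -lt0n.
have trB (B D : 'M[C]_n) : \tr (B - D) = \tr B - \tr D by exact: raddfB.
have trS (c : C) : \tr (c%:M : 'M[C]_n) = n%:R * c by rewrite mxtrace_scalar mulr_natl.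
rewrite /brace mxtraceD trB !trS; move: (\tr A) => q.
by field.
Qed.

Lemma brace_herm n (tau : R) (al be : 'cV[C]_n) (e : C) : (0 < n)%N -> tau != 0 ->
  let f := 4^-1 *: brace tau (rank_one be al) + e%:M in
  let q := herm be al in let t := \tr f in
  [/\ t = 4^-1 * tau%:C * q + n%:R * e &
   4 * herm (f *m al) be = herm be be * herm al al - q * conjc q / n%:R
     + 16 / (n%:R * tau%:C) * (t * conjc t) - 16 / tau%:C * (t * conjc e)].
Proof.
move=> n0 tau0 f q t.
have nC : n%:R != 0 :> C by rewrite pnatr_eq0 -lt0n.
have tC : tau%:C != 0 by rewrite realC_eq0.
have trq : \tr (rank_one be al) = q by rewrite /rank_one mxtrace_mulC /mxtrace big_ord1.
have tE : t = 4^-1 * tau%:C * q + n%:R * e.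
  rewrite /t /f mxtraceD mxtraceZ trace_brace// trq mxtrace_scalar.
  by rewrite -[e *+ n]mulr_natl [4^-1 * (_ * _)]mulrA.
split; first exact: tE.
have -> : herm (f *m al) be = 4^-1 * (herm be be * herm al al - q / n%:R * conjc q + tau%:C / n%:R * q * conjc q) + e * conjc q.
  rewrite /f mulmxDl -scalemxAl /brace mulmxDl mulmxBl !mul_scalar_mx trq /rank_one -mulmxA.
  rewrite (_ : adjmx al *m al = (herm al al)%:M) ?mul_mx_scalar; last first.
    by rewrite /herm [LHS]mx11_scalar.
  rewrite hermDl hermZl !hermDl -scaleNr !hermZl /q herm_conj; ring.
have ct : conjc t = 4^-1 * tau%:C * conjc q + n%:R * conjc e.
  by rewrite tE conjD !conjM conjc_inv !conjc_nat conjc_real.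
rewrite ct tE.
by field; rewrite nC tC.
Qed.

Lemma conj_sum (J : Type) (r : seq J) (P : pred J) (F : J -> C) :
  conjc (\sum_(j <- r | P j) F j) = \sum_(j <- r | P j) conjc (F j).
Proof. exact: rmorph_sum. Qed.

Lemma part20_conj (B : form2 C^o) k l : (forall p q, conjc (B p q) = - B p q) ->
  part20 B k l = - conjc (part02 B k l).
Proof.
move=> hB; rewrite /part20 /part02 conj_sum -sumrN; apply: eq_bigr => p _.
rewrite conj_sum -sumrN; apply: eq_bigr => q _.
rewrite [(P01 R k p * _) *: _]/(_ * _ * _) !conjM hB mulrN opprK.
by rewrite /P10 !mxE.
Qed.

End Algebra.

(** * Calculus of partial derivatives *)

Section PartialDerivatives.
Variable R : realType.
Local Notation V := 'rV[R]_4.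
Local Notation C := R[i].
Implicit Types (f g : V -> R) (F G : V -> C) (x y z : V) (k l : 'I_4) (U W K : set V).

Definition has_pdR k f y (d : R) := derivable f y 'e_k /\ pd k f y = d.

Lemma has_pdR_cst k (c : R) y : has_pdR k (fun _ => c) y 0.
Proof. by split; [exact: derivable_cst|exact: derive_cst]. Qed.

Lemma has_pdRD k f g y (d e : R) : has_pdR k f y d -> has_pdR k g y e ->
  has_pdR k (fun z => f z + g z) y (d + e).
Proof.
move=> [df <-] [dg <-]; split; first exact: (derivableD df dg).
exact: (deriveD df dg).
Qed.

Lemma has_pdRN k f y (d : R) : has_pdR k f y d -> has_pdR k (fun z => - f z) y (- d).
Proof.
move=> [df <-]; split; first exact: (derivableN df).
exact: (deriveN df).
Qed.

Lemma has_pdRM k f g y (d e : R) : has_pdR k f y d -> has_pdR k g y e ->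
  has_pdR k (fun z => f z * g z) y (d * g y + f y * e).
Proof.
move=> [df <-] [dg <-]; split; first exact: (derivableM df dg).
rewrite /pd [LHS](deriveM df dg) addrC mulrC; congr (_ + _).
Qed.

Lemma has_pdR_near k f g y (d : R) : (\forall z \near y, f z = g z) ->
  has_pdR k f y d -> has_pdR k g y d.
Proof.
move=> fg [df <-]; have e0 : 'e_k != 0 :> V.
  by apply/eqP => /rowP/(_ k); rewrite !mxE !eqxx => /eqP; rewrite oner_eq0.
split; first exact: near_eq_derivable fg df.
rewrite /pd; symmetry; exact: near_eq_derive.
Qed.

Lemma has_pdR_ext k f g y (d e : R) : (forall z, f z = g z) -> d = e ->
  has_pdR k f y d -> has_pdR k g y e.
Proof. by move=> /funext -> ->. Qed.

Lemma C1_on_pd W f y k : C1_on W f -> W y -> has_pdR k f y (pd k f y).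
Proof. by move=> c Wy; split=> //; have [] := c y Wy k. Qed.

Lemma C1_near W f g : open W -> (forall y, W y -> f y = g y) -> C1_on W f -> C1_on W g.
Proof.
move=> oW fg c y Wy k; have nW : \forall z \near y, W z by exact: open_nbhs_nbhs.
have E z : W z -> has_pdR k g z (pd k f z).
  move=> Wz; apply: has_pdR_near (C1_on_pd k c Wz).
  have : \forall t \near z, W t by exact: open_nbhs_nbhs.
  by apply: filterS => t /fg.
split; first by have [] := E y Wy.
apply: near_eq_continuous (c y Wy k).2; apply: filterS nW => z Wz.
by have [] := E z Wz.
Qed.

Lemma C1_of W f (d : 'I_4 -> V -> R) : open W ->
  (forall y k, W y -> has_pdR k f y (d k y)) ->
  (forall y k, W y -> {for y, continuous (d k)}) -> C1_on W f.
Proof.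
move=> oW h c y Wy k; split; first by have [] := h y k Wy.
apply: near_eq_continuous (c y k Wy).
have : \forall z \near y, W z by exact: open_nbhs_nbhs.
by apply: filterS => z Wz; have [] := h z k Wz.
Qed.

Lemma C1_cst W (c : R) : open W -> C1_on W (fun=> c).
Proof.
move=> oW; apply: (C1_of (d := fun _ _ => 0)) => // y k Wy; first exact: has_pdR_cst.
exact: cont_cst.
Qed.

Lemma C1D W f g : open W -> C1_on W f -> C1_on W g -> C1_on W (fun z => f z + g z).
Proof.
move=> oW cf cg; apply: (C1_of (d := fun k z => pd k f z + pd k g z)) => // y k Wy.
  by apply: has_pdRD; apply: C1_on_pd Wy.
by apply: contD; [exact: (cf y Wy k).2|exact: (cg y Wy k).2].
Qed.

Lemma C1N W f : open W -> C1_on W f -> C1_on W (fun z => - f z).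
Proof.
move=> oW cf; apply: (C1_of (d := fun k z => - pd k f z)) => // y k Wy.
  by apply: has_pdRN; apply: C1_on_pd Wy.
by apply: contN; exact: (cf y Wy k).2.
Qed.

Lemma C1M W f g : open W -> C1_on W f -> C1_on W g -> C1_on W (fun z => f z * g z).
Proof.
move=> oW cf cg; apply: (C1_of (d := fun k z => pd k f z * g z + f z * pd k g z)) => // y k Wy.
  by apply: has_pdRM; apply: C1_on_pd Wy.
have c1 := C1_continuous oW cf Wy; have c2 := C1_continuous oW cg Wy.
by apply: contD; [exact: (contM (cf y Wy k).2 c2)|exact: (contM c1 (cg y Wy k).2)].
Qed.

Definition has_pd k F y (d : C) :=
  has_pdR k (fun z => complex.Re (F z)) y (complex.Re d) /\
  has_pdR k (fun z => complex.Im (F z)) y (complex.Im d).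

Definition pdC k F y : C :=
  pd k (fun z => complex.Re (F z)) y +i* pd k (fun z => complex.Im (F z)) y.

Lemma has_pdE k F y d : has_pd k F y d -> pdC k F y = d.
Proof. by case: d => a b [[_ /= e] [_ /= e']]; rewrite /pdC e e'. Qed.

Lemma has_pd_eq k F y d e : d = e -> has_pd k F y d -> has_pd k F y e.
Proof. by move=> ->. Qed.

Lemma has_pd_cst k (c : C) y : has_pd k (fun _ => c) y 0.
Proof. by split; exact: has_pdR_cst. Qed.

Lemma has_pd_ext k F G y d e : (forall z, F z = G z) -> d = e ->
  has_pd k F y d -> has_pd k G y e.
Proof. by move=> /funext -> ->. Qed.

Lemma has_pdD k F G y d e : has_pd k F y d -> has_pd k G y e ->
  has_pd k (fun z => F z + G z) y (d + e).
Proof.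
move=> [f1 f2] [g1 g2]; split.
  apply: has_pdR_ext (has_pdRD f1 g1); last by case: (d) (e) => ? ? [].
  by move=> z; case: (F z) (G z) => ? ? [].
apply: has_pdR_ext (has_pdRD f2 g2); last by case: (d) (e) => ? ? [].
by move=> z; case: (F z) (G z) => ? ? [].
Qed.

Lemma has_pdM k F G y d e : has_pd k F y d -> has_pd k G y e ->
  has_pd k (fun z => F z * G z) y (d * G y + F y * e).
Proof.
move=> [f1 f2] [g1 g2]; split.
  apply: has_pdR_ext (has_pdRD (has_pdRM f1 g1) (has_pdRN (has_pdRM f2 g2))).
    by move=> z; case: (F z) (G z) => ? ? [].
  by case: (d) (e) (F y) (G y) => ? ? [? ?] [? ?] [? ?] /=; ring.
apply: has_pdR_ext (has_pdRD (has_pdRM f1 g2) (has_pdRM f2 g1)).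
  by move=> z; case: (F z) (G z) => ? ? [].
by case: (d) (e) (F y) (G y) => ? ? [? ?] [? ?] [? ?] /=; ring.
Qed.

Lemma has_pdZ k (c : C) F y d : has_pd k F y d -> has_pd k (fun z => c * F z) y (c * d).
Proof.
move=> h; apply: has_pd_eq (has_pdM (has_pd_cst k c y) h); by rewrite mul0r add0r.
Qed.

Lemma has_pdN k F y d : has_pd k F y d -> has_pd k (fun z => - F z) y (- d).
Proof.
by move=> /(has_pdZ (-1)); apply: has_pd_ext => [z|]; rewrite mulN1r.
Qed.

Lemma has_pdB k F G y d e : has_pd k F y d -> has_pd k G y e ->
  has_pd k (fun z => F z - G z) y (d - e).
Proof. by move=> hF hG; apply: has_pdD => //; exact: has_pdN. Qed.

Lemma has_pd_sum k (J : Type) (r : seq J) (P : pred J) (F : J -> V -> C) y (d : J -> C) :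
  (forall j, has_pd k (F j) y (d j)) ->
  has_pd k (fun z => \sum_(j <- r | P j) F j z) y (\sum_(j <- r | P j) d j).
Proof.
move=> h; elim: r => [|j r IH].
  by apply: has_pd_ext (has_pd_cst k 0 y) => [z|]; rewrite big_nil.
case Pj : (P j); last by apply: has_pd_ext IH => [z|]; rewrite big_cons Pj.
by apply: has_pd_ext (has_pdD (h j) IH) => [z|]; rewrite big_cons Pj.
Qed.

Lemma has_pd_conj k F y d : has_pd k F y d -> has_pd k (fun z => conjc (F z)) y (conjc d).
Proof.
move=> [h1 h2]; split.
  by apply: has_pdR_ext h1 => [z|]; [case: (F z)|case: (d)].
by apply: has_pdR_ext (has_pdRN h2) => [z|]; [case: (F z)|case: (d)].
Qed.

Lemma has_pd_real k f y (d : R) : has_pdR k f y d -> has_pd k (fun z => (f z)%:C) y d%:C.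
Proof. by move=> h; split=> //; exact: has_pdR_cst. Qed.

Lemma has_pd_near k F G y d : (\forall z \near y, F z = G z) ->
  has_pd k F y d -> has_pd k G y d.
Proof.
by move=> FG [h1 h2]; split; [move: h1|move: h2]; apply: has_pdR_near;
  apply: filterS FG => z ->.
Qed.

Definition C1C W F := C1_on W (fun z => complex.Re (F z)) /\
  C1_on W (fun z => complex.Im (F z)).

Lemma C1C_pd W F y k : C1C W F -> W y -> has_pd k F y (pdC k F y).
Proof. by move=> [c1 c2] Wy; split; [exact: C1_on_pd c1 Wy|exact: C1_on_pd c2 Wy]. Qed.

Lemma C1C_near W F G : open W -> (forall y, W y -> F y = G y) -> C1C W F -> C1C W G.
Proof.
by move=> oW FG [c1 c2]; split; [apply: C1_near c1|apply: C1_near c2] => // y Wy; rewrite FG.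
Qed.

Lemma C1C_cst W (c : C) : open W -> C1C W (fun=> c).
Proof. by move=> oW; split; exact: C1_cst. Qed.

Lemma C1CD W F G : open W -> C1C W F -> C1C W G -> C1C W (fun z => F z + G z).
Proof.
move=> oW [f1 f2] [g1 g2]; split.
  by apply: C1_near (C1D oW f1 g1) => // y _; case: (F y) (G y) => ? ? [].
by apply: C1_near (C1D oW f2 g2) => // y _; case: (F y) (G y) => ? ? [].
Qed.

Lemma C1CM W F G : open W -> C1C W F -> C1C W G -> C1C W (fun z => F z * G z).
Proof.
move=> oW [f1 f2] [g1 g2]; split.
  apply: C1_near (C1D oW (C1M oW f1 g1) (C1N oW (C1M oW f2 g2))) => // y _.
  by case: (F y) (G y) => ? ? [].
apply: C1_near (C1D oW (C1M oW f1 g2) (C1M oW f2 g1)) => // y _.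
by case: (F y) (G y) => ? ? [].
Qed.

Lemma C1C_conj W F : open W -> C1C W F -> C1C W (fun z => conjc (F z)).
Proof.
move=> oW [f1 f2]; split; first by apply: C1_near f1 => // y _; case: (F y).
by apply: C1_near (C1N oW f2) => // y _; case: (F y).
Qed.

Lemma C1C_sum W (J : Type) (r : seq J) (P : pred J) (F : J -> V -> C) : open W ->
  (forall j, C1C W (F j)) -> C1C W (fun z => \sum_(j <- r | P j) F j z).
Proof.
move=> oW h; elim: r => [|j r IH].
  by apply: C1C_near (C1C_cst 0 oW) => // y _; rewrite big_nil.
case Pj : (P j); last by apply: C1C_near IH => // y _; rewrite big_cons Pj.
by apply: C1C_near (C1CD oW (h j) IH) => // y _; rewrite big_cons Pj.
Qed.

Lemma C1C_real W f : open W -> C1_on W f -> C1C W (fun z => (f z)%:C).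
Proof. by move=> oW c; split=> //; exact: C1_cst. Qed.

Lemma smooth_C1 W f : smooth_on W f -> C1_on W f.
Proof.
move=> h y Wy k; split; first exact: (h [::] y Wy).2.
exact: (h [:: k] y Wy).1.
Qed.

Lemma smooth_pd W f k : smooth_on W f -> smooth_on W (pd k f).
Proof.
move=> h s y Wy; have E : iter_partial s (pd k f) = iter_partial (rcons s k) f.
  by rewrite /iter_partial foldr_rcons.
by rewrite E; exact: h.
Qed.

Lemma smoothC_C1 W F : smoothC_on W F -> C1C W F.
Proof. by move=> [h1 h2]; split; exact: smooth_C1. Qed.

Lemma smoothC_pd W F k : smoothC_on W F -> smoothC_on W (pdC k F).
Proof. by move=> [h1 h2]; split; exact: smooth_pd. Qed.

Lemma smoothC_schwarz W F y k l : open W -> W y -> smoothC_on W F ->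
  pdC k (pdC l F) y = pdC l (pdC k F) y.
Proof.
move=> oW Wy [h1 h2].
have e1 := schwarz oW Wy (smooth_C1 h1) (smooth_C1 (smooth_pd k h1)) (smooth_C1 (smooth_pd l h1)).
have e2 := schwarz oW Wy (smooth_C1 h2) (smooth_C1 (smooth_pd k h2)) (smooth_C1 (smooth_pd l h2)).
transitivity (pd k (pd l (fun z => complex.Re (F z))) y +i* pd k (pd l (fun z => complex.Im (F z))) y).
  reflexivity.
by rewrite e1 e2.
Qed.

Lemma int4_pd W K f k : open W -> compact K -> K `<=` W -> C1_on W f ->
  (forall y, W y -> ~ K y -> f y = 0) ->
  let u := fun y => if `[< W y >] then pd k f y else 0 in Cc u /\ int4 u = 0.
Proof.
move=> oW cK KW c f0 u; set v := fun y => if `[< W y >] then f y else 0.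
have clK : closed K by exact: (compact_closed (@norm_hausdorff _ _) cK).
have off y : ~ K y -> \forall z \near y, ~ K z.
  by move=> nK; apply: open_nbhs_nbhs; split=> //; exact: closed_openC.
have pd0 y : W y -> ~ K y -> has_pdR k f y 0.
  move=> Wy nK; apply: has_pdR_near (has_pdR_cst k 0 y).
  have nW : \forall z \near y, W z by exact: open_nbhs_nbhs.
  near=> z; rewrite f0//; near: z; [exact: nW|exact: off].
have Cu : Cc u.
  apply: (ext_continuous oW cK KW) => y Wy; first exact: (c y Wy k).2.
  by move=> nK; have [] := pd0 y Wy nK.
have Cv : Cc v by apply: (ext_continuous oW cK KW) => // y Wy; exact: C1_continuous oW c Wy.
split=> //.
have dv y : has_pdR k v y (u y).
  have [Wy|nW] := pselect (W y).
    have -> : u y = pd k f y by rewrite /u asboolT.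
    apply: has_pdR_near (C1_on_pd k c Wy).
    have : \forall z \near y, W z by exact: open_nbhs_nbhs.
    by apply: filterS => z Wz; rewrite /v asboolT.
  have -> : u y = 0 by rewrite /u asboolF.
  apply: has_pdR_near (has_pdR_cst k 0 y); have nK : ~ K y by move=> /KW.
  apply: filterS (off y nK) => z nKz; rewrite /v; case: asboolP => // Wz.
  by rewrite f0.
rewrite (@int4_inner R k v u 0) ?mul0r// => y.
rewrite mul0r fibreE.
have [M _ Mv] := Cv.2; have [N _ Nu] := Cu.2.
apply: (@Rint_derive R M _ (fun t => v (upd y k t))).
- exact: fibre_cont_line Cu.1.
- exact: fibre_supp_line (Mv k).
- move=> t; have [d1 d2] := dv (upd y k t).
  by have := has_deriv_upd d1; rewrite d2.
Unshelve. all: by end_near. Qed.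
End PartialDerivatives.

(** * Fields in charts *)

Section Charts.
Variables (R : realType) (X : complexSurface R).
Local Notation C := R[i].
Local Notation V := 'rV[R]_4.
Local Notation coord := Defs.coord.
Implicit Types (i j m : idx X) (k l p : 'I_4) (x : X) (U K : set X) (f : X -> C) (r : X -> R).

Definition chart i : set V := coord i @` dom i.

Lemma open_chart i : open (chart i). Proof. exact: coord_open. Qed.

Lemma icoordK i y : chart i y -> coord i (icoord i y) = y.
Proof. by move=> [x dx <-]; rewrite coordK. Qed.

Lemma icoord_dom i y : chart i y -> dom i (icoord i y).
Proof. by move=> [x dx <-]; rewrite coordK. Qed.

Lemma chart_coord i x : dom i x -> chart i (coord i x).
Proof. by exists x. Qed.

Lemma icoord_continuous i y : chart i y -> {for y, continuous (icoord i)}.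
Proof.
move=> cy; have := @icoord_cont R X i.
by rewrite (continuous_open_subspace _ (@open_chart i)) => /(_ y); apply; rewrite inE.
Qed.

Lemma coord_continuous i x : dom i x -> {for x, continuous (coord i)}.
Proof.
move=> dx; have := @coord_cont R X i.
by rewrite (continuous_open_subspace _ (dom_open i)) => /(_ x); apply; rewrite inE.
Qed.

Lemma near_dom i x : dom i x -> \forall z \near x, dom i z.
Proof. by move=> dx; apply: open_nbhs_nbhs; split=> //; exact: dom_open. Qed.

Lemma near_chart i y : chart i y -> \forall z \near y, chart i z.
Proof. by move=> dx; apply: open_nbhs_nbhs; split=> //; exact: open_chart. Qed.

Lemma near_icoord i x (P : set X) : dom i x -> (\forall z \near x, P z) ->
  \forall y \near coord i x, P (icoord i y).
Proof.
move=> dx nP; apply: (icoord_continuous (chart_coord dx)).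
by rewrite /= coordK.
Qed.

Lemma open_image i U : open U -> U `<=` dom i -> open (coord i @` U).
Proof.
move=> oU Ui; rewrite openE => y [x Ux <-]; rewrite /interior.
have dx := Ui _ Ux.
have n1 : \forall z \near coord i x, U (icoord i z).
  by apply: near_icoord dx _; apply: open_nbhs_nbhs.
apply: filterS2 n1 (near_chart (chart_coord dx)) => z Uz cz.
by exists (icoord i z) => //; rewrite icoordK.
Qed.

Definition has_pdX i k f x d := has_pd k (f \o icoord i) (coord i x) d.

Lemma has_pdXE i k f x d : has_pdX i k f x d -> pder i k f x = d.
Proof. exact: has_pdE. Qed.

Lemma has_pdX_near i k f (g : X -> C) x d : dom i x -> (\forall z \near x, f z = g z) ->
  has_pdX i k f x d -> has_pdX i k g x d.
Proof. by move=> dx fg; apply: has_pd_near; exact: near_icoord dx fg. Qed.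

Definition C1X i U f := C1C (coord i @` U) (f \o icoord i).

Lemma C1X_pd i U f x k : C1X i U f -> U x -> has_pdX i k f x (pder i k f x).
Proof. by move=> c Ux; apply: (C1C_pd k c); exists x. Qed.

Lemma C1X_near i U f (g : X -> C) : open U -> U `<=` dom i ->
  (forall x, U x -> f x = g x) -> C1X i U f -> C1X i U g.
Proof.
move=> oU Ui fg; apply: C1C_near; first exact: open_image.
by move=> _ [x Ux <-] /=; rewrite coordK ?fg//; exact: Ui.
Qed.

Lemma C1XS i U (U' : set X) f : U' `<=` U -> C1X i U f -> C1X i U' f.
Proof.
by move=> s [c1 c2]; split=> y [x Ux <-]; [apply: c1|apply: c2]; exists x => //; exact: s.
Qed.

Lemma C1_cont i U r : open U -> U `<=` dom i -> C1_on (coord i @` U) (r \o icoord i) ->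
  forall x, U x -> {for x, continuous r}.
Proof.
move=> oU Ui c x Ux; have dx := Ui x Ux.
have cc : {for coord i x, continuous (r \o icoord i)}.
  by apply: C1_continuous (open_image oU Ui) c _; exists x.
apply: near_eq_continuous (cont_comp (f := r \o icoord i) (h := coord i) (coord_continuous dx) cc).
by apply: filterS (near_dom dx) => z dz /=; rewrite coordK.
Qed.

Lemma pd_cont i U r : open U -> U `<=` dom i -> C1_on (coord i @` U) (r \o icoord i) ->
  forall x k, U x -> {for x, continuous (pderR i k r)}.
Proof.
move=> oU Ui c x k Ux; have dx := Ui x Ux.
have cx : (coord i @` U) (coord i x) by exists x.
exact: (cont_comp (h := coord i) (coord_continuous dx) (c _ cx k).2).
Qed.

Lemma transition_C1 i j p : C1_on (coord i @` (dom i `&` dom j)) (fun y => coord j (icoord i y) 0 p).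
Proof. exact: smooth_C1 (transition_smooth p). Qed.

Lemma open_inter i j : open (dom i `&` dom j).
Proof. by apply: openI; exact: dom_open. Qed.

Lemma chain_pderR i j U r x k : open U -> U `<=` dom j -> U x -> dom i x ->
  C1_on (coord j @` U) (r \o icoord j) ->
  has_pdR k (r \o icoord i) (coord i x) (\sum_p jac i j x k p * pderR j p r x).
Proof.
move=> oU Uj Ux dix c; have djx := Uj x Ux.
pose phi := fun y => coord j (icoord i y).
have phix : phi (coord i x) = coord j x by rewrite /phi coordK.
have Wx : (coord j @` U) (phi (coord i x)) by exists x.
have dphi p : derivable (fun y => phi y 0 p) (coord i x) 'e_k.
  by have [] := @transition_C1 i j p (coord i x) (ex_intro2 _ _ x (conj dix djx) erefl) k.
have [d e] := chain_rule (open_image oU Uj) c Wx dphi.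
have h : has_pdR k (fun y => (r \o icoord j) (phi y)) (coord i x) (\sum_p jac i j x k p * pderR j p r x).
  split; first exact: d.
  rewrite e; apply: eq_bigr => p _; rewrite mxE; congr (_ * _).
  by rewrite phix.
apply: has_pdR_near h.
have : \forall z \near x, dom j z by exact: near_dom.
move/(near_icoord dix); apply: filterS => y dy /=.
by rewrite /phi coordK.
Qed.

Lemma chain_pder i j U f x k : open U -> U `<=` dom j -> U x -> dom i x ->
  C1X j U f -> has_pdX i k f x (\sum_p (jac i j x k p)%:C * pder j p f x).
Proof.
move=> oU Uj Ux dix [c1 c2]; split.
  refine (has_pdR_ext _ _ (@chain_pderR i j U (fun y => complex.Re (f y)) x k oU Uj Ux dix c1)) => //.
  by rewrite Re_sum; apply: eq_bigr => p _; rewrite /pder /=; ring.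
refine (has_pdR_ext _ _ (@chain_pderR i j U (fun y => complex.Im (f y)) x k oU Uj Ux dix c2)) => //.
by rewrite Im_sum; apply: eq_bigr => p _; rewrite /pder /=; ring.
Qed.

Lemma pd_coord k p (y : V) : has_pdR k (fun z : V => z 0 p) y (k == p)%:R.
Proof.
have cv : (fun h : R => h^-1 *: (((fun z : V => z 0 p) \o shift y) (h *: 'e_k) - y 0 p)) @ 0^' --> ((k == p)%:R : R).
  apply: (@cvg_near_cst); near=> h; have h0 : h != 0 by near: h; exact: nbhs_dnbhs_neq.
  rewrite /= !mxE addrK [_ *: _]mulrA mulVf// mul1r eqxx eq_sym; by [].
split; first by apply/cvg_ex; exists (k == p)%:R.
exact/cvg_lim.
Unshelve. all: by end_near. Qed.
Lemma jac_id i x : dom i x -> jac i i x = 1%:M.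
Proof.
move=> dx; apply/matrixP => k p; rewrite !mxE.
have [] // : has_pdR k (fun y => coord i (icoord i y) 0 p) (coord i x) (k == p)%:R.
apply: has_pdR_near (pd_coord k p _).
by apply: filterS (near_chart (chart_coord dx)) => y cy; rewrite icoordK.
Qed.

Lemma jac_cocycle i j m x : dom i x -> dom j x -> dom m x ->
  jac i m x = jac i j x *m jac j m x.
Proof.
move=> di dj dm; apply/matrixP => k p; rewrite [LHS]mxE [RHS]mxE.
have sub : dom j `&` dom m `<=` dom j by move=> ? [].
have [_ e] := @chain_pderR i j (dom j `&` dom m) (fun y => coord m y 0 p) x k
  (@open_inter j m) sub (conj dj dm) di (@transition_C1 j m p).
by rewrite /pderR -/(pd _ _ _) e; apply: eq_bigr => q _; congr (_ * _); rewrite mxE.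
Qed.

Lemma jac_inv i j x : dom i x -> dom j x -> jac i j x *m jac j i x = 1%:M.
Proof. by move=> di dj; rewrite -jac_cocycle// jac_id. Qed.

Lemma jacJ i j x : dom i x -> dom j x -> Jmx R *m jac i j x = jac i j x *m Jmx R.
Proof. by move=> di dj; have := transition_holomorphic di dj. Qed.

Lemma det_jac_gt0 i j x : dom i x -> dom j x -> 0 < \det (jac i j x).
Proof.
move=> di dj; rewrite lt_neqAle (det_commJ_ge0 (jacJ di dj)) andbT eq_sym.
apply/eqP => e; have := jac_inv di dj => /(congr1 determinant).
by rewrite det_mulmx e mul0r det1 => /eqP; rewrite eq_sym oner_eq0.
Qed.

Lemma jac_C1 i j k p : C1_on (coord i @` (dom i `&` dom j)) ((fun x => jac i j x k p) \o icoord i).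
Proof.
have sm := smooth_pd k (@transition_smooth R X i j p).
apply: C1_near (smooth_C1 sm); first by apply: open_image; [exact: open_inter|move=> ? []].
by move=> _ [x [di dj] <-] /=; rewrite mxE /pderR coordK.
Qed.

Lemma jac_sym i j x k l p : dom i x -> dom j x ->
  pderR i k (fun y => jac i j y l p) x = pderR i l (fun y => jac i j y k p) x.
Proof.
move=> di dj; have sm := @transition_smooth R X i j p.
have oW : open (coord i @` (dom i `&` dom j)) by apply: open_image; [exact: open_inter|move=> ? []].
have Wx : (coord i @` (dom i `&` dom j)) (coord i x) by exists x.
have E k' l' : pderR i k' (fun y => jac i j y l' p) x =
    pd k' (pd l' (fun y => coord j (icoord i y) 0 p)) (coord i x).
  have nW : \forall z \near coord i x, (coord i @` (dom i `&` dom j)) z by apply: open_nbhs_nbhs.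
  have [_ e] : has_pdR k' (pd l' (fun y => coord j (icoord i y) 0 p)) (coord i x)
      (pderR i k' (fun y => jac i j y l' p) x); last by rewrite -e.
  apply: has_pdR_near (C1_on_pd k' (@jac_C1 i j l' p) Wx).
  by apply: filterS nW => _ [z [iz jz] <-] /=; rewrite mxE /pderR coordK.
by rewrite !E; apply: schwarz oW Wx (smooth_C1 sm) (smooth_C1 (smooth_pd k sm)) (smooth_C1 (smooth_pd l sm)).
Qed.

Lemma C1_chart i j U r : open U -> U `<=` dom i `&` dom j ->
  C1_on (coord j @` U) (r \o icoord j) -> C1_on (coord i @` U) (r \o icoord i).
Proof.
move=> oU Uij c; have Ui : U `<=` dom i by move=> x /Uij[].
have Uj : U `<=` dom j by move=> x /Uij[].
apply: (C1_of (d := fun k => (fun x => \sum_p jac i j x k p * pderR j p r x) \o icoord i)).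
- exact: open_image.
- move=> _ k [x Ux <-] /=; rewrite coordK; last exact: Ui.
  by apply: (chain_pderR k oU Uj Ux _ c); exact: Ui.
- move=> _ k [x Ux <-]; have dx := Ui x Ux.
  apply: (cont_comp (h := icoord i) (icoord_continuous (chart_coord dx))).
  rewrite coordK//; apply: cont_sum => p; apply: contM.
    by apply: (C1_cont (@open_inter i j) _ (@jac_C1 i j k p)) => [z []//|]; exact: Uij.
  exact: (pd_cont oU Uj c).
Qed.

Lemma C1X_chart i j U f : open U -> U `<=` dom i `&` dom j -> C1X j U f -> C1X i U f.
Proof.
move=> oU Uij [c1 c2]; split.
  exact: (@C1_chart i j U (fun y => complex.Re (f y)) oU Uij c1).
exact: (@C1_chart i j U (fun y => complex.Im (f y)) oU Uij c2).
Qed.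

Lemma jac_C1X i j k p : C1X i (dom i `&` dom j) (fun x => (jac i j x k p)%:C).
Proof.
apply: (@C1C_real R _ ((fun x => jac i j x k p) \o icoord i)).
  by apply: open_image; [exact: open_inter|move=> ? []].
exact: jac_C1.
Qed.

Lemma pull1_mul (W : lmodType C) (A B : 'M[R]_4) (a : form1 W) :
  pull1 (A *m B) a = pull1 A (pull1 B a).
Proof.
apply/funext => k; rewrite /pull1.
under [RHS]eq_bigr => p _ do (rewrite scaler_sumr; under eq_bigr => q _ do rewrite scalerA -rmorphM).
rewrite exchange_big; apply: eq_bigr => q _ /=.
by rewrite mxE rmorph_sum scaler_suml.
Qed.

Lemma pull1_id (W : lmodType C) (a : form1 W) : pull1 1%:M a = a.
Proof.
apply/funext => k; rewrite /pull1 (bigD1 k)//= mxE eqxx scale1r big1 ?addr0// => p pk.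
by rewrite mxE eq_sym (negPf pk) scale0r.
Qed.

Definition d1 i (mu : X -> form1 C^o) x : form2 C^o := fun k l =>
  pder i k (fun y => mu y l) x - pder i l (fun y => mu y k) x.

Lemma d1_natural i j U (mu nu : X -> form1 C^o) x : open U -> U `<=` dom i `&` dom j ->
  (forall y, U y -> mu y = pull1 (jac i j y) (nu y)) ->
  (forall p, C1X j U (fun y => nu y p)) -> U x ->
  d1 i mu x = pull2 (jac i j x) (d1 j nu x).
Proof.
move=> oU Uij E c Ux; have [di dj] := Uij x Ux.
have Uj : U `<=` dom j by move=> z /Uij[].
have D k l : pder i k (fun y => mu y l) x =
  \sum_p ((pderR i k (fun y => jac i j y l p) x)%:C * nu x p +
    (jac i j x l p)%:C * \sum_q (jac i j x k q)%:C * pder j q (fun y => nu y p) x).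
  apply: has_pdXE.
  apply: (@has_pdX_near i k (fun y => \sum_p (jac i j y l p)%:C * nu y p)) => //.
    have : \forall z \near x, U z by apply: open_nbhs_nbhs.
    by apply: filterS => z /E ->.
  apply: has_pd_sum => p.
  have h1 : has_pdX i k (fun y => (jac i j y l p)%:C) x (pderR i k (fun y => jac i j y l p) x)%:C.
    apply: has_pd_real; apply: (C1_on_pd k (@jac_C1 i j l p)); by exists x.
  have h2 := @chain_pder i j U (fun y => nu y p) x k oU Uj Ux di (c p).
  by apply: has_pd_eq (has_pdM h1 h2) => /=; rewrite coordK.
apply/funext => k; apply/funext => l; rewrite /d1 !D -sumrB.
transitivity (\sum_p \sum_q ((jac i j x k q * jac i j x l p)%:C * pder j q (fun y => nu y p) x) -
   \sum_p \sum_q ((jac i j x l q * jac i j x k p)%:C * pder j q (fun y => nu y p) x)).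
  rewrite -sumrB; apply: eq_bigr => p _; rewrite (jac_sym k l p di dj) !mulr_sumr.
  rewrite opprD addrACA subrr add0r; congr (_ - _);
    by apply: eq_bigr => q _; rewrite mulrA -rmorphM /= [X in X%:C]mulrC.
rewrite exchange_big -sumrB /pull2; apply: eq_bigr => p _ /=; rewrite -sumrB.
by apply: eq_bigr => q _; rewrite [_ *: _]mulrBr; congr (_ - _ * _); rewrite mulrC.
Qed.
Definition ext i r (y : V) : R := if `[< chart i y >] then r (icoord i y) else 0.

Lemma compact_image i K : compact K -> K `<=` dom i -> compact (coord i @` K).
Proof.
move=> cK Ki; apply: continuous_compact => //.
exact: continuous_subspaceW Ki (@coord_cont R X i).
Qed.

Lemma ext_Cc i K r : compact K -> K `<=` dom i ->
  (forall x, dom i x -> {for x, continuous r}) ->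
  (forall x, dom i x -> ~ K x -> r x = 0) -> Cc (ext i r).
Proof.
move=> cK Ki cr r0; apply: (ext_continuous (@open_chart i) (compact_image cK Ki)).
- by move=> _ [x Kx <-]; exists x => //; exact: Ki.
- move=> y cy; apply: (cont_comp (h := icoord i) (icoord_continuous cy)).
  by apply: cr; exact: icoord_dom.
- move=> y cy nK; apply: r0; first exact: icoord_dom.
  by move=> Kx; apply: nK; exists (icoord i y) => //; exact: icoordK.
Qed.

Lemma int4_chart i j K r r' : compact K -> K `<=` dom i `&` dom j ->
  (forall x, dom j x -> {for x, continuous r'}) ->
  (forall x, dom j x -> ~ K x -> r' x = 0) -> (forall x, dom i x -> ~ K x -> r x = 0) ->
  (forall x, dom i x -> dom j x -> r x = \det (jac i j x) * r' x) ->
  int4 (ext i r) = int4 (ext j r').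
Proof.
move=> cK Kij cr' r'0 r0 E.
have Ki : K `<=` dom i by move=> x /Kij[].
have Kj : K `<=` dom j by move=> x /Kij[].
pose U := coord i @` (dom i `&` dom j); pose W := coord j @` (dom i `&` dom j).
pose phi := fun y => coord j (icoord i y); pose psi := fun y => coord i (icoord j y).
have oU : open U by apply: open_image; [exact: open_inter|move=> ? []].
have oW : open W by apply: open_image; [exact: open_inter|move=> ? []].
have phiK (x : V) : U x -> W (phi x) /\ psi (phi x) = x.
  by move=> [z [iz jz] <-]; rewrite /phi /psi !coordK//; split=> //; exists z.
have psiK (x : V) : W x -> U (psi x) /\ phi (psi x) = x.
  by move=> [z [iz jz] <-]; rewrite /phi /psi !coordK//; split=> //; exists z.
have psi1 p : C1_on W (fun y => psi y 0 p) by rewrite /W setIC; exact: transition_C1.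
have dp (x : V) : U x -> 0 < \det (jacobian phi x).
  by move=> [z [iz jz] <-]; exact: det_jac_gt0.
have Cw : Cc (ext j r') by exact: (ext_Cc cK Kj cr' r'0).
have [|y nK|_ <-] := change_of_variables oU oW phiK psiK (fun p => @transition_C1 i j p) psi1 dp Cw.1 (compact_image cK Kj).
- by move=> _ [x Kx <-]; exists x => //; exact: Kij.
- rewrite /ext; case: asboolP => // cy; apply: r'0; first exact: icoord_dom.
  by move=> Kx; apply: nK; exists (icoord j y) => //; exact: icoordK.
congr int4; apply/funext => y; rewrite /ext; case: asboolP => cy; last first.
  by rewrite asboolF// => -[z [iz jz] e]; apply: cy; exists z.
case: asboolP => Uy.
  case: Uy => x [ix jx] <-; rewrite coordK// E// asboolT; last by rewrite /phi coordK//; exact: chart_coord.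
  by rewrite /phi !coordK// mulrC.
apply: r0; first exact: icoord_dom.
move=> Kx; apply: Uy; exists (icoord i y); first exact: Kij.
exact: icoordK.
Qed.

Lemma C1X_cont i U f : open U -> U `<=` dom i -> C1X i U f ->
  forall x, U x -> {for x, continuous (fun y => complex.Re (f y))}.
Proof. by move=> oU Ui [c _]; exact: C1_cont c. Qed.

Definition dbar i (k : 'I_4) f x : C := \sum_p P01 R k p * pder i p f x.

Lemma int4_dbar i K k f : compact K -> K `<=` dom i -> C1X i (dom i) f ->
  (forall x, dom i x -> ~ K x -> f x = 0) ->
  let r := fun x => complex.Re (dbar i k f x) in Cc (ext i r) /\ int4 (ext i r) = 0.
Proof.
move=> cK Ki c f0 r.
have cI := compact_image cK Ki.
have KI : (coord i @` K) `<=` chart i by move=> _ [x Kx <-]; exists x => //; exact: Ki.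
have f0' y : chart i y -> ~ (coord i @` K) y -> (f \o icoord i) y = 0.
  move=> cy nK; apply: f0; first exact: icoord_dom.
  by move=> Kx; apply: nK; exists (icoord i y) => //; exact: icoordK.
have h1 p := int4_pd p (@open_chart i) cI KI c.1 (fun y cy nK => congr1 (@complex.Re R) (f0' y cy nK)).
have h2 p := int4_pd p (@open_chart i) cI KI c.2 (fun y cy nK => congr1 (@complex.Im R) (f0' y cy nK)).
pose F1 p y := if `[< chart i y >] then pd p (fun z => complex.Re ((f \o icoord i) z)) y else 0.
pose F2 p y := if `[< chart i y >] then pd p (fun z => complex.Im ((f \o icoord i) z)) y else 0.
have E : ext i r = fun y => \sum_p (complex.Re (P01 R k p) * F1 p y + (- complex.Im (P01 R k p)) * F2 p y).
  apply/funext => y; rewrite /ext /F1 /F2; case: asboolP => cy; last first.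
    by rewrite big1// => p _; rewrite !mulr0 addr0.
  rewrite /r /dbar Re_sum; apply: eq_bigr => p _.
  rewrite /pder /pderR icoordK//; case: (P01 R k p) => a b /=.
  by rewrite mulNr.
have C1' p : Cc (fun y => complex.Re (P01 R k p) * F1 p y) by exact: CcZ (h1 p).1.
have C2' p : Cc (fun y => (- complex.Im (P01 R k p)) * F2 p y) by exact: CcZ (h2 p).1.
have C3 p := CcD (C1' p) (C2' p).
split; first by rewrite E; exact: Cc_sum.
rewrite E (int4_sum _ C3) big1// => p _.
by rewrite (int4D (C1' p) (C2' p)) (int4Z _ (h1 p).1) (int4Z _ (h2 p).1) (h1 p).2 (h2 p).2 !mulr0 addr0.
Qed.

Section PartitionOfUnity.
Variable rho : idx X -> X -> R.
Hypothesis rhoP : partition_of_unity rho.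

Definition psupp i : set X := closure [set x | rho i x != 0].

Lemma rho_ge0 i x : 0 <= rho i x. Proof. by case: rhoP. Qed.
Lemma rho_sum x : \sum_i rho i x = 1. Proof. by case: rhoP. Qed.
Lemma psupp_dom i : psupp i `<=` dom i. Proof. by case: rhoP => _ _ h _; exact: h. Qed.
Lemma rho_smooth i j : smooth_on (chart j) (rho i \o icoord j).
Proof. by case: rhoP => _ _ _ h; exact: h. Qed.

Lemma psupp_closed i : closed (psupp i). Proof. exact: closed_closure. Qed.

Lemma psupp_compact i : compact (psupp i).
Proof. by apply: (subclosed_compact (@psupp_closed i) (@pts_compact R X)). Qed.

Lemma rho_out i x : ~ psupp i x -> rho i x = 0.
Proof.
by move=> h; apply/eqP/negPn/negP => r0; apply: h; exact: subset_closure.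
Qed.

Lemma rho_cont i x : {for x, continuous (rho i)}.
Proof.
have [j dj] := dom_cover x.
have c := smooth_C1 (@rho_smooth i j).
by apply: C1_cont c x dj; first exact: dom_open.
Qed.

Lemma int4_partition (W : idx X -> X -> R) i K : compact K -> closed K -> K `<=` dom i ->
  (forall j x, dom j x -> {for x, continuous (W j)}) ->
  (forall j m x, dom j x -> dom m x -> W j x = \det (jac j m x) * W m x) ->
  (forall j x, dom j x -> ~ K x -> W j x = 0) ->
  int4 (ext i (W i)) = \sum_j int4 (ext j (fun x => rho j x * W j x)).
Proof.
move=> cK clK Ki cW tW W0.
have -> : ext i (W i) = fun y => \sum_j ext i (fun x => rho j x * W i x) y.
  apply/funext => y; rewrite /ext; case: asboolP => cy; last by rewrite big1.
  by rewrite -mulr_suml rho_sum mul1r.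
rewrite int4_sum => [|j]; last first.
  apply: (ext_Cc cK Ki) => x dx; first by apply: contM; [exact: rho_cont|exact: cW].
  by move=> nK; rewrite W0// mulr0.
apply: eq_bigr => j _.
apply: (@int4_chart i j (K `&` psupp j)).
- apply: (subclosed_compact _ cK); last by move=> ? [].
  exact: closedI clK (@psupp_closed j).
- by move=> x [/Ki ? /psupp_dom ?].
- by move=> x dx; apply: contM; [exact: rho_cont|exact: cW].
- move=> x dx nK; have [Kx|nKx] := pselect (K x); last by rewrite W0// mulr0.
  by rewrite rho_out ?mul0r// => px; apply: nK.
- move=> x dx nK; have [Kx|nKx] := pselect (K x); last by rewrite W0// mulr0.
  by rewrite rho_out ?mul0r// => px; apply: nK.
- by move=> x di dj; rewrite (tW i j)// mulrCA.
Qed.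

(** * Stokes' formula *)

Section Stokes.
Variables (lam : idx X -> X -> form1 C^o) (eta : sform2 X).
Hypothesis lam_C1 : forall i k, C1X i (dom i) (fun x => lam i x k).
Hypothesis lam_tensor : forall i j x, dom i x -> dom j x -> lam i x = pull1 (jac i j x) (lam j x).
Hypotheses (eta2 : is_form2 eta) (etai : imaginary2 eta) (etah : holomorphic20 eta).

Definition e02 i x : C := part02 (eta i x) 0 2%:R.

Lemma e02_C1 i : C1X i (dom i) (e02 i).
Proof.
have [h _ _] := eta2; rewrite /C1X.
apply: (@C1C_sum R (chart i)) => [|p]; first exact: open_chart.
apply: (@C1C_sum R (chart i)) => [|q]; first exact: open_chart.
apply: (@C1CM R (chart i)); [exact: open_chart|apply: C1C_cst; exact: open_chart|].
exact: smoothC_C1 (h i p q).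
Qed.

Lemma e02_kappa i j x : dom i x -> dom j x -> e02 i x = kappa (jac i j x) * e02 j x.
Proof.
move=> di dj; have [_ a h] := eta2.
by rewrite /e02 (h i j)// part02_kappa//; [exact: jacJ|exact: a].
Qed.

Lemma has_pdX_conj i k f x d : has_pdX i k f x d -> has_pdX i k (fun y => conjc (f y)) x (conjc d).
Proof. exact: has_pd_conj. Qed.

Lemma dbar_e02 i k x : dom i x -> dbar i k (fun y => conjc (e02 i y)) x = 0.
Proof.
move=> dx; have := @etah i x k 0 2%:R dx; rewrite /part01 /dbar => h.
apply: oppr_inj; rewrite oppr0 -[RHS]h -sumrN; apply: eq_bigr => p _.
rewrite -mulrN [RHS]/(_ * _); congr (_ * _).
have c := has_pdX_conj (C1X_pd p (e02_C1 i) dx).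
have d := has_pdN c.
have e : has_pdX i p (fun y => part20 (eta i y) 0 2%:R) x (- conjc (pder i p (e02 i) x)).
  apply: (has_pdX_near dx _ d); apply: filterS (near_dom dx) => y dy.
  by rewrite part20_conj// => q r; exact: etai.
by rewrite (has_pdXE c) (has_pdXE e).
Qed.

Definition l01 (a : 'I_4) i x : C := part01 (lam i x) a.

Lemma l01_C1 a i : C1X i (dom i) (l01 a i).
Proof.
apply: (@C1C_sum R (chart i)) => [|p]; first exact: open_chart.
apply: (@C1CM R (chart i)); [exact: open_chart|apply: C1C_cst; exact: open_chart|].
exact: lam_C1.
Qed.

Definition t02 i x : C := part02 (d1 i (lam i) x) 0 2%:R.

Lemma part02_alt_sum (a b : 'I_4 -> 'I_4 -> C^o) k l :
  part02 (fun p q => a p q - b q p) k l =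
  \sum_p P01 R k p * (\sum_q P01 R l q * a p q) - \sum_q P01 R l q * (\sum_p P01 R k p * b q p).
Proof.
rewrite /part02.
under [X in X - _]eq_bigr => p _ do rewrite mulr_sumr.
under [X in _ - X]eq_bigr => p _ do rewrite mulr_sumr.
rewrite [X in _ - X]exchange_big -sumrB; apply: eq_bigr => p _ /=; rewrite -sumrB.
apply: eq_bigr => q _; rewrite [_ *: _]mulrBr mulrA; congr (_ - _).
by rewrite -mulrA mulrCA.
Qed.

Lemma pder_l01 a i p x : dom i x -> pder i p (l01 a i) x = \sum_q P01 R a q * pder i p (fun y => lam i y q) x.
Proof.
move=> dx; apply: has_pdXE; apply: has_pd_sum => q; apply: has_pdZ.
exact: (C1X_pd p (lam_C1 i q) dx).
Qed.

Lemma t02E i x : dom i x -> t02 i x = dbar i 0 (l01 2%:R i) x - dbar i 2%:R (l01 0 i) x.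
Proof.
move=> dx; rewrite /t02 /d1 (part02_alt_sum (fun p q => pder i p (fun y => lam i y q) x) (fun q p => pder i q (fun y => lam i y p) x)).
by congr (_ - _); apply: eq_bigr => p _; rewrite pder_l01.
Qed.

Lemma rhoC_C1 i j : C1X j (dom j) (fun x => (rho i x)%:C).
Proof.
apply: (@C1C_real R (chart j) (rho i \o icoord j)); first exact: open_chart.
exact: smooth_C1 (@rho_smooth i j).
Qed.

Lemma pder_rhoC i j k x : dom j x ->
  pder j k (fun x => (rho i x)%:C) x = (pderR j k (rho i) x)%:C.
Proof.
move=> dx; apply: has_pdXE; apply: has_pd_real.
exact: C1_on_pd (smooth_C1 (@rho_smooth i j)) (chart_coord dx).
Qed.

Lemma pder_rhoC_C1 i j k : C1X j (dom j) (pder j k (fun x => (rho i x)%:C)).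
Proof.
have h : C1C (chart j) (fun y => (pd k (rho i \o icoord j) y)%:C).
  apply: C1C_real; first exact: open_chart.
  exact: smooth_C1 (smooth_pd k (@rho_smooth i j)).
apply: (C1C_near (@open_chart j) _ h) => y cy /=.
by rewrite pder_rhoC; [rewrite /pderR icoordK|exact: icoord_dom].
Qed.

Lemma pder_rhoC_out i j k x : dom j x -> ~ psupp i x -> pder j k (fun x => (rho i x)%:C) x = 0.
Proof.
move=> dx nK; apply: has_pdXE; apply: (@has_pdX_near _ _ (fun=> 0)) => //; last exact: has_pd_cst.
have : \forall z \near x, ~ psupp i z.
  by apply: open_nbhs_nbhs; split=> //; apply: closed_openC; exact: psupp_closed.
by apply: filterS => z /rho_out ->.
Qed.

Lemma pder_rhoC_sum j k x : dom j x -> \sum_i pder j k (fun x => (rho i x)%:C) x = 0.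
Proof.
move=> dx.
have h i : has_pdX j k (fun x => (rho i x)%:C) x (pder j k (fun x => (rho i x)%:C) x).
  exact: C1X_pd (rhoC_C1 i j) dx.
have := has_pd_sum (index_enum (idx X)) predT h; move/has_pdE => <-; apply: has_pdE.
apply: has_pd_ext (has_pd_cst k 1 _) => // z /=.
by rewrite -rmorph_sum /= rho_sum.
Qed.

Definition drho_lam i j x : form2 C^o := fun k l =>
  pder j k (fun x => (rho i x)%:C) x * lam j x l - pder j l (fun x => (rho i x)%:C) x * lam j x k.

Lemma drho_lam_alt i j x : Defs.alternating (drho_lam i j x).
Proof. by move=> k l; rewrite /drho_lam opprB. Qed.

Lemma drho_lam_tensor i j m x : dom j x -> dom m x ->
  drho_lam i j x = pull2 (jac j m x) (drho_lam i m x).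
Proof.
move=> dj dm.
have D k : pder j k (fun x => (rho i x)%:C) x =
    \sum_p (jac j m x k p)%:C * pder m p (fun x => (rho i x)%:C) x.
  exact: has_pdXE (chain_pder k (@dom_open R X m) (fun _ h => h) dm dj (rhoC_C1 i m)).
apply/funext => k; apply/funext => l; rewrite /drho_lam !D (lam_tensor dj dm) /pull1 /pull2.
rewrite !big_distrlr /= [X in _ - X]exchange_big -sumrB; apply: eq_bigr => p _ /=.
rewrite -sumrB; apply: eq_bigr => q _; rewrite rmorphM.
have h (A B c d a b : C) : A * c * (B * a) - B * d * (A * b) = A * B * (c * a - d * b) by ring.
exact: h.
Qed.

Lemma part02_drho_lam i j x : part02 (drho_lam i j x) 0 2%:R =
  dbar j 0 (fun x => (rho i x)%:C) x * l01 2%:R j x - dbar j 2%:R (fun x => (rho i x)%:C) x * l01 0 j x.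
Proof.
rewrite /drho_lam (part02_alt_sum
  (fun p q => pder j p (fun x => (rho i x)%:C) x * lam j x q)
  (fun q p => pder j q (fun x => (rho i x)%:C) x * lam j x p)).
have h (A B c a : C) : A * (B * (c * a)) = A * c * (B * a) by ring.
rewrite /dbar /l01 /part01; congr (_ - _).
  rewrite mulr_suml; apply: eq_bigr => p _; rewrite !mulr_sumr; apply: eq_bigr => q _.
  exact: h.
rewrite mulr_suml; apply: eq_bigr => p _; rewrite !mulr_sumr; apply: eq_bigr => q _.
exact: h.
Qed.

Definition bdry i j x : R := complex.Re (part02 (drho_lam i j x) 0 2%:R * conjc (e02 j x)).

Lemma bdry_cont i j x : dom j x -> {for x, continuous (bdry i j)}.
Proof.
move=> dx.
apply: (@C1X_cont j (dom j) (fun x => part02 (drho_lam i j x) 0 2%:R * conjc (e02 j x)) (@dom_open R X j) (fun _ h => h) _ x dx).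
have oc := @open_chart j; have c0 (c : C) := C1C_cst c oc.
apply: (@C1CM R (chart j)) => //; last by apply: (@C1C_conj R (chart j)) => //; exact: e02_C1.
apply: (@C1C_sum R (chart j)) => // p; apply: (@C1C_sum R (chart j)) => // q.
apply: (@C1CM R (chart j)) => //.
have h1 := pder_rhoC_C1 i j; have h2 := lam_C1 j.
have h3 k l : C1C (chart j) (fun y => pder j k (fun x => (rho i x)%:C) (icoord j y) * lam j (icoord j y) l).
  exact: C1CM oc (h1 k) (h2 l).
have := C1CD oc (h3 p q) (C1CM oc (c0 (-1)) (h3 q p)); apply: C1C_near => // y _.
by rewrite /= mulN1r.
Qed.

Lemma bdry_tensor i j m x : dom j x -> dom m x -> bdry i j x = \det (jac j m x) * bdry i m x.
Proof.
move=> dj dm; rewrite /bdry (drho_lam_tensor i dj dm) part02_kappa; last 2 first.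
- exact: jacJ.
- exact: drho_lam_alt.
rewrite (e02_kappa dj dm) [_ *: _]/(_ * _) conjM mulrACA (kappa_norm (jacJ dj dm)).
by case: (_ * conjc _) => a b /=; rewrite mul0r subr0.
Qed.

Lemma bdry_out i j x : dom j x -> ~ psupp i x -> bdry i j x = 0.
Proof.
move=> dx nK; rewrite /bdry part02_drho_lam /dbar !big1 ?(mul0r, subrr)// => p _;
  by rewrite pder_rhoC_out ?mulr0.
Qed.

Lemma bdry_sum j x : dom j x -> \sum_i bdry i j x = 0.
Proof.
move=> dx; rewrite /bdry -Re_sum -mulr_suml.
under eq_bigr => i _ do rewrite part02_drho_lam.
have D k : \sum_i dbar j k (fun x => (rho i x)%:C) x = 0.
  by rewrite /dbar exchange_big big1// => p _; rewrite -mulr_sumr pder_rhoC_sum// mulr0.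
by rewrite sumrB -!mulr_suml !D !mul0r subrr mul0r.
Qed.

Theorem stokes :
  \sum_i int4 (ext i (fun x => rho i x * complex.Re (t02 i x * conjc (e02 i x)))) = 0.
Proof.
have Cb i j : Cc (ext j (fun x => rho j x * bdry i j x)).
  apply: (ext_Cc (@psupp_compact j) (@psupp_dom j)) => x dx.
    by apply: contM; [exact: rho_cont|exact: bdry_cont].
  by move=> nK; rewrite rho_out// mul0r.
have E i : int4 (ext i (fun x => rho i x * complex.Re (t02 i x * conjc (e02 i x)))) =
    - \sum_j int4 (ext j (fun x => rho j x * bdry i j x)).
  rewrite -(int4_partition (@psupp_compact i) (@psupp_closed i) (@psupp_dom i) (@bdry_cont i) (@bdry_tensor i) (@bdry_out i)).
  pose G a x := (rho i x)%:C * l01 a i x * conjc (e02 i x).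
  have oc := @open_chart i.
  have cG a : C1X i (dom i) (G a).
    apply: (C1CM oc); last by apply: (C1C_conj oc); exact: e02_C1.
    by apply: (C1CM oc); [exact: rhoC_C1|exact: l01_C1].
  have G0 a x : dom i x -> ~ psupp i x -> G a x = 0.
    by move=> dx nK; rewrite /G rho_out// !mul0r.
  have [C1 I1] := int4_dbar 0 (@psupp_compact i) (@psupp_dom i) (cG 2%:R) (G0 2%:R).
  have [C2 I2] := int4_dbar 2%:R (@psupp_compact i) (@psupp_dom i) (cG 0) (G0 0).
  have C3 : Cc (ext i (bdry i i)).
    by apply: (ext_Cc (@psupp_compact i) (@psupp_dom i)) => x dx; [exact: bdry_cont|exact: bdry_out].
  have dG k a x : dom i x -> dbar i k (G a) x = (dbar i k (fun x => (rho i x)%:C) x * l01 a i x +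
      (rho i x)%:C * dbar i k (l01 a i) x) * conjc (e02 i x).
    move=> dx.
    have h p : pder i p (G a) x = (pder i p (fun x => (rho i x)%:C) x * l01 a i x +
       (rho i x)%:C * pder i p (l01 a i) x) * conjc (e02 i x) +
       (rho i x)%:C * l01 a i x * pder i p (fun y => conjc (e02 i y)) x.
      apply: has_pdXE.
      have h1 := C1X_pd p (rhoC_C1 i i) dx; have h2 := C1X_pd p (l01_C1 a i) dx.
      have ce : C1X i (dom i) (fun y => conjc (e02 i y)) := C1C_conj oc (e02_C1 i).
      have h3 := C1X_pd p ce dx.
      by apply: has_pd_eq (has_pdM (has_pdM h1 h2) h3) => /=; rewrite coordK.
    have D := dbar_e02 k dx; rewrite /dbar in D *.
    under eq_bigr => p _ do rewrite h mulrDr [X in _ + X]mulrCA.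
    rewrite big_split /= -mulr_sumr D mulr0 addr0.
    rewrite [X in (X + _) * _]mulr_suml [X in (_ + X) * _]mulr_sumr -big_split mulr_suml.
    apply: eq_bigr => p _ /=; ring.
  have -> : ext i (fun x => rho i x * complex.Re (t02 i x * conjc (e02 i x))) =
      fun y => (ext i (fun x => complex.Re (dbar i 0 (G 2%:R) x)) y +
       -1 * ext i (fun x => complex.Re (dbar i 2%:R (G 0) x)) y) + -1 * ext i (bdry i i) y.
    apply/funext => y; rewrite /ext; case: asboolP => cy; last by rewrite !mulr0 !addr0.
    have dx := icoord_dom cy; rewrite !dG// t02E// /bdry part02_drho_lam.
    move: (dbar i _ _ _) (dbar i _ _ _) (dbar i _ _ _) (dbar i _ _ _) => a b c d.
    move: (l01 _ _ _) (l01 _ _ _) (conjc _) (rho _ _) => l m e r.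
    case: a b c d l m e => a1 a2 [b1 b2] [c1 c2] [d1 d2] [l1 l2] [m1 m2] [e1 e2] /=.
    ring.
  have C2' := CcZ (-1) C2; have C3' := CcZ (-1) C3.
  rewrite (int4D (CcD C1 C2') C3') (int4D C1 C2') (int4Z _ C2) (int4Z _ C3) I1 I2.
  by rewrite mulr0 !add0r mulN1r.
rewrite (eq_bigr _ (fun i _ => E i)) sumrN exchange_big /= big1 ?oppr0// => j _.
rewrite -int4_sum; last by move=> i; exact: Cb.
rewrite -[RHS](@int4_0 R); congr int4; apply/funext => y.
rewrite /ext; case: asboolP => cy; last by rewrite big1.
by rewrite -mulr_sumr bdry_sum ?mulr0//; exact: icoord_dom.
Qed.
End Stokes.

End PartitionOfUnity.

End Charts.

Section Global.
Variables (R : realType) (X : complexSurface R).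
Local Notation C := R[i].

Lemma pou_partition : (1 < b2plus X)%N -> partition_of_unity (@pou R X).
Proof.
move=> hb; apply: contrapT => npou.
have p0 : @pou R X = fun _ _ => 0.
  rewrite /pou; case: (xgetP (point : idx X -> X -> R)) => [rho e P|_]; last by [].
  by case: npou; rewrite /pou -e.
have i0 (w : idx X -> X -> C) : integral4 w = 0.
  rewrite /integral4 big1// => i _; rewrite p0.
  rewrite /int4C; rewrite (_ : (fun y : 'rV[R]_4 => complex.Re _) = fun=> 0); last first.
    by apply/funext => y; case: asboolP => // _; rewrite mul0r.
  rewrite (_ : (fun y : 'rV[R]_4 => complex.Im _) = fun=> 0); last first.
    by apply/funext => y; case: asboolP => // _; rewrite mul0r.
  by rewrite int4_0.
have m0 m : @positive_subspace R X m -> m = 0%N.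
  case: m => // m [B [_ h0]]; exfalso.
  have c0 : const_mx 1 != 0 :> 'rV[R]_m.+1.
    by apply/eqP => /rowP/(_ ord0); rewrite !mxE => /eqP; rewrite oner_eq0.
  by have := h0 _ c0; rewrite /= i0 ltxx.
move: hb; rewrite /b2plus.
case: (xgetP (point : nat)) => [m e [/m0 h _]|_] /=.
  by move: m h {e} => [|].
by [].
Qed.

Lemma cont_det (T : topologicalType) n (M : T -> 'M[R]_n) x :
  (forall k l, {for x, continuous (fun y => M y k l)}) ->
  {for x, continuous (fun y => \det (M y))}.
Proof.
move=> h; rewrite /determinant; apply: cont_sum => s; apply: contM; first exact: cont_cst.
by apply: cont_prod => k; exact: h.
Qed.

Lemma det_jac_cont (i j : idx X) x : dom i x -> dom j x ->
  {for x, continuous (fun y => \det (jac i j y))}.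
Proof.
move=> di dj; apply: cont_det => k p.
by apply: (C1_cont (@open_inter R X i j) _ (@jac_C1 R X i j k p)) => [z []|].
Qed.

Definition has_pdmx (i : idx X) k m n (f : X -> 'M[C]_(m, n)) x (D : 'M[C]_(m, n)) :=
  forall r c, has_pdX i k (fun y => f y r c) x (D r c).

Section MatrixFields.
Variables (i : idx X) (k : 'I_4).

Lemma has_pdmxE m n (f : X -> 'M[C]_(m, n)) x D : has_pdmx i k f x D -> pdermx i k f x = D.
Proof. by move=> h; apply/matrixP => r c; rewrite mxE; exact: has_pdXE (h r c). Qed.

Lemma has_pdmxD m n (f g : X -> 'M[C]_(m, n)) x D D' : has_pdmx i k f x D ->
  has_pdmx i k g x D' -> has_pdmx i k (fun y => f y + g y) x (D + D').
Proof.
move=> hf hg r c; apply: has_pd_ext (has_pdD (hf r c) (hg r c)) => [y|]; by rewrite /= !mxE.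
Qed.

Lemma has_pdmxN m n (f : X -> 'M[C]_(m, n)) x D : has_pdmx i k f x D ->
  has_pdmx i k (fun y => - f y) x (- D).
Proof. by move=> hf r c; apply: has_pd_ext (has_pdN (hf r c)) => [y|]; rewrite /= !mxE. Qed.

Lemma has_pdmxZ m n (a : C) (f : X -> 'M[C]_(m, n)) x D : has_pdmx i k f x D ->
  has_pdmx i k (fun y => a *: f y) x (a *: D).
Proof. by move=> hf r c; apply: has_pd_ext (has_pdZ a (hf r c)) => [y|]; rewrite /= !mxE. Qed.

Lemma has_pdmx_sum m n (f : 'I_4 -> X -> 'M[C]_(m, n)) x D :
  (forall p, has_pdmx i k (f p) x (D p)) ->
  has_pdmx i k (fun y => \sum_p f p y) x (\sum_p D p).
Proof.
move=> hf r c; apply: has_pd_ext (has_pd_sum (index_enum 'I_4) predT (fun p => hf p r c)) => [y|];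
  by rewrite /= summxE.
Qed.

Lemma has_pdmxM m n l (f : X -> 'M[C]_(m, n)) (g : X -> 'M[C]_(n, l)) x D D' : dom i x ->
  has_pdmx i k f x D -> has_pdmx i k g x D' ->
  has_pdmx i k (fun y => f y *m g y) x (D *m g x + f x *m D').
Proof.
move=> dx hf hg r c.
apply: has_pd_ext (has_pd_sum (index_enum 'I_n) predT (fun p => has_pdM (hf r p) (hg p c))) => [y|].
  by rewrite /= mxE.
by rewrite !mxE -big_split /=; apply: eq_bigr => p _; rewrite /= coordK.
Qed.

Lemma has_pdmx_near m n (f g : X -> 'M[C]_(m, n)) x D : dom i x ->
  (\forall y \near x, f y = g y) -> has_pdmx i k f x D -> has_pdmx i k g x D.
Proof.
move=> dx fg hf r c; apply: (has_pdX_near dx _ (hf r c)).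
by apply: filterS fg => y ->.
Qed.

Lemma smoothmx_pd m n U (f : X -> 'M[C]_(m, n)) x : smoothmx_in i U f -> U x ->
  has_pdmx i k f x (pdermx i k f x).
Proof.
move=> h Ux r c; rewrite mxE; exact: (C1X_pd k (smoothC_C1 (h r c)) Ux).
Qed.

Lemma smoothmx_pdermx m n U (f : X -> 'M[C]_(m, n)) : open U -> U `<=` dom i ->
  smoothmx_in i U f -> forall r c, C1X i U (fun y => pdermx i k f y r c).
Proof.
move=> oU Ui h r c.
have := smoothC_C1 (smoothC_pd k (h r c)); apply: C1C_near; first exact: open_image.
by move=> _ [x Ux <-] /=; rewrite coordK ?mxE//; exact: Ui.
Qed.

End MatrixFields.

Lemma smoothmx_schwarz i k l m n U (f : X -> 'M[C]_(m, n)) x : open U -> U `<=` dom i ->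
  smoothmx_in i U f -> U x ->
  pdermx i k (pdermx i l f) x = pdermx i l (pdermx i k f) x.
Proof.
move=> oU Ui h Ux; have dx := Ui x Ux.
have E k' l' : pdermx i k' (pdermx i l' f) x = \matrix_(r, c) pdC k' (pdC l' ((fun y => f y r c) \o icoord i)) (Defs.coord i x).
  apply/matrixP => r c; rewrite !mxE; apply: has_pdXE.
  have Wx : (Defs.coord i @` U) (Defs.coord i x) by exists x.
  have := C1C_pd k' (smoothC_C1 (smoothC_pd l' (h r c))) Wx; apply: has_pd_near.
  have : \forall z \near Defs.coord i x, (Defs.coord i @` U) z.
    by apply: open_nbhs_nbhs; split=> //; exact: open_image.
  by apply: filterS => _ [y Uy <-] /=; rewrite coordK ?mxE ?/pder ?/pderR//; exact: Ui.
have S r c : pdC k (pdC l ((fun y => f y r c) \o icoord i)) (Defs.coord i x) =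
    pdC l (pdC k ((fun y => f y r c) \o icoord i)) (Defs.coord i x).
  apply: (smoothC_schwarz (W := Defs.coord i @` U)) (h r c); first exact: open_image.
  by exists x.
apply: etrans (E k l) (etrans _ (esym (E l k))).
by apply: eq_mx => r c; exact: S.
Qed.

End Global.

Section Dolbeault.
Variable R : realType.
Local Notation C := R[i].
Implicit Types (V : lmodType C).

Lemma part02B V (B B' : form2 V) :
  part02 (fun k l => B k l - B' k l) = fun k l => part02 B k l - part02 B' k l.
Proof.
apply/funext => k; apply/funext => l; rewrite /part02 -sumrB; apply: eq_bigr => p _.
by rewrite -sumrB; apply: eq_bigr => q _; rewrite scalerBr.
Qed.

Lemma part02D V (B B' : form2 V) :
  part02 (fun k l => B k l + B' k l) = fun k l => part02 B k l + part02 B' k l.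
Proof.
apply/funext => k; apply/funext => l; rewrite /part02 -big_split; apply: eq_bigr => p _.
by rewrite -big_split; apply: eq_bigr => q _; rewrite scalerDr.
Qed.

Lemma part02_proj V (T : form2 V) :
  part02 (fun k l => \sum_p P01 R l p *: T k p - \sum_p P01 R k p *: T l p) =
  part02 (fun k l => T k l - T l k).
Proof.
rewrite !part02B; apply/funext => k; apply/funext => l; rewrite /part02; congr (_ - _).
  apply: eq_bigr => a _.
  under eq_bigr => b _ do (rewrite scaler_sumr; under eq_bigr => p _ do rewrite scalerA -mulrA).
  rewrite exchange_big; apply: eq_bigr => p _ /=.
  by rewrite -scaler_suml -mulr_sumr P01_idem.
rewrite exchange_big [RHS]exchange_big; apply: eq_bigr => b _ /=.
under eq_bigr => a _ do (rewrite scaler_sumr; under eq_bigr => p _ do rewrite scalerA mulrAC).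
rewrite exchange_big; apply: eq_bigr => p _ /=.
by rewrite -scaler_suml -mulr_suml P01_idem.
Qed.

Lemma addr_shuffle (G : zmodType) (u v w z : G) : - u - - v + (- w - - z) = - (u + w - (v + z)).
Proof. by rewrite !opprK addrACA -opprD addrC opprB. Qed.

Lemma addr_cancel (G : zmodType) (u v w z s p q : G) :
  s + (p + u) + (v + w) - (s + (q + v) + (u + z)) = p - q + (w - z).
Proof.
have -> : s + (p + u) + (v + w) = (s + u + v) + (p + w) by rewrite (AC ((1*2)*2) ((1*3*4)*(2*5))).
have -> : s + (q + v) + (u + z) = (s + u + v) + (q + z) by rewrite (AC ((1*2)*2) ((1*4*3)*(2*5))).
by rewrite opprD addrACA subrr add0r opprD addrACA.
Qed.

Lemma covariant_proj m (M : 'I_4 -> 'M[C]_m) (D : 'I_4 -> 'I_4 -> 'cV[C]_m) (N : 'I_4 -> 'cV[C]_m) k l :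
  - (\sum_p P01 R l p *: D k p) - - (\sum_p P01 R k p *: D l p) +
    (M k *m - (\sum_p P01 R l p *: N p) - M l *m - (\sum_p P01 R k p *: N p)) =
  - (\sum_p P01 R l p *: (D k p + M k *m N p) - \sum_p P01 R k p *: (D l p + M l *m N p)).
Proof.
have h k' l' : \sum_p P01 R l' p *: (D k' p + M k' *m N p) =
    \sum_p P01 R l' p *: D k' p + M k' *m (\sum_p P01 R l' p *: N p).
  by rewrite mulmx_sumr -big_split; apply: eq_bigr => p _; rewrite scalerDr -scalemxAr.
by rewrite (h k l) (h l k) !mulmxN; exact: addr_shuffle.
Qed.

End Dolbeault.

(** * Connections *)

Section Bundle.
Variables (R : realType) (X : kahlerSurface R) (n : nat) (E : hermBundle X n).
Local Notation C := R[i].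
Local Notation glue := Defs.glue.
Implicit Types (a b : fr E) (x : X).

Lemma near_triv a x : triv a x -> \forall z \near x, triv a z.
Proof. by move=> t; apply: open_nbhs_nbhs; split=> //; exact: triv_open. Qed.

Lemma glue_id a x : triv a x -> glue a a x = 1%:M.
Proof.
move=> t; have u := glue_unitary t t; have c := glue_cocycle t t t.
by rewrite -[LHS]mulmx1 -u mulmxA c u.
Qed.

Lemma glue_inv a b x : triv a x -> triv b x -> glue a b x *m glue b a x = 1%:M.
Proof. by move=> ta tb; rewrite glue_cocycle// glue_id. Qed.

Lemma herm_unitary (g : 'M[C]_n) (u v : 'cV[C]_n) : g *m adjmx g = 1%:M ->
  herm (g *m u) (g *m v) = herm u v.
Proof.
move=> /mulmx1C h; rewrite /herm; have -> : adjmx (g *m v) = adjmx v *m adjmx g.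
  by rewrite /adjmx map_mxM trmx_mul.
by rewrite mulmxA -[_ *m adjmx g *m g]mulmxA h mulmx1.
Qed.

Section Connection.
Variables (A : endform1 E) (al : esec E).
Hypotheses (hA : is_connection A) (hal : is_section al).

Lemma curvature_alt a x : Defs.alternating (curvature A a x).
Proof. by move=> k l; rewrite /curvature opprD !opprB. Qed.

Lemma dbar_dbar a (gam : eform1 E) x : triv a x ->
  (forall y k, triv a y -> dbar0 A al a y k + gam a y k = 0) ->
  dbar1 A gam a x = fun k l => - (part02 (curvature A a x) k l *m al a x).
Proof.
move=> t hg; have dx := triv_dom t; pose i := base a.
have oU := triv_open a; have Ui := @triv_dom R X n E a.
have [sA _ _] := hA; have [sal _] := hal.
pose N p y := pdermx i p (al a) y + A a y p *m al a y.
have gE y k : triv a y -> gam a y k = - \sum_p P01 R k p *: N p y.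
  by move=> /(hg y k)/eqP; rewrite addrC addr_eq0 => /eqP.
pose DN k p := pdermx i k (pdermx i p (al a)) x +
  (pdermx i k (fun y => A a y p) x *m al a x + A a x p *m pdermx i k (al a) x).
have hN k p : has_pdmx i k (N p) x (DN k p).
  apply: has_pdmxD.
    move=> r c; rewrite mxE.
    exact: (C1X_pd k (smoothmx_pdermx p oU Ui (sal a) r c) t).
  apply: has_pdmxM => //; first exact: smoothmx_pd (sA a p) t.
  exact: smoothmx_pd (sal a) t.
have hgam k l : pdermx i k (fun y => gam a y l) x = - \sum_p P01 R l p *: DN k p.
  apply: has_pdmxE; apply: (@has_pdmx_near R X i k _ _ (fun y => - \sum_p P01 R l p *: N p y)) => //.
    by apply: filterS (near_triv t) => y ty; rewrite gE.
  by apply: has_pdmxN; apply: has_pdmx_sum => p; apply: has_pdmxZ.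
pose T k p := DN k p + A a x k *m N p x.
have B k l : pdermx i k (fun y => gam a y l) x - pdermx i l (fun y => gam a y k) x
    + (A a x k *m gam a x l - A a x l *m gam a x k) =
    - (\sum_p P01 R l p *: T k p - \sum_p P01 R k p *: T l p).
  rewrite (hgam k l) (hgam l k) (gE x l t) (gE x k t); exact: covariant_proj.
have F k l : T k l - T l k = curvature A a x k l *m al a x.
  rewrite /T /DN (smoothmx_schwarz k l oU Ui (sal a) t) /curvature /N -/i.
  rewrite !mulmxDr !mulmxDl !mulNmx !mulmxA.
  move: (pdermx i l _ x) (pdermx i k (fun y => A a y l) x *m _) (pdermx i l (fun y => A a y k) x *m _).
  move: (A a x l *m pdermx i k (al a) x) (A a x k *m pdermx i l (al a) x) (A a x k *m _ *m _) (A a x l *m _ *m _).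
  exact: addr_cancel.
rewrite /dbar1 -/i (_ : (fun k l => _ + _) = fun k l => - (\sum_p P01 R l p *: T k p - \sum_p P01 R k p *: T l p)); last first.
  by apply/funext => k; apply/funext => l; exact: B.
apply/funext => k; apply/funext => l.
have := part02_proj T => /(congr1 (fun f => f k l)) e.
transitivity (- part02 (fun k l => \sum_p P01 R l p *: T k p - \sum_p P01 R k p *: T l p) k l).
  rewrite /part02 -sumrN; apply: eq_bigr => p _; rewrite -sumrN; apply: eq_bigr => q _.
  by rewrite scalerN.
rewrite e /part02 mulmx_suml; congr (- _); apply: eq_bigr => p _.
by rewrite mulmx_suml; apply: eq_bigr => q _; rewrite F scalemxAl.
Qed.
Lemma tr_curvature a x k l : triv a x -> \tr (curvature A a x k l) =
  d1 (base a) (fun y p => \tr (A a y p)) x k l.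
Proof.
move=> t; have dx := triv_dom t; have [sA _ _] := hA.
have h p q : has_pdX (base a) p (fun y => \tr (A a y q)) x (\tr (pdermx (base a) p (fun y => A a y q) x)).
  exact: has_pd_sum (fun r => smoothmx_pd p (sA a q) t r r).
have trB (M N : 'M[C]_n) : \tr (M - N) = \tr M - \tr N by exact: raddfB.
rewrite /curvature mxtraceD !trB [\tr (A a x k *m _)]mxtrace_mulC subrr addr0.
by rewrite /d1 (has_pdXE (h k l)) (has_pdXE (h l k)).
Qed.

End Connection.

Section Difference.
Variables (A A0 : endform1 E) (theta : sform2 X) (xi : sform1 X).
Hypotheses (hA : is_connection A) (hA0 : is_connection A0).
Hypotheses (htheta : type11 theta) (hxi : is_form1 xi).
Hypothesis hc1 : forall a x k l, triv a x ->
  'i%C / (2 * pi)%:C * \tr (curvature A0 a x k l) = theta (base a) x k l + ext_d1 xi (base a) x k l.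

Definition trdiff a x : form1 C^o := fun k => \tr (A a x k - A0 a x k).

Lemma trdiff_tensor a b x : triv a x -> triv b x ->
  trdiff a x = pull1 (bjac a b x) (trdiff b x).
Proof.
move=> ta tb; have [_ _ h] := hA; have [_ _ h0] := hA0.
apply/funext => k; rewrite /trdiff (h a b)// (h0 a b)//.
rewrite opprD addrACA subrr addr0 -mulmxBl -mulmxBr mxtrace_mulC mulmxA glue_inv// mul1mx.
rewrite /pull1 -sumrB raddf_sum; apply: eq_bigr => p _ /=.
by rewrite -scalerBr mxtraceZ.
Qed.

Let c : C := (2 * pi)%:C / 'i%C.

Definition lam (i : idx X) x : form1 C^o := fun k =>
  c * xi i x k + pull1 (jac i (base (frame_at E x)) x) (trdiff (frame_at E x) x) k.

Lemma frame_atP x : triv (frame_at E x) x.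
Proof. by rewrite /frame_at; case: cid. Qed.

Lemma lamE i a x : dom i x -> triv a x ->
  lam i x = fun k => c * xi i x k + pull1 (jac i (base a) x) (trdiff a x) k.
Proof.
move=> di ta; have tf := frame_atP x; apply/funext => k; rewrite /lam; congr (_ + _).
rewrite (trdiff_tensor ta tf) -pull1_mul; congr (pull1 _ _ k).
by apply: jac_cocycle => //; exact: triv_dom.
Qed.

Lemma lam_tensor i j x : dom i x -> dom j x -> lam i x = pull1 (jac i j x) (lam j x).
Proof.
move=> di dj; have t := frame_atP x; have [_ h] := hxi; apply/funext => k.
rewrite /lam (h i j)// (jac_cocycle di dj (triv_dom t)) pull1_mul /pull1 mulr_sumr -big_split.
apply: eq_bigr => p _ /=; rewrite scalerDr; congr (_ + _).
by rewrite ![_ *: _]/(_ * _) mulrCA.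
Qed.

Lemma trdiff_C1 a k : C1X (base a) (triv a) (fun x => trdiff a x k).
Proof.
have [sA _ _] := hA; have [sA0 _ _] := hA0.
have oU := open_image (@triv_open R X n E a) (@triv_dom R X n E a).
apply: C1C_sum => // r; apply: C1C_near (C1CD oU (smoothC_C1 (sA a k r r)) (C1CM oU (C1C_cst (-1) oU) (smoothC_C1 (sA0 a k r r)))) => //.
by move=> y _ /=; rewrite !mxE mulN1r.
Qed.

Lemma lam_C1 i k : C1X i (dom i) (fun x => lam i x k).
Proof.
have [h _] := hxi.
have L x : dom i x -> exists2 U : set X, open U & [/\ U x, U `<=` dom i & C1X i U (fun x => lam i x k)].
  move=> dx; pose a := frame_at E x; have t := frame_atP x.
  pose U := triv a `&` dom i.
  have oU : open U by apply: openI; [exact: triv_open|exact: dom_open].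
  have Ui : U `<=` dom i by move=> ? [].
  have Uij : U `<=` dom i `&` dom (base a) by move=> ? [/triv_dom ? ?].
  have oI := open_image oU Ui.
  exists U => //; split=> //.
  apply: (@C1X_near R X i U (fun x => c * xi i x k + pull1 (jac i (base a) x) (trdiff a x) k)) => //.
    by move=> y [ta dy]; rewrite (lamE dy ta).
  apply: (C1CD oI).
    by apply: (C1CM oI); [exact: C1C_cst|exact: C1XS Ui (smoothC_C1 (h i k))].
  apply: (C1C_sum _ _ oI) => p; apply: (C1CM oI).
    exact: C1XS Uij (@jac_C1X R X i (base a) k p).
  apply: (@C1X_chart R X i (base a) U (fun y => trdiff a y p) oU Uij).
  by apply: C1XS (trdiff_C1 a p) => ? [].
split=> _ [x dx <-]; have [U oU [Ux _ [h1 h2]]] := L x dx; [apply: h1|apply: h2]; by exists x.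
Qed.

Lemma d1_lam a x : triv a x -> d1 (base a) (lam (base a)) x =
  fun k l => c * ext_d1 xi (base a) x k l +
    (d1 (base a) (fun y p => \tr (A a y p)) x k l - d1 (base a) (fun y p => \tr (A0 a y p)) x k l).
Proof.
move=> t; have dx := triv_dom t; have [h _] := hxi.
have [sA _ _] := hA; have [sA0 _ _] := hA0.
have htr (B : endform1 E) p q : is_connection B -> has_pdX (base a) p (fun y => \tr (B a y q)) x (pder (base a) p (fun y => \tr (B a y q)) x).
  move=> [sB _ _].
  have := has_pd_sum (index_enum 'I_n) predT (fun r => smoothmx_pd p (sB a q) t r r) => e.
  by apply: (has_pd_eq _ e); symmetry; exact: has_pdXE e.
have hl k l : pder (base a) k (fun y => lam (base a) y l) x =
   c * pder (base a) k (fun y => xi (base a) y l) x +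
   (pder (base a) k (fun y => \tr (A a y l)) x - pder (base a) k (fun y => \tr (A0 a y l)) x).
  apply: has_pdXE; apply: (@has_pdX_near R X _ _ (fun y => c * xi (base a) y l + (\tr (A a y l) - \tr (A0 a y l)))) => //.
    apply: filterS (near_triv t) => y ty.
    rewrite (lamE (triv_dom ty) ty) jac_id ?pull1_id; last exact: triv_dom.
    by congr (_ + _); symmetry; exact: raddfB.
  apply: has_pdD; first by apply: has_pdZ; exact: (C1X_pd k (smoothC_C1 (h (base a) l)) dx).
  by apply: has_pdB; exact: htr.
apply/funext => k; apply/funext => l; rewrite /d1 !hl /ext_d1.
move: (pder _ _ _ _) (pder _ _ _ _) (pder _ _ _ _) (pder _ _ _ _) (pder _ _ _ _) (pder _ _ _ _) => p q r s u v.
ring.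
Qed.

Lemma tr_F02 a x k l : triv a x ->
  part02 (fun p q => \tr (curvature A a x p q) : C^o) k l = part02 (d1 (base a) (lam (base a)) x) k l.
Proof.
move=> t; have [_ th] := htheta (triv_dom t).
have i0 : 'i%C != 0 :> C by rewrite eq_complex /= oner_eq0 andbF.
have p0 : (2 * pi)%:C != 0 :> C by rewrite realC_eq0 mulf_neq0 ?lt0r_neq0 ?pi_gt0.
have E1 p q : \tr (curvature A a x p q) = d1 (base a) (lam (base a)) x p q + c * theta (base a) x p q.
  rewrite (d1_lam t) -(tr_curvature hA)// -(tr_curvature hA0)//.
  have -> : \tr (curvature A0 a x p q) = c * (theta (base a) x p q + ext_d1 xi (base a) x p q).
    by rewrite -hc1// mulrA (_ : c * _ = 1) ?mul1r// /c mulrA (divfK i0) (mulfV p0).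
  ring.
have -> : (fun p q => \tr (curvature A a x p q) : C^o) =
    fun p q => d1 (base a) (lam (base a)) x p q + c * theta (base a) x p q.
  by apply/funext => p; apply/funext => q; exact: E1.
rewrite part02D -[RHS]addr0; congr (_ + _).
have := congr1 (fun f => c * f k l) th; rewrite /= mulr0 => <-.
rewrite /part02 mulr_sumr; apply: eq_bigr => p _; rewrite mulr_sumr; apply: eq_bigr => q _.
by rewrite ![_ *: _]/(_ * _) mulrCA.
Qed.
End Difference.
End Bundle.

Section ComplexContinuity.
Variables (R : realType) (T : topologicalType).
Local Notation C := R[i].
Implicit Types (f g : T -> C) (x : T).

Definition contC f x := {for x, continuous (fun y => complex.Re (f y))} /\
  {for x, continuous (fun y => complex.Im (f y))}.

Lemma contC_ext f g x : (forall y, f y = g y) -> contC f x -> contC g x.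
Proof. by move=> /funext ->. Qed.

Lemma contC_cst (c : C) x : contC (fun=> c) x.
Proof. by split; exact: cont_cst. Qed.

Lemma cont_ext (u v : T -> R) x : (forall y, u y = v y) -> {for x, continuous u} -> {for x, continuous v}.
Proof. by move=> /funext ->. Qed.

Lemma contCD f g x : contC f x -> contC g x -> contC (fun y => f y + g y) x.
Proof.
move=> [f1 f2] [g1 g2]; split; [apply: cont_ext (contD f1 g1)|apply: cont_ext (contD f2 g2)] => y;
  by case: (f y) (g y) => ? ? [].
Qed.

Lemma contCM f g x : contC f x -> contC g x -> contC (fun y => f y * g y) x.
Proof.
move=> [f1 f2] [g1 g2]; split.
  apply: cont_ext (contB (contM f1 g1) (contM f2 g2)) => y.
  by case: (f y) (g y) => ? ? [].
apply: cont_ext (contD (contM f1 g2) (contM f2 g1)) => y.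
by case: (f y) (g y) => ? ? [].
Qed.

Lemma contC_conj f x : contC f x -> contC (fun y => conjc (f y)) x.
Proof.
move=> [f1 f2]; split; first by apply: cont_ext f1 => y; case: (f y).
by apply: cont_ext (contN f2) => y; case: (f y).
Qed.

Lemma contC_sum (J : Type) (r : seq J) (F : J -> T -> C) x : (forall j, contC (F j) x) ->
  contC (fun y => \sum_(j <- r) F j y) x.
Proof.
move=> h; elim: r => [|j r IH].
  by apply: contC_ext (contC_cst 0 x) => y; rewrite big_nil.
by apply: contC_ext (contCD (h j) IH) => y; rewrite big_cons.
Qed.

End ComplexContinuity.

(** * Monopoles *)

Section Monopole.
Variables (R : realType) (X : kahlerSurface R) (n : nat) (E : hermBundle X n).
Local Notation C := R[i].
Local Notation glue := Defs.glue.
Implicit Types (a : fr E) (x : X) (i j : idx X).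

Lemma C1X_contC i (U : set X) (f : X -> C) x : open U -> U `<=` dom i -> C1X i U f -> U x -> contC f x.
Proof. move=> oU Ui [c1 c2] Ux; split.
  exact: (@C1_cont R X i U (fun y => complex.Re (f y)) oU Ui c1 x Ux).
exact: (@C1_cont R X i U (fun y => complex.Im (f y)) oU Ui c2 x Ux). Qed.

Lemma vol_jac i j x : dom i x -> dom j x ->
  vol (metric i x) = \det (jac i j x) * vol (metric j x).
Proof.
move=> di dj; rewrite /vol (metric_tensor di dj) !det_mulmx det_tr.
have J0 := det_jac_gt0 di dj.
rewrite mulrAC -expr2 sqrtrM ?sqr_ge0// sqrtr_sqr gtr0_norm//.
Qed.

Lemma vol_metric_gt0 i x : dom i x -> 0 < vol (metric i x).
Proof.
move=> dx.
exact: vol_gt0 (Defs.metric_sym dx) (fun v => @metric_pos R X i x v dx) (metric_hermitian dx).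
Qed.

Lemma Re_integral (f : X -> C) : complex.Re (Defs.integral f) =
  \sum_i int4 (ext i (fun x => @pou R X i x * complex.Re ((vol (metric i x))%:C * f x))).
Proof.
rewrite /Defs.integral /integral4 Re_sum; apply: eq_bigr => i _; rewrite /int4C /=.
congr int4; apply/funext => y; rewrite /ext; case: asboolP => // _.
by case: (_ * f _) => u v /=; rewrite mul0r subr0.
Qed.

Variables (tau : R) (eta : sform2 X) (A A0 : endform1 E) (theta : sform2 X) (xi : sform1 X).
Variables (al : esec E) (be : eform2 E) (gam : eform1 E).
Hypotheses (rhoP : partition_of_unity (@pou R X)) (n2 : (2 <= n)%N) (tau0 : 0 < tau).
Hypotheses (heta : is_form2 eta) (him : imaginary2 eta) (hhol : holomorphic20 eta).
Hypotheses (hA : is_connection A) (hA0 : is_connection A0).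
Hypotheses (htheta : type11 theta) (hxi : is_form1 xi).
Hypothesis hc1 : forall a x k l, triv a x ->
  'i%C / (2 * pi)%:C * \tr (curvature A0 a x k l) = theta (base a) x k l + ext_d1 xi (base a) x k l.
Hypotheses (hal : is_section al) (hbe : is_form02 be) (hstar : is_dbar_star A be gam).
Hypothesis hdirac : forall a x k, triv a x -> dbar0 A al a x k + gam a x k = 0.
Hypothesis hF : forall a x k l, triv a x -> part02 (curvature A a x) k l =
  4^-1 *: brace tau (rank_one (be a x k l) (al a x)) + (part02 (eta (base a) x) k l)%:M.

Let b a x := be a x 0 2%:R.
Let F a x := part02 (curvature A a x) 0 2%:R.
Let lm := lam A A0 xi.
Let e i x := e02 eta i x.
Let t i x := t02 lm i x.
Let q i x := (4 / tau)%:C * (t i x - n%:R * e i x).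

Lemma betaE a x : triv a x -> be a x = fun k l => s02 R k l *: b a x.
Proof.
move=> ta; have [_ alt _ pr] := hbe.
by rewrite -[LHS](pr a x ta) (part02E (alt a x ta)) pr.
Qed.

Lemma dbar1E a x : triv a x ->
  dbar1 A gam a x = fun k l => s02 R k l *: (- (F a x *m al a x)).
Proof.
move=> ta; rewrite (dbar_dbar hA hal ta) => [|y k ty]; last exact: hdirac.
apply/funext => k; apply/funext => l; rewrite (part02E (curvature_alt A a x)).
by rewrite scalerN -scalemxAl.
Qed.

Lemma t_kappa i a x : dom i x -> triv a x -> t i x = kappa (jac i (base a) x) * \tr (F a x).
Proof.
move=> di ta; have dx := triv_dom ta.
have Uij : (dom i `&` dom (base a)) x by [].
have c p : C1X (base a) (dom i `&` dom (base a)) (fun y => lm (base a) y p).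
  by apply: C1XS (lam_C1 hA hA0 hxi (base a) p) => ? [].
have E1 y : (dom i `&` dom (base a)) y -> lm i y = pull1 (jac i (base a) y) (lm (base a) y).
  by move=> [dy1 dy2]; exact: lam_tensor.
rewrite /t /t02 (d1_natural (@open_inter R X i (base a)) (fun _ h => h) E1 c Uij).
rewrite part02_kappa; first last.
- by move=> k l; rewrite /d1 opprB.
- exact: jacJ.
rewrite -(tr_F02 hA hA0 htheta hxi hc1 _ _ ta); congr (_ * _).
rewrite /F /part02 raddf_sum; apply: eq_bigr => p _; rewrite raddf_sum; apply: eq_bigr => r _ /=.
by rewrite mxtraceZ.
Qed.

Lemma n_gt0 : (0 < n)%N. Proof. exact: leq_trans n2. Qed.

Lemma q_kappa i a x : dom i x -> triv a x ->
  q i x = kappa (jac i (base a) x) * herm (b a x) (al a x).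
Proof.
move=> di ta; have dj := triv_dom ta.
have FE : F a x = 4^-1 *: brace tau (rank_one (b a x) (al a x)) + (e (base a) x)%:M by exact: hF.
have := brace_herm (al a x) (b a x) (e (base a) x) n_gt0 (lt0r_neq0 tau0).
rewrite /= -FE => -[tE _].
have ti : t i x = kappa (jac i (base a) x) * \tr (F a x) by exact: t_kappa.
have ei : e i x = kappa (jac i (base a) x) * e (base a) x by exact: e02_kappa.
have tC : tau%:C != 0 by rewrite realC_eq0 lt0r_neq0.
rewrite /q ti ei tE rmorphM fmorphV /=.
have -> : (4 : R)%:C = 4 :> C by rewrite (rmorph_nat (real_complex R) 4).
by field.
Qed.

Lemma density_local i a x : dom i x -> triv a x ->
  (vol (metric i x))%:C * herm2 (metric (base a) x) (dbar1 A gam a x) (be a x) =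
  - ((\det (jac i (base a) x))%:C * (herm (b a x) (b a x) * herm (al a x) (al a x))
     - q i x * conjc (q i x) / n%:R + 16 / (n%:R * tau%:C) * (t i x * conjc (t i x))
     - 16 / tau%:C * (t i x * conjc (e i x))).
Proof.
move=> di ta; have dj := triv_dom ta.
have gp v := @metric_pos R X (base a) x v dj.
rewrite (vol_jac di dj) rmorphM /= dbar1E// betaE// -[LHS]mulrA (vol_herm2 _ _ (Defs.metric_sym dj) gp (metric_hermitian dj)).
have hN : herm (- (F a x *m al a x)) (b a x) = - herm (F a x *m al a x) (b a x).
  by rewrite -[X in herm X _]scaleN1r hermZl mulN1r.
rewrite hN !mulrN; congr (- _).
have FE : F a x = 4^-1 *: brace tau (rank_one (b a x) (al a x)) + (e (base a) x)%:M by exact: hF.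
have := brace_herm (al a x) (b a x) (e (base a) x) n_gt0 (lt0r_neq0 tau0).
rewrite /= -FE => -[_ ->].
have ti : t i x = kappa (jac i (base a) x) * \tr (F a x) by exact: t_kappa.
have ei : e i x = kappa (jac i (base a) x) * e (base a) x by exact: e02_kappa.
have K := kappa_norm (jacJ di dj).
have nC : n%:R != 0 :> C by rewrite pnatr_eq0 -lt0n n_gt0.
have tC : tau%:C != 0 by rewrite realC_eq0 lt0r_neq0.
have qi := q_kappa di ta.
rewrite qi ti ei !conjM -K.
move: (kappa _) (herm _ _) (\tr _) (e _ _) (herm (b a x) (b a x)) (herm (al a x) (al a x)) => u v w z r s.
by field; rewrite nC tC.
Qed.

Definition sqnorm (z : C) : R := complex.Re (z * conjc z).

Lemma sqnorm_ge0 z : 0 <= sqnorm z.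
Proof. by have := mulcJ_ge0 z; rewrite lecE => /andP[]. Qed.

Lemma sqnorm_eq0 z : sqnorm z = 0 -> z = 0.
Proof.
case: z => u v; rewrite /sqnorm /= => h; apply/eqP; rewrite eq_complex /=.
have h' : u ^+ 2 + v ^+ 2 = 0 by rewrite -h; ring.
move/eqP: h'; rewrite paddr_eq0 ?sqr_ge0// => /andP[]; rewrite !expf_eq0 /= => -> ->.
by [].
Qed.

Definition dens a i x : R :=
  \det (jac i (base a) x) * complex.Re (herm (b a x) (b a x) * herm (al a x) (al a x)).

Definition pos_part i x : R := dens (frame_at E x) i x - sqnorm (q i x) / n%:R
  + 16 / (n%:R * tau) * sqnorm (t i x).

Lemma Re_density i x : dom i x ->
  complex.Re ((vol (metric i x))%:C * herm2 (metric_at E x) (dbar1 A gam (frame_at E x) x) (be (frame_at E x) x)) =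
  - (pos_part i x + (- (16 / tau)) * complex.Re (t i x * conjc (e i x))).
Proof.
move=> di; rewrite (density_local di (frame_atP E x)) /pos_part /dens /sqnorm.
have -> : 16 / (n%:R * tau%:C) = (16 / (n%:R * tau))%:C :> C.
  by rewrite rmorphM fmorphV rmorphM /= !(rmorph_nat (real_complex R)).
have -> : 16 / tau%:C = (16 / tau)%:C :> C.
  by rewrite rmorphM fmorphV /= !(rmorph_nat (real_complex R)).
have -> : (n%:R : C)^-1 = (n%:R^-1)%:C by rewrite fmorphV /= !(rmorph_nat (real_complex R)).
move: (herm _ _ * herm _ _) (q i x * _) (t i x * _) (t i x * _) (\det _) (16 / _) (16 / _) (n%:R^-1) => [z1 z2] [w1 w2] [u1 u2] [v1 v2] d c c' m /=.
ring.
Qed.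

Lemma dens_frame a a' i x : dom i x -> triv a x -> triv a' x -> dens a i x = dens a' i x.
Proof.
move=> di ta ta'; have dj := triv_dom ta; have dj' := triv_dom ta'.
have [_ sal] := hal; have [_ _ tbe _] := hbe.
have gu := glue_unitary ta ta'.
have eb : b a x = kappa (bjac a a' x) *: (glue a a' x *m b a' x).
  rewrite /b (tbe a a')//= (betaE ta') pull2_s02; last exact: jacJ.
  by rewrite -!scalemxAr !scalerA mulrC.
rewrite /dens eb (sal a a')// hermZl hermZr !(herm_unitary _ _ gu).
rewrite (jac_cocycle di dj dj') det_mulmx.
have := kappa_norm (jacJ dj dj'); rewrite -/(bjac a a' x) => K.
rewrite [kappa _ * _]mulrA K -mulrA -[RHS]mulrA; congr (_ * _).
by case: (herm _ _ * herm _ _) => u v /=; rewrite mul0r subr0.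
Qed.

Lemma dens_cont i x : dom i x -> {for x, continuous (fun y => dens (frame_at E y) i y)}.
Proof.
move=> di; pose a := frame_at E x; have ta : triv a x by exact: frame_atP.
apply: (@near_eq_continuous R X (dens a i)).
  apply: filterS2 (near_dom di) (near_triv ta) => y dy ty.
  exact: dens_frame dy ty (frame_atP E y).
apply: contM; first by apply: det_jac_cont => //; exact: triv_dom.
have oU := triv_open a; have Ui := @triv_dom R X n E a.
have [sal _] := hal; have [sbe _ _ _] := hbe.
suff [] : contC (fun y => herm (b a y) (b a y) * herm (al a y) (al a y)) x by [].
have h (u : X -> 'cV[C]_n) : smoothmx_in (base a) (triv a) u -> contC (fun y => herm (u y) (u y)) x.
  move=> su; apply: (@contC_ext R X (fun y => \sum_r conjc (u y r 0) * u y r 0)).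
    by move=> y; rewrite herm_sum.
  apply: contC_sum => r; have c : contC (fun y => u y r 0) x.
    exact: (C1X_contC oU Ui (smoothC_C1 (su r 0)) ta).
  exact: contCM (contC_conj c) c.
by apply: contCM; apply: h; [exact: sbe|exact: sal].
Qed.

Lemma e_contC i x : dom i x -> contC (e i) x.
Proof. exact: (C1X_contC (@dom_open R X i) (fun _ h => h) (e02_C1 heta i)). Qed.

Lemma t_contC i x : dom i x -> contC (t i) x.
Proof.
move=> di; apply: contC_sum => p; apply: contC_sum => r.
apply: contCM; first exact: contC_cst.
have h k l : contC (pder i k (fun y => lm i y l)) x.
  have [c1 c2] := lam_C1 hA hA0 hxi i l; split.
    exact: (pd_cont (r := fun y => complex.Re (lm i y l)) (@dom_open R X i) (fun _ h => h) c1).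
  exact: (pd_cont (r := fun y => complex.Im (lm i y l)) (@dom_open R X i) (fun _ h => h) c2).
apply: (contC_ext _ (contCD (h p r) (contCM (contC_cst (-1) x) (h r p)))) => y.
by rewrite mulN1r.
Qed.

Lemma pos_part_cont i x : dom i x -> {for x, continuous (pos_part i)}.
Proof.
move=> di; have ct := t_contC di; have ce := e_contC di.
have cq : contC (q i) x.
  apply: contCM; first exact: contC_cst.
  apply: (contC_ext _ (contCD ct (contCM (contC_cst (- n%:R) x) ce))) => y.
  by rewrite mulNr.
have sq (f : X -> C) : contC f x -> {for x, continuous (fun y => sqnorm (f y))}.
  by move=> cf; have [] := contCM cf (contC_conj cf).
apply: contD; last by apply: contM; [exact: cont_cst|exact: sq].
apply: contB; first exact: dens_cont.
by apply: contM; [exact: sq|exact: cont_cst].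
Qed.

Lemma pos_part_split i x : dom i x ->
  [/\ sqnorm (q i x) <= dens (frame_at E x) i x, 0 <= pos_part i x &
      pos_part i x = 0 -> e i x = 0].
Proof.
move=> di; have ta := frame_atP E x; have dj := triv_dom ta; set a := frame_at E x in ta dj *.
have le1 : sqnorm (q i x) <= dens a i x.
  have qi := q_kappa di ta; have K := kappa_norm (jacJ di dj).
  have := herm_cauchy_schwarz (b a x) (al a x); rewrite lecE => /andP[_].
  rewrite /sqnorm /dens qi conjM mulrACA K; move: (herm _ _ * conjc _) (herm _ _ * herm _ _) => [u v] [w z] /=.
  by rewrite mul0r subr0; apply: ler_wpM2l; exact: ltW (det_jac_gt0 di dj).
have n0 : 0 < n%:R :> R by rewrite ltr0n n_gt0.
have n2' : 2 <= n%:R :> R by rewrite ler_nat.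
have c0 : 0 < 16 / (n%:R * tau) by rewrite divr_gt0// mulr_gt0.
have sq := sqnorm_ge0 (q i x); have st := sqnorm_ge0 (t i x).
have E1 : sqnorm (q i x) / n%:R <= sqnorm (q i x) / 2.
  by rewrite ler_wpM2l// lef_pV2// posrE.
have E2 : 0 <= 16 / (n%:R * tau) * sqnorm (t i x) by rewrite mulr_ge0// ltW.
split=> //; first by rewrite /pos_part -/a; lra.
rewrite /pos_part -/a => h.
have q0 : sqnorm (q i x) = 0 by lra.
have t0 : 16 / (n%:R * tau) * sqnorm (t i x) = 0 by move: h; rewrite q0 mul0r subr0; lra.
have {}t0 : t i x = 0.
  by apply: sqnorm_eq0; move/eqP: t0; rewrite mulf_eq0 (gt_eqF c0) => /eqP.
move/sqnorm_eq0: q0; rewrite /q t0 sub0r mulrN => /eqP; rewrite oppr_eq0 !mulf_eq0.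
rewrite realC_eq0 mulf_eq0 invr_eq0 (gt_eqF tau0) !pnatr_eq0 /= => /orP[/eqP n00|/eqP ->]; last by [].
by have := n_gt0; rewrite n00.
Qed.

Lemma ext_ge0 i (r : X -> R) : (forall x, dom i x -> 0 <= r x) -> 0 <= int4 (ext i r).
Proof.
move=> h; apply: int4_ge0 => y; rewrite /ext; case: asboolP => [cy|_]; last exact: lexx.
exact: h (icoord_dom cy).
Qed.

Lemma energy_ge0 : 0 <= \sum_i int4 (ext i (fun x => @pou R X i x * complex.Re ((vol (metric i x))%:C *
    herm1 (metric_at E x) (gam (frame_at E x) x) (gam (frame_at E x) x)))).
Proof.
apply: sumr_ge0 => i _; apply: ext_ge0 => x dx.
have dj := triv_dom (frame_atP E x).
apply: mulr_ge0; first exact: (rho_ge0 rhoP).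
have gp v := @metric_pos R X _ x v dj.
have := herm1_ge0 (gam (frame_at E x) x) (Defs.metric_sym dj) gp.
rewrite /metric_at; case: (herm1 _ _ _) => u v /= u0; rewrite mul0r subr0.
apply: mulr_ge0 u0; apply: ltW; exact: vol_metric_gt0.
Qed.

Lemma pou_Cc i (r : X -> R) : (forall x, dom i x -> {for x, continuous r}) ->
  Cc (ext i (fun x => @pou R X i x * r x)).
Proof.
move=> cr; apply: (ext_Cc (@psupp_compact R X _ i) (@psupp_dom R X _ rhoP i)) => x dx.
  by apply: contM; [exact: (rho_cont rhoP)|exact: cr].
by move=> nK; rewrite (rho_out nK) mul0r.
Qed.

Lemma int_pos_part : \sum_i int4 (ext i (fun x => @pou R X i x * pos_part i x)) <= 0.
Proof.
have [gamP /(_ gam gamP)] := hstar.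
move=> h0.
have eqL := etrans (esym (Re_integral (fun x => herm2 (metric_at E x) (dbar1 A gam (frame_at E x) x) (be (frame_at E x) x))))
  (etrans (congr1 (@complex.Re R) h0)
     (Re_integral (fun x => herm1 (metric_at E x) (gam (frame_at E x) x) (gam (frame_at E x) x)))).
have r0 := energy_ge0; rewrite -eqL in r0.
have Cp i := pou_Cc (@pos_part_cont i).
have Ct i : Cc (ext i (fun x => @pou R X i x * complex.Re (t i x * conjc (e i x)))).
  by apply: pou_Cc => x dx; exact: (contCM (t_contC dx) (contC_conj (e_contC dx))).1.
clear eqL.
have E1 i : int4 (ext i (fun x => @pou R X i x * complex.Re ((vol (metric i x))%:C *
    herm2 (metric_at E x) (dbar1 A gam (frame_at E x) x) (be (frame_at E x) x)))) =
    - int4 (ext i (fun x => @pou R X i x * pos_part i x)) +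
    16 / tau * int4 (ext i (fun x => @pou R X i x * complex.Re (t i x * conjc (e i x)))).
  rewrite -mulN1r -(int4Z _ (Cp i)) -(int4Z _ (Ct i)) -int4D; [|exact: CcZ|exact: CcZ].
  congr int4; apply/funext => y; rewrite /ext; case: asboolP => cy; last by rewrite !mulr0 addr0.
  rewrite Re_density; last exact: icoord_dom.
  move: (pos_part _ _) (complex.Re _) (pou _ _) (16 / tau) => u v w z; ring.
have st : \sum_i int4 (ext i (fun x => @pou R X i x * complex.Re (t i x * conjc (e i x)))) = 0.
  exact: (@stokes R X (@pou R X) rhoP lm eta (lam_C1 hA hA0 hxi) (lam_tensor A A0 hxi) heta him hhol).
rewrite (eq_bigr _ (fun i _ => E1 i)) big_split /= -mulr_sumr st mulr0 addr0 sumrN in r0.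
by rewrite -oppr_ge0.
Qed.

Lemma eta02_eq0 i x : dom i x -> e i x = 0.
Proof.
have Cp j := pou_Cc (@pos_part_cont j).
have g0 j : forall y, 0 <= ext j (fun x => @pou R X j x * pos_part j x) y.
  move=> y; rewrite /ext; case: asboolP => [cy|_]; last exact: lexx.
  by apply: mulr_ge0; [exact: (rho_ge0 rhoP)|have [] := pos_part_split (icoord_dom cy)].
have I0 j : int4 (ext j (fun x => @pou R X j x * pos_part j x)) = 0.
  have S0 : \sum_j int4 (ext j (fun x => @pou R X j x * pos_part j x)) = 0.
    by apply/eqP; rewrite eq_le int_pos_part sumr_ge0// => k _; exact: int4_ge0.
  move/eqP: S0; rewrite psumr_eq0 => [/allP/(_ j (mem_index_enum j))/eqP//|k _].
  exact: int4_ge0.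
have [j rj] : exists j, @pou R X j x != 0.
  apply: contrapT => H; have := rho_sum rhoP x; rewrite big1 => [|j _].
    by move/eqP; rewrite eq_sym oner_eq0.
  by apply/eqP/negPn/negP => h; apply: H; exists j.
have dj : dom j x by apply: (psupp_dom rhoP); exact: subset_closure.
have [_ p0 pe] := pos_part_split dj.
have Pj : pos_part j x = 0.
  apply/eqP; rewrite eq_le p0 andbT leNgt; apply/negP => pp.
  have pos : 0 < ext j (fun x => @pou R X j x * pos_part j x) (Defs.coord j x).
    rewrite /ext asboolT; last exact: chart_coord.
    rewrite coordK//; apply: mulr_gt0 => //.
    by rewrite lt_neqAle eq_sym rj; exact: (rho_ge0 rhoP).
  by have := int4_gt0 (Cp j) (g0 j) pos; rewrite I0 ltxx.
move=> di; have := e02_kappa heta di dj; rewrite -/(e i x) -/(e j x) => ->.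
by rewrite pe// mulr0.
Qed.

End Monopole.

Theorem corollary4p5 (R : realType) (X : kahlerSurface R)
    (hb : (1 < b2plus X)%N)
    (n : nat) (hn : (2 <= n)%N) (E : hermBundle X n) (hc : c1_type11 E)
    (eta : sform2 X) (heta : is_form2 eta) (hsd : selfdual eta)
    (him : imaginary2 eta) (hhol : holomorphic20 eta) (hnz : nonzero20 eta)
    (tau : R) (htau0 : 0 < tau) (htau1 : tau <= 1) :
  moduli_space E tau eta = set0.
Proof.
rewrite -subset0 => O [[[al be] A] /= [[hal hbe hA] [gam [hstar hdirac]] hF _] _].
have [A0 [theta [xi [hA0 [_ _ htheta] hxi hc1]]]] := hc.
have [i [x [k [l [di]]]]] := hnz.
rewrite part20_conj; last by move=> p q; exact: him.
have [_ alt _] := heta; rewrite (part02E (alt i x di)).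
rewrite -/(e02 eta i x) (eta02_eq0 (pou_partition hb) hn htau0 heta him hhol hA hA0 htheta hxi hc1 hal hbe hstar hdirac hF di).
by rewrite scaler0 conjc0 oppr0 eqxx.
Qed.
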